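(* Let $G$ be a (possibly infinite dimensional) Lie group with Lie algebra $\mathfrak g$, and $\langle\ ,\ \rangle$ a positive definite bounded (weak) inner product on $\mathfrak g$ such that for all $\xi\in\mathfrak g$ the adjoint $\mathrm{ad}(\xi)^\top$ exists and $\xi\mapsto\mathrm{ad}(\xi)^\top$ is bounded. Let $g:\mathbb R^2\to G$, $(t,s)\mapsto g(t,s)$, be smooth such that $t\mapsto g(t,s)$ is, for each $s$, a geodesic of the right invariant metric defined by $\langle\ ,\ \rangle$. Put $u=T(\mu^{g^{-1}})\cdot\partial_tg$ and $y=T(\mu^{g^{-1}})\cdot\partial_sg$ (so $u$ is the right trivialized velocity, $u_t=-\mathrm{ad}(u)^\top u$, and $y$ is the right trivialized Jacobi field of the variation). Then $y$ satisfies the Jacobi equation $$y_{tt}=[\mathrm{ad}(y)^\top+\mathrm{ad}(y),\mathrm{ad}(u)^\top]u-\mathrm{ad}(u)^\top y_t-\alpha(u)y_t+\mathrm{ad}(u)y_t .$$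
   Context: $\mu^y(x)=xy$ is right translation; the bracket on $\mathfrak g=T_eG$ is the usual one (from left invariant vector fields), $\mathrm{ad}(\xi)\eta=[\xi,\eta]$, $\langle\mathrm{ad}(\xi)\eta,\zeta\rangle=\langle\eta,\mathrm{ad}(\xi)^\top\zeta\rangle$, and $\alpha(\xi)\eta:=\mathrm{ad}(\eta)^\top\xi$. The right invariant metric is $G_x(\xi,\eta)=\langle T(\mu^{x^{-1}})\xi,T(\mu^{x^{-1}})\eta\rangle$; a curve is a geodesic iff its right logarithmic derivative $u$ satisfies $u_t=-\mathrm{ad}(u)^\top u$. Commutators of linear operators on $\mathfrak g$ are denoted $[\ ,\ ]$. Infinite dimensional Lie groups are understood in the sense of convenient calculus. *)

(* Defs.v *)
(* MathComp / MathComp-Analysis *)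
From HB Require Import structures.
From mathcomp Require Import all_boot all_order all_algebra.
From mathcomp Require Import all_classical all_reals all_analysis.

Set Implicit Arguments.
Unset Strict Implicit.
Unset Printing Implicit Defensive.

Import Order.TTheory GRing.Theory Num.Theory.
Import numFieldNormedType.Exports.

Local Open Scope classical_set_scope.
Local Open Scope ring_scope.

(* Convenient calculus (Froelicher, Kriegl, Michor).  [tvsType R] is the type
   of locally convex spaces.  The library's [derivable] and [derive1] are
   restricted to normed codomains, hence the versions below. *)

Section Curves.
Context {R : realType} {E : tvsType R}.
Implicit Types (c : R -> E) (t : R).

Definition diffquot c t : R -> E := fun h => h^-1 *: (c (h + t) - c t).

Definition cderivable c t : Prop :=
  exists v : E, diffquot c t @ 0^' --> v.

(* 0 if the limit does not exist *)
Definition cderiv c t : E := xget 0 [set v | diffquot c t @ 0^' --> v].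

(* The germ of [c] at [t] is smooth: all iterated derivatives exist on a
   neighbourhood of [t] that does not depend on their order.  Working with
   germs allows for curves defined on an open interval only; after
   reparametrization every such germ extends to a smooth curve on the whole
   line, so the notions below are the usual ones. *)
Definition smooth_at c t : Prop :=
  \forall s \near t, forall n : nat, cderivable (iter n cderiv c) s.

(* openness in the final topology of the smooth curves *)
Definition cinfty_open (O : set E) : Prop :=
  forall c t, smooth_at c t -> O (c t) -> \forall s \near t, O (c s).

(* von Neumann boundedness *)
Definition vn_bounded (B : set E) : Prop :=
  forall U, nbhs (0 : E) U ->
    exists2 r : R, 0 < r & B `<=` [set r *: x | x in U].

End Curves.

(* A map on a c^oo-open set is smooth if it maps smooth curves to smooth
   curves. *)
Definition smooth_map (R : realType) (E F : tvsType R) (O : set E)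
    (f : E -> F) : Prop :=
  forall (c : R -> E) (t : R),
    smooth_at c t -> (\forall s \near t, O (c s)) -> smooth_at (f \o c) t.

(* For [F = E], boundedness of [f] as a map from E to the space L(E, E) of
   bounded operators, with the topology of uniform convergence on bounded
   sets. *)
Definition bounded2 (R : realType) (E F : tvsType R) (f : E -> E -> F) : Prop :=
  forall A B : set E, vn_bounded A -> vn_bounded B ->
    vn_bounded [set f x y | x in A & y in B].

(* Among the equivalent forms of c^oo-completeness: a curve is smooth as soon
   as its compositions with all continuous linear functionals are. *)
Definition convenient (R : realType) (E : tvsType R) : Prop :=
  hausdorff_space E /\
  forall (c : R -> E) (t : R),
    (\forall s \near t, forall l : {linear E -> R^o},
       continuous l -> smooth_at (l \o c) s) ->
    smooth_at c t.

(* [cmap] is only meaningful on [cdom], and [cinv] on [cmap @` cdom]. *)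
Record chart (R : realType) (E : tvsType R) (G : Type) := Chart {
  cdom : set G ;
  cmap : G -> E ;
  cinv : E -> G }.

Section Manifold.
Context {R : realType} {E : tvsType R} {G : Type}.
Implicit Types (A : set (chart E G)) (a b : chart E G).

Definition is_atlas A : Prop :=
  [/\ forall x : G, exists2 a, A a & cdom a x,
      forall a x, A a -> cdom a x -> cinv a (cmap a x) = x,
      forall a b, A a -> A b ->
        cinfty_open (cmap a @` (cdom a `&` cdom b)) &
      forall a b, A a -> A b ->
        smooth_map (cmap a @` (cdom a `&` cdom b)) (cmap b \o cinv a)].

Definition msmooth_at A (c : R -> G) (t : R) : Prop :=
  exists2 a, A a &
    (\forall s \near t, cdom a (c s)) /\ smooth_at (cmap a \o c) t.

Definition msmooth A (c : R -> G) : Prop := forall t, msmooth_at A c t.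

(* smoothness of a map from the plane to G, a smooth curve in the plane being
   a pair of smooth functions *)
Definition msmooth2 A (g : R -> R -> G) : Prop :=
  forall (p q : R -> R^o) (r : R), smooth_at p r -> smooth_at q r ->
    msmooth_at A (fun k => g (p k) (q k)) r.

End Manifold.

(* A Lie group modelled on E.  All charts of a Lie group may be modelled on
   the same space, by translation.  Maps between manifolds are smooth iff they
   map smooth curves to smooth curves, and a smooth curve in [G * G] is a pair
   of smooth curves in [G].  No separation axiom is imposed on G. *)
Definition is_lie_group (R : realType) (E : tvsType R) (G : groupType)
    (A : set (chart E G)) : Prop :=
  [/\ convenient E, is_atlas A,
      forall (c d : R -> G) t, msmooth_at A c t -> msmooth_at A d t ->
        msmooth_at A (fun k => c k * d k)%g t &
      forall (c : R -> G) t, msmooth_at A c t ->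
        msmooth_at A (fun k => (c k)^-1)%g t].

(* The Lie algebra T_e G is identified with the model space E by means of a
   chart [a] whose domain contains the unit. *)
Section LieAlgebra.
Context {R : realType} {E : tvsType R} {G : groupType}.
Variable a : chart E G.

(* The left invariant vector field x |-> T(mu_x) xi in the chart [a]: its value
   at x = cinv a p is the velocity at r = 0 of r |-> x * c(r), where c is the
   curve through the unit with velocity xi that is a straight line in the
   chart. *)
Definition left_invariant (xi p : E) : E :=
  let c r := cinv a (cmap a 1%g + r *: xi) in
  cderiv (fun r => cmap a (cinv a p * c r)%g) 0.

(* [X, Y] = dY(X) - dX(Y) at the unit, for X and Y the left invariant vector
   fields of xi and eta *)
Definition ad (xi eta : E) : E :=
  cderiv (fun r => left_invariant eta (cmap a 1%g + r *: xi)) 0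
  - cderiv (fun r => left_invariant xi (cmap a 1%g + r *: eta)) 0.

(* Right logarithmic derivative T(mu^{c(t)^-1}) c'(t): the velocity at h = t of
   the curve h |-> c(h) c(t)^-1. *)
Definition rlog (c : R -> G) (t : R) : E :=
  cderiv (fun h => cmap a (c h * (c t)^-1)%g) t.

Definition is_inner_product (ip : E -> E -> R^o) : Prop :=
  [/\ forall z, scalar (ip ^~ z), forall x y, ip x y = ip y x,
      forall x, x != 0 -> 0 < ip x x & bounded2 ip].

(* [adT xi] is the transpose of [ad xi]; it is unique, and linear, as [ip] is
   positive definite. *)
Definition is_transpose (ip : E -> E -> R^o) (adT : E -> E -> E) : Prop :=
  forall xi eta zeta, ip (ad xi eta) zeta = ip eta (adT xi zeta).

(* The geodesics of the right invariant metric
   G_x(v, w) = ip (T(mu^{x^-1}) v) (T(mu^{x^-1}) w), by way of their equation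
   u_t = - ad(u)^T u for the right logarithmic derivative u. *)
Definition geodesic (A : set (chart E G)) (adT : E -> E -> E) (c : R -> G)
    : Prop :=
  msmooth A c /\
  forall t, cderiv (rlog c) t = - adT (rlog c t) (rlog c t).

End LieAlgebra.

Definition alpha (E : Type) (adT : E -> E -> E) (xi eta : E) : E := adT eta xi.

Definition opcomm (E : zmodType) (S T : E -> E) : E -> E :=
  fun x => S (T x) - T (S x).

(* Main.v *)
Require Import Defs.
From mathcomp Require Import all_boot all_order all_algebra.
From mathcomp Require Import all_classical all_reals all_analysis.
From mathcomp Require Import lra ring zify.
Import Order.TTheory GRing.Theory Num.Theory.
Import numFieldNormedType.Exports.
Local Open Scope classical_set_scope.
Local Open Scope ring_scope.

(** Write u_t, u_s for derivatives of u, and so on.  The equation is the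
    derivative in t of the zero curvature equation
      y_t = u_s + ad u y,
    that relates the logarithmic derivatives u and y of any smooth map from
    the plane to G (zero_curvature).  Indeed
      y_tt = u_st + ad u_t y + ad u y_t,
    where u_st = u_ts is the derivative in s of - ad(u)^T u, so that
      y_tt = - ad(u_s)^T u - ad(u)^T u_s - ad (ad(u)^T u) y + ad u y_t
    with u_s = y_t - ad u y.  The term ad(ad u y)^T u is a commutator of
    transposes, by the transpose adT_ad of the Jacobi identity ad_jacobi, and
    the result is a rearrangement of the equation.

    The ingredients are to be derived from smoothness along curves alone.  A
    function of two real variables that is smooth along smooth curves has
    partial derivatives of the same kind (smooth2_at_d1), and its second
    derivatives are symmetric (schwarz).  For functions with values in R this
    is the part of Boman's theorem in param_deriv, whose proof goes as follows.
    A smooth curve can run along segments of straight lines through any fast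
    converging sequence of points (special_coordinate), so that all
    directional derivatives are locally bounded (directional_bound).  Mixed
    differences are linear combinations of differences in single directions
    (polarization), hence obey similar bounds, and derivatives of any order in
    one variable are locally Lipschitz in the other one
    (iter_deriv_lipschitz); this makes difference quotients in one variable
    converge together with their derivatives in the other.  A convenient space
    has enough continuous functionals to carry this over to its curves.

    Two consequences replace the differential calculus on E and G.  The
    derivative along the diagonal of the plane is the sum of the partial
    derivatives (cderiv_diag): a variable that occurs in several places can be
    differentiated in one place at a time.  And the derivative of a smooth map
    along a curve depends only on the velocity of the curve
    (chain_velocity, from Hadamard's lemma).  With these, the bracket of the
    velocities of c and d is the mixed derivative of
    c r * d s * (c r)^-1 (mixed_conj); as Ad g preserves the bracket (Ad_ad),
    its derivative at the unit is the Jacobi identity. *)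

(** * Derivatives of curves *)

Section CurveDerivatives.
Set Implicit Arguments.
Unset Strict Implicit.
Context {R : realType}.

Definition is_cderiv {E : tvsType R} (c : R -> E) (t : R) (v : E) : Prop :=
  diffquot c t @ 0^' --> v.

Lemma is_cderivE (E : tvsType R) (c : R -> E) (t : R) v :
  hausdorff_space E -> is_cderiv c t v -> cderiv c t = v.
Proof.
move=> hE cv; rewrite /cderiv; case: xgetP => [w -> /= cw|/(_ v)//].
exact: (cvg_unique hE cw cv).
Qed.

Lemma cderivP (E : tvsType R) (c : R -> E) (t : R) :
  cderivable c t -> is_cderiv c t (cderiv c t).
Proof.
by move=> [v cv]; rewrite /cderiv; case: xgetP => [w -> //|/(_ v)].
Qed.

Lemma near_shift0 (t : R) (P : R -> Prop) :
  (\forall s \near t, P s) -> \forall h \near 0^', P (h + t).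
Proof.
move=> nP; apply: cvg_within => /=.
have : (fun h : R => h + t) @ (0 : R) --> t.
  by rewrite -{2}[t]add0r; apply: cvgD; [exact: cvg_id|exact: cvg_cst].
by apply.
Qed.

Lemma near_is_cderiv (E : tvsType R) (c d : R -> E) (t : R) v :
  (\forall s \near t, c s = d s) -> is_cderiv c t v -> is_cderiv d t v.
Proof.
move=> cd; apply: cvg_trans; apply: near_eq_cvg.
have := near_shift0 cd; apply: filterS => h.
by rewrite /diffquot (nbhs_singleton cd) => ->.
Qed.

Lemma near_cderiv (E : tvsType R) (c d : R -> E) (t : R) :
  (\forall s \near t, c s = d s) -> cderiv c t = cderiv d t.
Proof.
move=> cd; rewrite /cderiv; congr xget; apply/seteqP; split=> v /=.
  exact: near_is_cderiv.
by apply: near_is_cderiv; apply: filterS cd => s ->.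
Qed.

Lemma near_iter_cderiv (E : tvsType R) (c d : R -> E) (t : R) (n : nat) :
  (\forall s \near t, c s = d s) ->
  \forall s \near t, iter n cderiv c s = iter n cderiv d s.
Proof.
elim: n => // n IHn cd /=.
have := IHn cd => /near_join; apply: filterS => s; exact: near_cderiv.
Qed.

Lemma near_cderivable (E : tvsType R) (c d : R -> E) (t : R) :
  (\forall s \near t, c s = d s) -> cderivable c t -> cderivable d t.
Proof. by move=> cd [v cv]; exists v; apply: near_is_cderiv cv. Qed.

Lemma near_smooth_at (E : tvsType R) (c d : R -> E) (t : R) :
  (\forall s \near t, c s = d s) -> smooth_at c t -> smooth_at d t.
Proof.
move=> /near_join cd sc; near=> s => n.
have cds : \forall s \near s, c s = d s by near: s.
apply: near_cderivable (near_iter_cderiv n cds) _.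
by move: n; near: s.
Unshelve. all: by end_near. Qed.

Lemma smooth_at_near (E : tvsType R) (c : R -> E) (t : R) :
  smooth_at c t -> \forall s \near t, smooth_at c s.
Proof. by move=> /near_join. Qed.

Lemma smooth_at_is_cderiv (E : tvsType R) (c : R -> E) (t : R) :
  smooth_at c t -> is_cderiv c t (cderiv c t).
Proof. by move=> /nbhs_singleton /(_ 0) /cderivP. Qed.

Lemma smooth_at_deriv (E : tvsType R) (c : R -> E) (t : R) :
  smooth_at c t -> smooth_at (cderiv c) t.
Proof.
by apply: filterS => s sc n; rewrite -iterSr.
Qed.

Lemma smooth_at_iter (E : tvsType R) (c : R -> E) (t : R) (n : nat) :
  smooth_at c t -> smooth_at (iter n cderiv c) t.
Proof. by move=> sc; elim: n => //= n; exact: smooth_at_deriv. Qed.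

(** Recognizing smoothness from a whole sequence of successive derivatives
    avoids computing the iterated derivatives themselves. *)
Lemma smooth_tower (E : tvsType R) (Q : nat -> R -> E) (t : R) :
  hausdorff_space E ->
  (\forall s \near t, forall n, is_cderiv (Q n) s (Q n.+1 s)) ->
  smooth_at (Q 0) t /\ \forall s \near t, forall n, iter n cderiv (Q 0) s = Q n s.
Proof.
move=> hE Qt.
have itE : \forall s \near t, forall n, iter n cderiv (Q 0) s = Q n s.
  apply: filterS (near_join Qt) => s Qs n.
  elim: n s Qs => // n IHn s Qs /=.
  transitivity (cderiv (Q n) s).
    by apply: near_cderiv; apply: filterS (near_join Qs) => r; exact: IHn.
  exact: is_cderivE (nbhs_singleton Qs n).
split=> //; near=> s => n; exists (Q n.+1 s).
apply: (@near_is_cderiv _ (Q n)); last by move: n; near: s.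
have : \forall s \near s, forall n, iter n cderiv (Q 0) s = Q n s.
  by near: s; apply: near_join itE.
by apply: filterS => r ->.
Unshelve. all: by end_near. Qed.

Lemma cvgZ_tvs (E : tvsType R) (T : Type) (F : set_system T) {FF : Filter F}
    (a : T -> R) (c : T -> E) (k : R) v :
  a @ F --> (k : R^o) -> c @ F --> v -> (fun x => a x *: c x) @ F --> k *: v.
Proof.
move=> ak cv.
apply: (@cvg_comp _ _ _ (fun x => (a x : R^o, c x)) (fun z : R^o * E => z.1 *: z.2)).
  exact: (cvg_pair ak cv).
exact: (@scale_continuous R E (k, v)).
Qed.

Lemma cvgD_tvs (E : tvsType R) (T : Type) (F : set_system T) {FF : Filter F}
    (c d : T -> E) v w :
  c @ F --> v -> d @ F --> w -> (fun x => c x + d x) @ F --> v + w.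
Proof.
move=> cv dw.
apply: (@cvg_comp _ _ _ (fun x => (c x, d x)) (fun z : E * E => z.1 + z.2)).
  exact: (cvg_pair cv dw).
exact: (@add_continuous E (v, w)).
Qed.

Lemma is_cderiv_continuous (E : tvsType R) (c : R -> E) (t : R) v :
  is_cderiv c t v -> c s @[s --> t] --> c t.
Proof.
move=> cv.
have H : (fun h : R => h *: diffquot c t h + c t) @ 0^' --> 0 *: v + c t.
  apply: cvgD_tvs; last exact: cvg_cst.
  by apply: cvgZ_tvs => //; apply: cvg_within_filter; exact: cvg_id.
rewrite scale0r add0r in H.
have H1 : (fun h : R => c (h + t)) @ (0 : R) --> c t.
  rewrite -[X in _ --> X]/(c t) -[in X in _ --> X](add0r t).
  apply/(@continuous_withinNx R E (fun h => c (h + t)) 0).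
  rewrite add0r; apply: cvg_trans H; apply: near_eq_cvg.
  near=> h; rewrite /diffquot scalerA divff ?scale1r ?subrK//.
  by near: h; exact: nbhs_dnbhs_neq.
move=> U /H1; rewrite /nbhs /= => -[e /= e0 eU].
exists e => //= s; rewrite /ball_ /= => ts.
by have := eU (s - t); rewrite /ball_ /= subrK; apply; rewrite sub0r opprB.
Unshelve. all: by end_near. Qed.

Lemma is_cderiv_linear (E F : tvsType R) (l : {linear E -> F}) (c : R -> E) (t : R) v :
  continuous l -> is_cderiv c t v -> is_cderiv (l \o c) t (l v).
Proof.
move=> cl cv; apply: cvg_trans (cvg_comp _ _ cv (cl v)).
apply: near_eq_cvg; near=> h.
by rewrite /diffquot /= linearZ_LR linearB.
Unshelve. all: by end_near. Qed.

Lemma is_cderiv_derive (f : R -> R) (t v : R) :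
  is_cderiv (f : R -> R^o) t v <-> is_derive t 1 f v.
Proof.
have E : diffquot (f : R -> R^o) t = (fun h => h^-1 *: ((f \o shift t) (h *: 1) - f t)).
  by apply/funext => h; rewrite /diffquot /= scaler1.
rewrite /is_cderiv E; split => [fv|[d <-]//].
by apply: DeriveDef; [by apply/cvg_ex; exists v|exact: cvg_lim fv].
Qed.

Lemma Ro_hausdorff : hausdorff_space (R^o : tvsType R).
Proof. exact: Rhausdorff. Qed.

End CurveDerivatives.

(** * Smooth functions of one real variable *)

Section ScalarSmooth.
Set Implicit Arguments.
Unset Strict Implicit.
Context {R : realType}.
Implicit Types (f g : R -> R) (U V : set R) (s t : R).

Lemma derD f g s a b : is_derive s 1 f a -> is_derive s 1 g b ->
  is_derive s 1 (fun x => f x + g x) (a + b).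
Proof. exact: is_deriveD. Qed.

Lemma derN f s a : is_derive s 1 f a -> is_derive s 1 (fun x => - f x) (- a).
Proof. exact: is_deriveN. Qed.

Lemma derB f g s a b : is_derive s 1 f a -> is_derive s 1 g b ->
  is_derive s 1 (fun x => f x - g x) (a - b).
Proof. exact: is_deriveB. Qed.

Lemma derM f g s a b : is_derive s 1 f a -> is_derive s 1 g b ->
  is_derive s 1 (fun x => f x * g x) (a * g s + f s * b).
Proof.
move=> fa gb; have := is_deriveM fa gb => H.
by apply: (is_derive_eq H); rewrite addrC [a * _]mulrC.
Qed.

Lemma derV f s a : f s != 0 -> is_derive s 1 f a ->
  is_derive s 1 (fun x => (f x)^-1) (- (a * ((f s)^-1 * (f s)^-1))).
Proof.
move=> fs fa; have H := is_deriveV fs fa.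
by apply: (is_derive_eq H); rewrite -invfM -expr2 scaleNr [in RHS]mulrC.
Qed.

Lemma der_comp f g s a b : is_derive s 1 f a -> is_derive (f s) 1 g b ->
  is_derive s 1 (fun x => g (f x)) (a * b).
Proof.
move=> fa gb; have H := is_derive1_comp gb fa.
by apply: (is_derive_eq H); rewrite /= mulrC.
Qed.

Lemma der_cst (a : R) s : is_derive s 1 (fun=> a : R) 0.
Proof. exact: is_derive_cst. Qed.

Lemma der_id s : is_derive s 1 (fun x : R => x) 1.
Proof. exact: is_derive_id. Qed.

Lemma der_continuous f s a : is_derive s 1 f a -> f x @[x --> s] --> f s.
Proof. by move=> /is_cderiv_derive /is_cderiv_continuous. Qed.

Lemma der_near f g s a : (\forall x \near s, f x = g x) ->
  is_derive s 1 f a -> is_derive s 1 g a.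
Proof. exact: near_eq_is_derive. Qed.

(** Differentiability of order n on U.  Induction on n yields closure under the
    algebraic operations and composition without the formulas of Leibniz and
    Faa di Bruno for iterated derivatives. *)
Fixpoint Dn U (n : nat) f : Prop :=
  if n is m.+1 then
    exists2 f', (forall s, U s -> is_derive s 1 f (f' s)) & Dn U m f'
  else True.

Definition ssmooth U f := forall n, Dn U n f.

Lemma DnS U n f : Dn U n.+1 f -> Dn U n f.
Proof. by elim: n f => // n IHn f [f' ff' /IHn ?]; exists f'. Qed.

Lemma Dn_ext U n f g : open U -> (forall s, U s -> f s = g s) ->
  Dn U n f -> Dn U n g.
Proof.
case: n => // n oU fg [f' ff' Df']; exists f' => // s Us.
by apply: der_near (ff' s Us); near=> x; apply: fg; near: x; exact: open_nbhs_nbhs.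
Unshelve. all: by end_near. Qed.

Lemma Dn_sub U V n f : V `<=` U -> Dn U n f -> Dn V n f.
Proof.
move=> VU; elim: n f => // n IHn f [f' ff' /IHn ?]; exists f' => // s /VU; exact: ff'.
Qed.

Lemma Dn_cst U n (a : R) : Dn U n (fun=> a).
Proof. by elim: n a => // n IHn a; exists (fun=> 0) => // s _; exact: der_cst. Qed.

Lemma Dn_id U n : Dn U n id.
Proof. by case: n => // n; exists (fun=> 1) => [s _|]; [exact: der_id|exact: Dn_cst]. Qed.

Lemma DnD U n f g : Dn U n f -> Dn U n g -> Dn U n (fun x => f x + g x).
Proof.
elim: n f g => // n IHn f g [f' ff' Df] [g' gg' Dg].
by exists (fun x => f' x + g' x) => [s Us|]; [apply: derD; auto|exact: IHn].
Qed.

Lemma DnN U n f : Dn U n f -> Dn U n (fun x => - f x).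
Proof.
elim: n f => // n IHn f [f' ff' Df].
by exists (fun x => - f' x) => [s Us|]; [apply: derN; auto|exact: IHn].
Qed.

Lemma DnM U n f g : Dn U n f -> Dn U n g -> Dn U n (fun x => f x * g x).
Proof.
elim: n f g => // n IHn f g /[dup] /DnS Df [f' ff' Df'] /[dup] /DnS Dg [g' gg' Dg'].
exists (fun x => f' x * g x + f x * g' x) => [s Us|]; first by apply: derM; auto.
by apply: DnD; exact: IHn.
Qed.

Lemma DnV U n f : (forall s, U s -> f s != 0) ->
  Dn U n f -> Dn U n (fun x => (f x)^-1).
Proof.
move=> f0; elim: n => // n IHn /[dup] /DnS Df [f' ff' Df'].
exists (fun x => - (f' x * ((f x)^-1 * (f x)^-1))) => [s Us|].
  by apply: derV; [exact: f0|exact: ff'].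
by apply/DnN/DnM/DnM; auto.
Qed.

Lemma Dn_comp U V n f g : (forall s, U s -> V (f s)) ->
  Dn U n f -> Dn V n g -> Dn U n (fun x => g (f x)).
Proof.
move=> UV; elim: n g => // n IHn g /[dup] /DnS Df [f' ff' Df'] [g' gg' Dg'].
exists (fun x => f' x * g' (f x)) => [s Us|].
  by apply: der_comp; [exact: ff'|apply: gg'; exact: UV].
by apply: DnM => //; exact: IHn.
Qed.

Lemma Dn_derive U n f : open U -> Dn U n.+1 f ->
  Dn U n (derive1 f) /\ forall s, U s -> is_derive s 1 f (derive1 f s).
Proof.
move=> oU [f' ff' Df'].
have dE s : U s -> f' s = derive1 f s.
  by move=> /ff' fs; rewrite derive1E; apply/esym; exact: derive_val.
by split; [exact: Dn_ext Df'|move=> s Us; rewrite -dE//; exact: ff'].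
Qed.

Lemma ssmooth_tower U f : open U -> ssmooth U f ->
  forall n s, U s -> is_derive s 1 (derive1n n f) (derive1n n.+1 f s).
Proof.
move=> oU sf n; suff H : ssmooth U (derive1n n f).
  by have [_] := Dn_derive oU (H 1); rewrite derive1nS.
by elim: n => // n IHn m; rewrite derive1nS; exact: (Dn_derive oU (IHn m.+1)).1.
Qed.

Lemma ssmooth_at U f t : open U -> U t -> ssmooth U f ->
  smooth_at (f : R -> R^o) t /\
  \forall s \near t, forall n, iter n cderiv (f : R -> R^o) s = derive1n n f s.
Proof.
move=> oU Ut sf; apply: (@smooth_tower _ _ (fun n => derive1n n f : R -> R^o)).
  exact: Ro_hausdorff.
have : nbhs t U by exact: open_nbhs_nbhs.
by apply: filterS => s Us n; apply/is_cderiv_derive; exact: ssmooth_tower Us.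
Qed.

Lemma smooth_atP f t :
  smooth_at (f : R -> R^o) t <-> exists U, [/\ open U, U t & ssmooth U f].
Proof.
split=> [|[U [oU Ut sf]]]; last exact: (ssmooth_at oU Ut sf).1.
move=> sf; pose A : set R := [set s | forall n, cderivable (iter n cderiv (f : R -> R^o)) s].
exists A°; split; [exact: open_interior|exact: (sf : nbhs t A)|move=> n].
have sU s : A° s -> A s by exact: interior_subset.
suff H m : Dn A° n (iter m (@cderiv _ R^o) f) by exact: (H 0).
elim: n m => [|n IHn] m; first exact: I.
exists (iter m.+1 (@cderiv _ R^o) f) => // s /sU /(_ m).
by move=> /cderivP /is_cderiv_derive.
Qed.

Lemma smooth_at_der f t : smooth_at (f : R -> R^o) t ->
  is_derive t 1 f (cderiv (f : R -> R^o) t).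
Proof. by move=> /smooth_at_is_cderiv /is_cderiv_derive. Qed.

Lemma der_cderiv f t a : is_derive t 1 f a -> cderiv (f : R -> R^o) t = a.
Proof. by move=> /is_cderiv_derive; apply: is_cderivE; exact: Ro_hausdorff. Qed.

Lemma smooth_at_cst (a : R) t : smooth_at ((fun=> a) : R -> R^o) t.
Proof. by apply/smooth_atP; exists setT; split=> //; [exact: openT|move=> n; exact: Dn_cst]. Qed.

Lemma smooth_at_id t : smooth_at ((fun x => x) : R -> R^o) t.
Proof. by apply/smooth_atP; exists setT; split=> //; [exact: openT|move=> n; exact: Dn_id]. Qed.

Lemma smooth_atD f g t : smooth_at (f : R -> R^o) t -> smooth_at (g : R -> R^o) t ->
  smooth_at ((fun x => f x + g x) : R -> R^o) t.
Proof.
move=> /smooth_atP[U [oU Ut sf]] /smooth_atP[V [oV Vt sg]].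
apply/smooth_atP; exists (U `&` V); split=> //; first exact: openI.
by move=> n; apply: DnD; [apply: Dn_sub (sf n)|apply: Dn_sub (sg n)] => ? [].
Qed.

Lemma smooth_atM f g t : smooth_at (f : R -> R^o) t -> smooth_at (g : R -> R^o) t ->
  smooth_at ((fun x => f x * g x) : R -> R^o) t.
Proof.
move=> /smooth_atP[U [oU Ut sf]] /smooth_atP[V [oV Vt sg]].
apply/smooth_atP; exists (U `&` V); split=> //; first exact: openI.
by move=> n; apply: DnM; [apply: Dn_sub (sf n)|apply: Dn_sub (sg n)] => ? [].
Qed.

Lemma smooth_atN f t : smooth_at (f : R -> R^o) t ->
  smooth_at ((fun x => - f x) : R -> R^o) t.
Proof.
move=> /smooth_atP[U [oU Ut sf]]; apply/smooth_atP; exists U; split=> // n; exact: DnN.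
Qed.

Lemma smooth_atV f t : f t != 0 -> smooth_at (f : R -> R^o) t ->
  smooth_at ((fun x => (f x)^-1) : R -> R^o) t.
Proof.
move=> ft0 /smooth_atP[U [oU Ut sf]].
have cf s : U s -> f x @[x --> s] --> f s.
  by move=> Us; have [f' ff' _] := sf 1; exact: der_continuous (ff' s Us).
apply/smooth_atP; exists (U `&` [set s | f s != 0]); split=> //; last first.
  by move=> n; apply: DnV; [move=> s []|apply: Dn_sub (sf n) => ? []].
rewrite openE => s [Us fs]; apply: filterI; first exact: open_nbhs_nbhs.
by apply: (cf s Us [set y | y != 0]); apply: open_nbhs_nbhs; split => //; exact: open_neq.
Qed.

Lemma smooth_at_scomp f g t : smooth_at (f : R -> R^o) t ->
  smooth_at (g : R -> R^o) (f t) -> smooth_at ((fun x => g (f x)) : R -> R^o) t.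
Proof.
move=> /smooth_atP[U [oU Ut sf]] /smooth_atP[V [oV Vt sg]].
have cf s : U s -> f x @[x --> s] --> f s.
  by move=> Us; have [f' ff' _] := sf 1; exact: der_continuous (ff' s Us).
apply/smooth_atP; exists (U `&` f @^-1` V); split=> //.
  rewrite openE => s [Us Vs]; apply: filterI; first exact: open_nbhs_nbhs.
  by apply: (cf s Us V); exact: open_nbhs_nbhs.
move=> n; apply: (@Dn_comp _ V); [by move=> s []|by apply: Dn_sub (sf n) => ? []|exact: sg].
Qed.

End ScalarSmooth.

(** * Smooth curves through fast converging sequences *)

Section SpecialCurve.
Set Implicit Arguments.
Unset Strict Implicit.
Context {R : realType}.
Implicit Types (f g psi : R -> R) (alpha : nat -> R) (s t : R).

Lemma scaleRE (a b : R) : a *: (b : R^o) = a * b.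
Proof. by []. Qed.

(** A remainder of second order is what the functions below offer at the one
    point where they are not given by a formula. *)
Lemma der_quad f s a C :
  (\forall x \near s, `|f x - f s - a * (x - s)| <= C * (x - s) ^+ 2) ->
  is_derive s 1 f a.
Proof.
move=> fC; apply/is_cderiv_derive; rewrite /is_cderiv.
apply/cvgrPdist_le => /= e e0.
have C0 : 0 < `|C| + 1 by rewrite ltr_wpDl.
have H0 : \forall h \near (0 : R)^', `|h| <= e / (`|C| + 1).
  apply: cvg_within; exists (e / (`|C| + 1)); first by rewrite /= divr_gt0.
  by move=> h /=; rewrite sub0r normrN => /ltW.
have H1 := near_shift0 fC.
near=> h.
have h0 : h != 0 by near: h; exact: nbhs_dnbhs_neq.
have hn0 : 0 < `|h| by rewrite normr_gt0.
have K : `|f (h + s) - f s - a * h| <= C * h ^+ 2.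
  have : `|f (h + s) - f s - a * (h + s - s)| <= C * (h + s - s) ^+ 2 by near: h; exact: H1.
  by rewrite addrK.
rewrite /diffquot distrC -(ler_pM2l hn0) -normrM.
have -> : h * (h^-1 *: (f (h + s) - f s) - a) = f (h + s) - f s - a * h.
  by rewrite mulrBr scaleRE mulrA divff// mul1r [h * a]mulrC.
apply: (le_trans K).
have hle : `|h| <= e / (`|C| + 1) by near: h.
rewrite -normr_id in hn0.
apply: (@le_trans _ _ ((`|C| + 1) * `|h| ^+ 2)).
  by rewrite real_normK ?num_real// ler_wpM2r ?sqr_ge0// (le_trans (ler_norm _))// lerDl.
rewrite expr2 mulrCA ler_pM2l ?normr_gt0//.
by rewrite -ler_pdivlMl// mulrC.
Unshelve. all: by end_near. Qed.

(** The functions x^-k exp (-1/x), extended by 0: their derivatives are linear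
    combinations of functions of the same family. *)
Definition flat k x : R := if 0 < x then (x^-1) ^+ k * expR (- x^-1) else 0.

(** Write y as n + 1 times z = y / (n + 1): then exp y is the power of order
    n + 1 of exp z, which is at least z, and at least 1. *)
Lemma expRN_le (n : nat) (y : R) : 0 < y ->
  y ^+ n * expR (- y) <= n.+1%:R ^+ n.
Proof.
move=> y0; have n0 : (0 : R) < n.+1%:R by rewrite ltr0n.
have E : expR y = expR (y / n.+1%:R) ^+ n.+1.
  by rewrite -expRM_natl mulrC divfK// gt_eqF.
rewrite expRN ler_pdivrMr ?expR_gt0// E.
have z0 : 0 < y / n.+1%:R by rewrite divr_gt0.
rewrite [X in X ^+ n <= _](_ : y = n.+1%:R * (y / n.+1%:R)); last by rewrite mulrC divfK// gt_eqF.
rewrite exprMn ler_pM2l ?exprn_gt0//.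
have H : 1 + y / n.+1%:R <= expR (y / n.+1%:R) by exact: expR_ge1Dx.
have H1 : y / n.+1%:R <= expR (y / n.+1%:R) by apply: le_trans H; rewrite lerDr.
apply: (@le_trans _ _ (expR (y / n.+1%:R) ^+ n)).
  by rewrite lerXn2r ?nnegrE ?expR_ge0 ?(ltW z0).
by rewrite ler_weXn2l// (le_trans _ H)// lerDl ltW.
Qed.

Lemma der_flat k t : is_derive t 1 (flat k)
  ((- k%:R) * flat k.+1 t + flat k.+2 t).
Proof.
have [t0|t0|t0] := ltgtP t 0.
- rewrite /flat ltNge (ltW t0) /= mulr0 addr0.
  apply: (@der_near _ (fun=> 0)).
  near=> x; suff : x < 0 by move=> x0; rewrite ltNge (ltW x0).
  by near: x; exact: lt_nbhsl.
- apply: (@der_near _ (fun x => (x^-1) ^+ k * expR (- x^-1))).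
    near=> x; rewrite /flat; suff -> : 0 < x by [].
    by near: x; exact: lt_nbhsr.
  have tn0 : t != 0 by rewrite gt_eqF.
  have dV : is_derive t 1 (fun x : R => x^-1) (- (1 * (t^-1 * t^-1))).
    exact: (derV tn0 (der_id t)).
  have dE := der_comp (derN dV) (is_derive_expR (- t^-1)).
  have dX : is_derive t 1 (fun x : R => x^-1 ^+ k)
     (- (1 * (t^-1 * t^-1)) * (k%:R * (t^-1) ^+ k.-1)).
    have := @is_deriveX R R (fun x => x^-1) k t 1 _ dV.
    by rewrite exprfctE => H; apply: (is_derive_eq H); rewrite scaleRE mulrC.
  apply: (is_derive_eq (derM dX dE)).
  rewrite /flat t0; case: k {dX} => [|k]; last by rewrite /= !exprS; ring.
  by rewrite /= !exprS !expr0; ring.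
- rewrite t0 /flat ltxx mulr0 addr0.
  apply: (@der_quad _ _ _ (k.+3%:R ^+ k.+2)).
  near=> x; rewrite ltxx subr0 mul0r !subr0.
  case: ifPn => [x0|_]; last by rewrite normr0 mulr_ge0 ?sqr_ge0// exprn_ge0.
  have y0 : 0 < x^-1 by rewrite invr_gt0.
  rewrite ger0_norm; last by rewrite mulr_ge0 ?expR_ge0// exprn_ge0// ltW.
  rewrite -ler_pdivrMr ?exprn_gt0//; apply: le_trans (expRN_le k.+2 y0).
  by rewrite mulrAC -exprVn -exprD addn2.
Unshelve. all: by end_near. Qed.

Lemma ssmooth_flat k : ssmooth setT (flat k).
Proof.
move=> n; elim: n k => // n IHn k.
exists (fun t => (- k%:R) * flat k.+1 t + flat k.+2 t) => [s _|]; first exact: der_flat.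
by apply: DnD => //; apply: DnM => //; exact: Dn_cst.
Qed.

(** 0 on the left of 0 and 1 on the right of 1; the denominator never
    vanishes. *)
Definition step x : R := flat 0 x / (flat 0 x + flat 0 (1 - x)).

Lemma flat_ge0 k x : 0 <= flat k x.
Proof.
rewrite /flat; case: ifP => // x0; rewrite mulr_ge0 ?expR_ge0// exprn_ge0//.
by rewrite invr_ge0 ltW.
Qed.

Lemma flat0_gt0 x : 0 < x -> 0 < flat 0 x.
Proof. by move=> x0; rewrite /flat x0 expr0 mul1r expR_gt0. Qed.

Lemma flat_le0 k x : x <= 0 -> flat k x = 0.
Proof. by rewrite /flat ltNge => ->. Qed.

Lemma step_denom x : 0 < flat 0 x + flat 0 (1 - x).
Proof.
have [x0|x0] := ltP 0 x.
  by rewrite ltr_wpDr ?flat_ge0// flat0_gt0.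
by rewrite ltr_wpDl ?flat_ge0// flat0_gt0// subr_gt0 (le_lt_trans x0).
Qed.

Lemma ssmooth_step : ssmooth setT step.
Proof.
move=> n; apply: DnM; first exact: ssmooth_flat.
apply: DnV => [s _|]; first by rewrite gt_eqF// step_denom.
apply: DnD; first exact: ssmooth_flat.
apply: (@Dn_comp _ _ setT) => //; last exact: ssmooth_flat.
by apply: DnD; [exact: Dn_cst|apply/DnN/Dn_id].
Qed.

Lemma step_le0 x : x <= 0 -> step x = 0.
Proof. by move=> x0; rewrite /step flat_le0// mul0r. Qed.

Lemma step_ge1 x : 1 <= x -> step x = 1.
Proof.
move=> x1; rewrite /step (@flat_le0 0 (1 - x)) ?subr_le0// addr0 divff// gt_eqF//.
by rewrite flat0_gt0// (lt_le_trans _ x1).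
Qed.

(** A smooth function equal to 1 around 3/4 and to 0 around every point
    outside of the interval from 5/8 to 7/8. *)
Definition bump x : R := step (2 + 20 * (x - 3 / 4)) * step (2 - 20 * (x - 3 / 4)).

Lemma ssmooth_bump : ssmooth setT bump.
Proof.
move=> n; have A : Dn setT n (fun x : R => 20 * (x - 3 / 4)).
  apply: DnM; first exact: Dn_cst.
  by apply: DnD; [exact: Dn_id|exact: Dn_cst].
apply: DnM; apply: (@Dn_comp _ _ setT) => //; try exact: ssmooth_step.
  by apply: DnD A; exact: Dn_cst.
by apply: DnD (DnN A); exact: Dn_cst.
Qed.

Lemma bump1 x : `|x - 3 / 4| <= 1 / 20 -> bump x = 1.
Proof.
rewrite ler_norml => /andP[H1 H2].
by rewrite /bump !step_ge1 ?mulr1//; lra.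
Qed.

Lemma bump0 x : 1 / 10 <= `|x - 3 / 4| -> bump x = 0.
Proof.
rewrite ler_normr /bump => /orP[] H.
  by rewrite (@step_le0 (2 - _)) ?mulr0//; lra.
by rewrite step_le0 ?mul0r//; lra.
Qed.

(** The vanishing in a neighbourhood of each point outside the interval, end
    points included, makes this property stable under differentiation. *)
Definition dyadic_support psi := ssmooth setT psi /\
  forall x : R, ~~ (5 / 8 < x < 7 / 8) -> \forall y \near x, psi y = 0.

Lemma dyadic_support_bump psi : ssmooth setT psi ->
  dyadic_support (fun x => psi x * bump x).
Proof.
move=> sp; split=> [n|x]; first by apply: DnM => //; exact: ssmooth_bump.
move=> xN; near=> y.
have yx : `|x - y| < 1 / 40.
  by near: y; exists (1 / 40) => //=; lra.
rewrite bump0 ?mulr0//; rewrite ler_normr; move: yx xN.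
rewrite ltr_norml negb_and -!leNgt => /andP[Y1 Y2] /orP[X|X]; apply/orP.
  by right; lra.
by left; lra.
Unshelve. all: by end_near. Qed.

Lemma dyadic_support_derive psi : dyadic_support psi -> dyadic_support (derive1 psi).
Proof.
move=> [sp p0]; split=> [n|x /p0]; first exact: (Dn_derive openT (sp n.+1)).1.
move/near_join; apply: filterS => y py.
have H : is_derive y 1 psi 0.
  by apply: (@der_near _ (fun=> 0)); apply: filterS py => z ->.
by rewrite derive1E; exact: derive_val.
Qed.

Lemma dyadic_support_bounded psi : dyadic_support psi ->
  exists2 M, 0 < M & forall x, `|psi x| <= M.
Proof.
move=> [sp p0].
have cp : continuous psi.
  by move=> x; have [f' pf' _] := sp 1; exact: der_continuous (pf' x I).
have [||c _ cM] := @EVT_max R (fun x => `|psi x|) (5 / 8) (7 / 8); first lra.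
  by apply: continuous_subspaceT => x; apply: continuous_comp; [exact: cp|exact: norm_continuous].
exists (`|psi c| + 1) => [|x]; first by rewrite ltr_wpDl.
have [/andP[x1 x2]|/p0 /nbhs_singleton ->] := boolP (5 / 8 < x < 7 / 8); last first.
  by rewrite normr0 addr_ge0.
apply: (@le_trans _ _ `|psi c|); last by rewrite lerDl.
by apply: cM; rewrite in_itv /= !ltW.
Qed.

Definition rapid alpha :=
  forall k, exists2 C, 0 < C & forall n, `|alpha n| * (2 ^+ n) ^+ k <= C.

Definition dyadic_index t : nat := xget 0 [set n : nat | 5 / 8 < 2 ^+ n * t < 7 / 8].

(** The sum over n of alpha n * psi (2 ^ n t), for psi supported between 5/8
    and 7/8: the terms then have disjoint supports. *)
Definition dyadic_sum alpha psi t : R :=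
  alpha (dyadic_index t) * psi (2 ^+ dyadic_index t * t).

(** The range allowed for n contains a full dyadic period with some room on
    either side, so that the formula dyadic_sumE holds near every t > 0. *)
Lemma dyadic_uniq m n t : 5 / 8 < 2 ^+ m * t < 7 / 8 -> 7 / 16 < 2 ^+ n * t < 5 / 4 ->
  m = n.
Proof.
have two (i : nat) : (2 : R) <= 2 ^+ i.+1.
  by rewrite exprS ler_peMr// exprn_ege1// ler1n.
move=> /andP[m1 m2] /andP[n1 n2]; have [mn|nm|//] := ltngtP m n.
  have E : (2 : R) ^+ n * t = 2 ^+ (n - m.+1).+1 * (2 ^+ m * t).
    by rewrite mulrA -exprD; congr (_ ^+ _ * _); lia.
  exfalso; have := two (n - m.+1)%N; rewrite E in n1 n2; move: n1 n2 m1 m2.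
  move: (2 ^+ _) (2 ^+ _ * t) => a b a2 h1 h2 h3 h4; nra.
have E : (2 : R) ^+ m * t = 2 ^+ (m - n.+1).+1 * (2 ^+ n * t).
  by rewrite mulrA -exprD; congr (_ ^+ _ * _); lia.
exfalso; have := two (m - n.+1)%N; rewrite E in m1 m2; move: n1 n2 m1 m2.
move: (2 ^+ _) (2 ^+ _ * t) => a b a2 h1 h2 h3 h4; nra.
Qed.

Lemma dyadic_sumE alpha psi n t : dyadic_support psi ->
  7 / 16 < 2 ^+ n * t < 5 / 4 -> dyadic_sum alpha psi t = alpha n * psi (2 ^+ n * t).
Proof.
move=> [_ p0] tn; rewrite /dyadic_sum /dyadic_index; case: xgetP => [m _ /= mt|H].
  by rewrite (dyadic_uniq mt tn).
have pz m : psi (2 ^+ m * t) = 0.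
  have : ~~ (5 / 8 < 2 ^+ m * t < 7 / 8) by apply/negP; exact: H.
  by move/p0/nbhs_singleton.
by rewrite !pz !mulr0.
Qed.

Lemma dyadic_sum_le0 alpha psi t : dyadic_support psi -> t <= 0 ->
  dyadic_sum alpha psi t = 0.
Proof.
move=> [_ p0] t0; rewrite /dyadic_sum.
suff /p0 /nbhs_singleton -> : ~~ (5 / 8 < 2 ^+ dyadic_index t * t < 7 / 8) by rewrite mulr0.
have : 2 ^+ dyadic_index t * t <= 0 by rewrite mulr_ge0_le0// exprn_ge0.
by move=> H; rewrite negb_and -!leNgt; apply/orP; left; lra.
Qed.

Lemma dyadic_sum_quad alpha psi : dyadic_support psi -> rapid alpha ->
  exists C, forall t, `|dyadic_sum alpha psi t| <= C * t ^+ 2.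
Proof.
move=> dp ra; have [M M0 pM] := dyadic_support_bounded dp.
have [C C0 aC] := ra 2; exists (C * M * (64 / 25)) => t.
have pos : 0 <= C * M * (64 / 25) * t ^+ 2.
  by rewrite mulr_ge0 ?sqr_ge0// mulr_ge0 ?mulr_ge0 ?ltW//; lra.
rewrite /dyadic_sum; move: (dyadic_index t) => n.
have [/andP[H1 _]|/dp.2 /nbhs_singleton ->] := boolP (5 / 8 < 2 ^+ n * t < 7 / 8); last first.
  by rewrite mulr0 normr0.
rewrite normrM; apply: (@le_trans _ _ (`|alpha n| * M)); first by rewrite ler_wpM2l.
have -> : C * M * (64 / 25) * t ^+ 2 = C * (64 / 25 * t ^+ 2) * M by ring.
rewrite ler_pM2r//.
have K : 1 <= 64 / 25 * (2 ^+ n * t) ^+ 2.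
  by set z := 2 ^+ n * t in H1 *; nra.
apply: (@le_trans _ _ (`|alpha n| * (2 ^+ n) ^+ 2 * (64 / 25 * t ^+ 2))).
  have -> : `|alpha n| * (2 ^+ n) ^+ 2 * (64 / 25 * t ^+ 2) =
      `|alpha n| * (64 / 25 * (2 ^+ n * t) ^+ 2) by rewrite exprMn; ring.
  by rewrite ler_peMr.
by rewrite ler_wpM2r// mulr_ge0 ?sqr_ge0//; lra.
Qed.

Lemma dyadic_exists t : 0 < t -> t < 1 -> exists n : nat, 1 / 2 <= 2 ^+ n * t < 1.
Proof.
move=> t0 t1.
have exn : exists n : nat, 1 / 2 <= 2 ^+ n * t.
  exists (Num.bound t^-1).
  have : t^-1 < (Num.bound t^-1)%:R by rewrite archi_boundP// invr_ge0 ltW.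
  move: (Num.bound _) => n tn.
  have : n%:R <= (2 : R) ^+ n by rewrite -natrX ler_nat ltnW// ltn_expl.
  move=> n2; have : t^-1 * t < 2 ^+ n * t by rewrite ltr_pM2r// (lt_le_trans tn).
  by rewrite mulVf ?gt_eqF//; lra.
exists (ex_minn exn); case: ex_minnP => -[|m] m1 m2; first by rewrite m1 expr0 mul1r t1.
rewrite m1 /=; have [mt|//] := leP 1 (2 ^+ m.+1 * t).
have : (m < m)%N by apply: m2; move: mt; rewrite exprS; lra.
by rewrite ltnn.
Qed.

(** The derivative is a function of the same kind, for psi' and alpha n * 2 ^ n,
    whence smoothness by induction on the order.  At 0 the rapid decrease of
    alpha makes the sum smaller than a multiple of t ^ 2. *)
Lemma der_dyadic_sum alpha psi t : dyadic_support psi -> rapid alpha -> t < 1 ->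
  is_derive t 1 (dyadic_sum alpha psi)
    (dyadic_sum (fun n => alpha n * 2 ^+ n) (derive1 psi) t).
Proof.
move=> dp ra t1; have dp' := dyadic_support_derive dp.
have [t0|t0|t0] := ltgtP t 0.
- rewrite dyadic_sum_le0 ?ltW//.
  apply: (@der_near _ (fun=> 0)).
  near=> x; rewrite dyadic_sum_le0// ltW//.
  by near: x; exact: lt_nbhsl.
- have [n /andP[n1 n2]] := dyadic_exists t0 t1.
  rewrite (@dyadic_sumE _ _ n)//; last by apply/andP; split; lra.
  apply: (@der_near _ (fun x => alpha n * psi (2 ^+ n * x))).
    have c2 : (fun x : R => 2 ^+ n * x) x @[x --> t] --> 2 ^+ n * t.
      by apply: cvgM; [exact: cvg_cst|exact: cvg_id].
    near=> x; rewrite (@dyadic_sumE _ _ n)//; apply/andP; split; near: x.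
      by apply: (cvgr_gt _ c2); lra.
    by apply: (cvgr_lt _ c2); lra.
  have dm := derM (der_cst (2 ^+ n : R) t) (der_id t).
  have dpsi : is_derive (2 ^+ n * t) 1 psi (derive1 psi (2 ^+ n * t)).
    exact: (Dn_derive openT (dp.1 1)).2.
  by apply: (is_derive_eq (derM (der_cst (alpha n : R) t) (der_comp dm dpsi))); ring.
- rewrite t0 dyadic_sum_le0//.
  have [C HC] := dyadic_sum_quad dp ra.
  apply: (@der_quad _ _ _ C); near=> x.
  by rewrite (@dyadic_sum_le0 _ _ 0)// mul0r !subr0.
Unshelve. all: by end_near. Qed.

Lemma rapidS alpha : rapid alpha -> rapid (fun n => alpha n * 2 ^+ n).
Proof.
move=> ra k; have [C C0 aC] := ra k.+1; exists C => // n.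
apply: le_trans (aC n).
by rewrite normrM exprS mulrA [`|2 ^+ n|]ger0_norm// exprn_ge0.
Qed.

Lemma ssmooth_dyadic_sum alpha psi : dyadic_support psi -> rapid alpha ->
  ssmooth [set t | t < 1] (dyadic_sum alpha psi).
Proof.
move=> dp ra n; elim: n alpha psi dp ra => // n IHn alpha psi dp ra.
exists (dyadic_sum (fun n => alpha n * 2 ^+ n) (derive1 psi)) => [s s1|].
  exact: der_dyadic_sum.
by apply: IHn; [exact: dyadic_support_derive|exact: rapidS].
Qed.

Lemma rapid_le alpha : (forall n, `|alpha n| <= (2 ^+ (n * n))^-1) -> rapid alpha.
Proof.
move=> ra k; exists (2 ^+ (k * k)) => [|n]; first by rewrite exprn_gt0.
apply: (@le_trans _ _ ((2 ^+ (n * n))^-1 * (2 ^+ n) ^+ k)).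
  by rewrite ler_wpM2r// exprn_ge0// exprn_ge0.
rewrite ler_pdivrMl ?exprn_gt0// -exprM -exprD ler_weXn2l ?ler1n//.
nia.
Qed.

(** The point where the variable 2 ^ n t of the bump takes the value 3/4. *)
Definition special_time n : R := 3 / 4 / 2 ^+ n.

(** Kriegl and Michor's special curve lemma, one coordinate at a time: a
    smooth germ at 0 runs through any rapidly decreasing sequence of positions
    with any rapidly decreasing sequence of velocities, along an affine piece
    of curve each time. *)
Lemma special_coordinate (x lam : nat -> R) :
  (forall n, `|x n| <= (2 ^+ (n * n))^-1) ->
  (forall n, `|lam n| <= (2 ^+ (n * n))^-1) ->
  exists p : R -> R, [/\ smooth_at (p : R -> R^o) 0, p 0 = 0 &
    forall n, \forall s \near 0, p (special_time n + s) = x n + s * lam n].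
Proof.
move=> xle lamle.
pose mu n := lam n / 2 ^+ n.
have mule n : `|mu n| <= (2 ^+ (n * n))^-1.
  apply: le_trans (lamle n); rewrite normrM normfV [`|2 ^+ n|]ger0_norm ?exprn_ge0//.
  by rewrite ler_piMr// invf_le1 ?exprn_gt0// exprn_ege1// ler1n.
pose psi y : R := (fun=> 1) y * bump y.
pose phi y : R := (fun z => z - 3 / 4) y * bump y.
have dpsi : dyadic_support psi by apply: dyadic_support_bump => n; exact: Dn_cst.
have dphi : dyadic_support phi.
  by apply: dyadic_support_bump => n; apply: DnD; [exact: Dn_id|exact: Dn_cst].
exists (fun t => dyadic_sum x psi t + dyadic_sum mu phi t); split.
- apply/smooth_atP; exists [set t | t < 1]; split=> //=.
  move=> n; apply: DnD; apply: ssmooth_dyadic_sum => //; exact: rapid_le.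
- by rewrite !dyadic_sum_le0// addr0.
move=> n; have n0 : (0 : R) < 2 ^+ n by rewrite exprn_gt0.
have tE s : 2 ^+ n * (special_time n + s) = 3 / 4 + 2 ^+ n * s.
  by rewrite mulrDr /special_time mulrCA divff ?mulr1// gt_eqF.
have ns : \forall s \near (0 : R), `|s| <= (2 ^+ n)^-1 * (1 / 20).
  exists ((2 ^+ n)^-1 * (1 / 20)); first by rewrite /= mulr_gt0// ?invr_gt0//; lra.
  by move=> h /=; rewrite sub0r normrN => /ltW.
near=> s.
have sn : `|2 ^+ n * s| <= 1 / 20.
  rewrite normrM ger0_norm ?exprn_ge0// -ler_pdivlMl//; near: s; exact: ns.
have /andP[s1 s2] : - (1 / 20) <= 2 ^+ n * s <= 1 / 20 by rewrite -ler_norml.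
rewrite !(@dyadic_sumE _ _ n) ?tE//; try by apply/andP; split; lra.
rewrite /psi /phi bump1; last by rewrite addrAC subrr add0r.
rewrite addrAC subrr add0r !mulr1 /mu; congr (_ + _).
by rewrite mulrA divfK ?gt_eqF// mulrC.
Unshelve. all: by end_near. Qed.

End SpecialCurve.

(** * Functions of two real variables that are smooth along curves *)

Section PlaneFunctions.
Set Implicit Arguments.
Unset Strict Implicit.
Context {R : realType}.

(** Only curves through the point (x, y) count, as germs: f may take arbitrary
    values away from the point.  Maps into a manifold, read in a chart, are of
    this kind. *)
Definition smooth2_at (E : tvsType R) (f : R -> R -> E) (x y : R) : Prop :=
  forall (p q : R -> R^o) r, smooth_at p r -> smooth_at q r ->
    p r = x -> q r = y -> smooth_at (fun k => f (p k) (q k)) r.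

Definition near2 (P : R -> R -> Prop) (x y : R) : Prop :=
  exists2 d, 0 < d & forall a b, `|a - x| < d -> `|b - y| < d -> P a b.

Definition smooth2 (E : tvsType R) (f : R -> R -> E) (x y : R) : Prop :=
  near2 (smooth2_at f) x y.

Lemma near2_point P x y : near2 P x y -> P x y.
Proof. by move=> [d d0 H]; apply: H; rewrite subrr normr0. Qed.

Lemma near2_sub (P Q : R -> R -> Prop) x y :
  (forall a b, P a b -> Q a b) -> near2 P x y -> near2 Q x y.
Proof. by move=> PQ [d d0 H]; exists d => // a b *; apply/PQ/H. Qed.

Lemma near2_and (P Q : R -> R -> Prop) x y :
  near2 P x y -> near2 Q x y -> near2 (fun a b => P a b /\ Q a b) x y.
Proof.
move=> [d d0 H] [e e0 K]; exists (Num.min d e) => [|a b]; first by rewrite lt_min d0.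
by rewrite !lt_min => /andP[? ?] /andP[? ?]; split; auto.
Qed.

Lemma near2_near2 P x y : near2 P x y -> near2 (near2 P) x y.
Proof.
move=> [d d0 H]; exists (d / 2) => [|a b ax bx]; first by rewrite divr_gt0.
exists (d / 2) => [|a' b' aa bb]; first by rewrite divr_gt0.
apply: H.
  by rewrite (splitr d) -(subrK a a') -addrA (le_lt_trans (ler_normD _ _))// ltrD.
by rewrite (splitr d) -(subrK b b') -addrA (le_lt_trans (ler_normD _ _))// ltrD.
Qed.

Lemma near2_curve P x y (p q : R -> R) r : near2 P x y ->
  p s @[s --> r] --> p r -> q s @[s --> r] --> q r -> p r = x -> q r = y ->
  \forall s \near r, P (p s) (q s).
Proof.
move=> [d d0 H] /cvgr_dist_lt /(_ _ d0) cp /cvgr_dist_lt /(_ _ d0) cq pr qr.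
by apply: filterS2 cp cq => s; rewrite pr qr ![`|_ - p s|]distrC ![`|_ - q s|]distrC; exact: H.
Qed.

Lemma smooth_at_scontinuous (p : R -> R) t :
  smooth_at (p : R -> R^o) t -> p s @[s --> t] --> p t.
Proof. by move=> /smooth_at_der; exact: der_continuous. Qed.

Lemma near2_scurve P x y (p q : R -> R^o) r : near2 P x y ->
  smooth_at p r -> smooth_at q r -> p r = x -> q r = y ->
  \forall s \near r, P (p s) (q s).
Proof.
by move=> H sp sq; apply: near2_curve H _ _; exact: smooth_at_scontinuous.
Qed.

Lemma smooth_affine (h : R -> R) (k t s : R) : smooth_at (h : R -> R^o) (t + k * s) ->
  smooth_at ((fun x => h (t + k * x)) : R -> R^o) s /\
  forall m, iter m cderiv ((fun x => h (t + k * x)) : R -> R^o) s =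
    k ^+ m * iter m cderiv (h : R -> R^o) (t + k * s).
Proof.
move=> sh; pose Q m x : R^o := k ^+ m * iter m cderiv (h : R -> R^o) (t + k * x).
have da (x : R) : is_derive x 1 (fun x => t + k * x) k.
  apply: (is_derive_eq (derD (der_cst t x) (derM (der_cst k x) (der_id x)))).
  by rewrite mul0r mulr1 !add0r.
have [||sQ itQ] := @smooth_tower R R^o Q s; first exact: Ro_hausdorff.
  have ca := @der_continuous R _ s _ (da s).
  have cn : \forall x \near s, smooth_at (h : R -> R^o) (t + k * x).
    exact: (ca _ (smooth_at_near sh)).
  apply: filterS cn => x /= sx m.
  apply/is_cderiv_derive.
  have H := derM (der_cst (k ^+ m : R) x) (der_comp (da x) (smooth_at_der (smooth_at_iter m sx))).
  by apply: (is_derive_eq H); rewrite /Q /= mul0r add0r exprSr mulrA.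
have Q0 : Q 0 = (fun x => h (t + k * x)).
  by apply/funext => x; rewrite /Q expr0 mul1r.
rewrite Q0 in sQ itQ; split => // m.
exact: nbhs_singleton itQ m.
Qed.

Lemma special_time_near (P : R -> Prop) :
  (\forall s \near 0, P s) -> \forall n \near \oo, P (special_time n).
Proof.
suff : @special_time R @ \oo --> (0 : R) by apply.
rewrite (_ : special_time = fun n => 3 / 4 * (1 / 2) ^+ n); last first.
  by apply/funext => n; rewrite /special_time expr_div_n expr1n mul1r.
rewrite -[X in _ --> X](mulr0 (3 / 4)); apply: cvgM; first exact: cvg_cst.
by apply: cvg_expr; rewrite ger0_norm; lra.
Qed.

Lemma special_plane_curve (x0 y0 : R) (x y lam mu : nat -> R) :
  (forall n, `|x n - x0| <= (2 ^+ (n * n))^-1) ->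
  (forall n, `|y n - y0| <= (2 ^+ (n * n))^-1) ->
  (forall n, `|lam n| <= (2 ^+ (n * n))^-1) ->
  (forall n, `|mu n| <= (2 ^+ (n * n))^-1) ->
  exists p q : R -> R^o, [/\ smooth_at p 0, smooth_at q 0, p 0 = x0, q 0 = y0 &
    forall n, \forall s \near (0 : R), p (special_time n + s) = x n + s * lam n /\
                           q (special_time n + s) = y n + s * mu n].
Proof.
move=> xle yle lle mle.
have [p [sp p0 pE]] := special_coordinate xle lle.
have [q [sq q0 qE]] := special_coordinate yle mle.
exists (fun s => p s + x0), (fun s => q s + y0); split.
- by apply: smooth_atD => //; exact: smooth_at_cst.
- by apply: smooth_atD => //; exact: smooth_at_cst.
- by rewrite p0 add0r.
- by rewrite q0 add0r.
move=> n; near=> s; split.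
  rewrite (_ : p _ = x n - x0 + s * lam n); last by near: s; exact: pE.
  by rewrite addrAC subrK.
rewrite (_ : q _ = y n - y0 + s * mu n); last by near: s; exact: qE.
by rewrite addrAC subrK.
Unshelve. all: by end_near. Qed.

(** To show that a property holds near a point of the plane it suffices to
    follow smooth curves through the point, as otherwise a special curve runs
    through a sequence of exceptions. *)
Lemma near2_of_curves (P : R -> R -> Prop) x0 y0 :
  (forall (p q : R -> R^o) r, smooth_at p r -> smooth_at q r -> p r = x0 -> q r = y0 ->
    \forall s \near r, P (p s) (q s)) -> near2 P x0 y0.
Proof.
move=> HP; apply: contrapT => nP.
have H n : exists z : R * R, [/\ `|z.1 - x0| <= (2 ^+ (n * n))^-1,
    `|z.2 - y0| <= (2 ^+ (n * n))^-1 & ~ P z.1 z.2].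
  apply: contrapT => nz; apply: nP; exists (2 ^+ (n * n))^-1; first by rewrite invr_gt0 exprn_gt0.
  move=> a b ax by0; apply: contrapT => nPab; apply: nz.
  by exists (a, b); split=> //=; exact: ltW.
have [z zP] := choice H.
have z1 n : `|(z n).1 - x0| <= (2 ^+ (n * n))^-1 by have [] := zP n.
have z2 n : `|(z n).2 - y0| <= (2 ^+ (n * n))^-1 by have [] := zP n.
have l0 n : `|(fun=> 0 : R) n| <= (2 ^+ (n * n))^-1.
  by rewrite normr0 invr_ge0 exprn_ge0.
have [p [q [sp sq p0 q0 pq]]] := special_plane_curve z1 z2 l0 l0.
have Pn := special_time_near (HP p q 0 sp sq p0 q0).
near \oo => n; have [_ _] := zP n; apply.
have := nbhs_singleton (pq n); rewrite addr0 mul0r !addr0 => -[<- <-].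
by near: n.
Unshelve. all: by end_near. Qed.

(** The first half of Boman's theorem.  Were the derivatives of order m in the
    direction v not defined and bounded near the point, there would be a
    sequence of points with a derivative larger than n / lam n ^ m, for
    velocities lam n that decrease rapidly.  A special curve through
    these points with the velocities lam n * v is mapped to a smooth function,
    whose derivatives of order m, bounded near 0, are those of f multiplied by
    lam n ^ m. *)
Lemma directional_bound (f : R -> R -> R^o) x0 y0 v1 v2 (m : nat) :
  smooth2_at f x0 y0 ->
  exists M, near2 (fun a b =>
    smooth_at (fun s => f (a + v1 * s) (b + v2 * s)) 0 /\
    `|iter m cderiv (fun s => f (a + v1 * s) (b + v2 * s)) 0| <= M) x0 y0.
Proof.
move=> sf; apply: contrapT => nB.
pose B a b M := smooth_at (fun s => f (a + v1 * s) (b + v2 * s)) 0 /\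
    `|iter m cderiv (fun s => f (a + v1 * s) (b + v2 * s)) 0| <= M.
pose K := 1 + `|v1| + `|v2|; have K0 : 0 < K by rewrite ltr_wpDr// ltr_wpDr.
have e0 n : 0 < (2 ^+ (n * n))^-1 :> R by rewrite invr_gt0 exprn_gt0.
pose lam n : R := (2 ^+ (n * n))^-1 / K.
have lam0 n : 0 < lam n by rewrite divr_gt0.
have H n : exists z : R * R, [/\ `|z.1 - x0| <= (2 ^+ (n * n))^-1,
    `|z.2 - y0| <= (2 ^+ (n * n))^-1 & ~ B z.1 z.2 (n%:R * (lam n)^-1 ^+ m)].
  apply: contrapT => nz; apply: nB; exists (n%:R * (lam n)^-1 ^+ m).
  exists (2 ^+ (n * n))^-1 => // a b ax by0; apply: contrapT => nPab; apply: nz.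
  by exists (a, b); split=> //=; exact: ltW.
have [z zP] := choice H.
have z1 n : `|(z n).1 - x0| <= (2 ^+ (n * n))^-1 by have [] := zP n.
have z2 n : `|(z n).2 - y0| <= (2 ^+ (n * n))^-1 by have [] := zP n.
have lle v n : `|v| <= K -> `|v * lam n| <= (2 ^+ (n * n))^-1.
  move=> vK; rewrite normrM [`|lam n|]gtr0_norm// /lam mulrCA ler_piMr ?(ltW (e0 n))//.
  by rewrite ler_pdivrMr// mul1r.
have l1 n : `|v1 * lam n| <= (2 ^+ (n * n))^-1.
  by apply: lle; rewrite /K addrAC lerDr addr_ge0.
have l2 n : `|v2 * lam n| <= (2 ^+ (n * n))^-1.
  by apply: lle; rewrite /K lerDr addr_ge0.
have [p [q [sp sq p0 q0 pq]]] := special_plane_curve z1 z2 l1 l2.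
pose h k : R^o := f (p k) (q k).
have sh : smooth_at h 0 by exact: sf.
have shn := special_time_near (smooth_at_near sh).
have chm := smooth_at_scontinuous (smooth_at_iter m sh).
pose C := `|iter m cderiv h 0| + 1.
have hC : \forall s \near (0 : R), `|iter m cderiv h s| <= C.
  have /(cvgr_dist_le) := chm; move=> /(_ 1 ltr01); apply: filterS => s hs.
  rewrite /C -lerBlDl; apply: le_trans hs.
  by rewrite distrC lerB_dist.
have hCn := special_time_near hC.
near \oo => n; have [_ _] := zP n; apply.
have shtn : smooth_at h (special_time n) by near: n.
have hCtn : `|iter m cderiv h (special_time n)| <= C by near: n.
pose L (s : R) : R^o := h (special_time n + (lam n)^-1 * s).
have LE : \forall s \near (0 : R), L s = f ((z n).1 + v1 * s) ((z n).2 + v2 * s).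
  have c0 : (fun s : R => (lam n)^-1 * s) s @[s --> (0 : R)] --> (0 : R).
    by rewrite -[X in _ --> X](mulr0 (lam n)^-1); apply: cvgM; [exact: cvg_cst|exact: cvg_id].
  have cn : \forall s \near (0 : R), p (special_time n + (lam n)^-1 * s) = (z n).1 + (lam n)^-1 * s * (v1 * lam n) /\
      q (special_time n + (lam n)^-1 * s) = (z n).2 + (lam n)^-1 * s * (v2 * lam n).
    exact: (c0 _ (pq n)).
  apply: filterS cn => s [E1 E2].
  rewrite /L /h E1 E2; have lE v : (lam n)^-1 * s * (v * lam n) = v * s.
    by rewrite mulrCA mulrAC mulVf ?mul1r// gt_eqF.
  by rewrite !lE.
have [|sL LD] := @smooth_affine h (lam n)^-1 (special_time n) 0.
  by rewrite mulr0 addr0.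
split; first exact: near_smooth_at LE sL.
rewrite -(nbhs_singleton (near_iter_cderiv m LE)) LD mulr0 addr0 normrM.
rewrite ger0_norm ?exprn_ge0 ?invr_ge0 ?(ltW (lam0 n))// mulrC ler_pM2r; last first.
  by rewrite exprn_gt0// invr_gt0.
apply: (le_trans hCtn); near: n; exact: nbhs_infty_ger.
Unshelve. all: by end_near. Qed.

End PlaneFunctions.

(** * Finite differences and their polarization *)

Section FiniteDifferences.
Set Implicit Arguments.
Unset Strict Implicit.
Context {R : realType}.

(** The operator 1 - T for the translation T by w; its powers are the iterated
    differences up to a sign. *)
Definition shd {V : lmodType R} (w : V) (f : V -> R) : V -> R :=
  fun z => f z - f (z + w).

(** The binomial coefficients with signs, of which only the first one matters
    below. *)
Lemma shd_coefs (p : nat) : exists2 c : nat -> R, c 0 = 1 &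
  forall (V : lmodType R) (w : V) (f : V -> R) z,
    iter p (shd w) f z = \sum_(j < p.+1) c j * f (z + w *+ j).
Proof.
elim: p => [|p [c c0 IHp]].
  by exists (fun=> 1) => // V w f z; rewrite big_ord1 /= mul1r addr0.
pose d j := if j is i.+1 then (if (i < p)%N then c i.+1 else 0) - c i else c 0.
exists d => // V w f z.
rewrite iterS {1}/shd !IHp [RHS]big_ord_recl /= mulr0n addr0.
under [X in _ = _ + X]eq_bigr do rewrite mulrBl.
rewrite sumrB addrA; congr (_ - _); last first.
  by apply: eq_bigr => i _; rewrite ?lift0 mulrS addrA.
rewrite big_ord_recl /= mulr0n addr0; congr (_ + _).
rewrite [RHS]big_ord_recr /= ltnn mul0r addr0.
by apply: eq_bigr => i _; rewrite ltn_ord.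
Qed.

(** The alternating sum of F over all partial sums of the pairs in hs. *)
Fixpoint altsum {V : lmodType R} (hs : seq (V * V)) (F : V -> V -> R) (a b : V) : R :=
  if hs is (h, g) :: hs' then altsum hs' F a b - altsum hs' F (a + h) (b + g)
  else F a b.

Lemma altsum_ext (V : lmodType R) (hs : seq (V * V)) F G a b :
  (forall a b, F a b = G a b) -> altsum hs F a b = altsum hs G a b.
Proof. by move=> FG; elim: hs a b => [|[h g] hs IH] a b //=; rewrite !IH. Qed.

Lemma altsum_sum (V : lmodType R) (hs : seq (V * V)) n (c : nat -> R)
    (F : nat -> V -> V -> R) a b :
  altsum hs (fun a b => \sum_(j < n) c j * F j a b) a b =
  \sum_(j < n) c j * altsum hs (F j) a b.
Proof.
elim: hs a b => [|[h g] hs IH] a b //=.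
by rewrite !IH -sumrB; apply: eq_bigr => j _; rewrite mulrBr.
Qed.

Lemma altsum_shift (V : lmodType R) (hs : seq (V * V)) F h g :
  (forall a b, F (a + h) (b + g) = F a b) ->
  forall a b, altsum hs F (a + h) (b + g) = altsum hs F a b.
Proof.
move=> Fh; elim: hs => [|[h' g'] hs IH] a b /=; first exact: Fh.
by rewrite IH ![_ + h + _]addrAC ![_ + g + _]addrAC IH.
Qed.

Lemma altsum_inv (V : lmodType R) (hs : seq (V * V)) F h g : (h, g) \in hs ->
  (forall a b, F (a + h) (b + g) = F a b) -> forall a b, altsum hs F a b = 0.
Proof.
move=> + Fh; elim: hs => [//|[h' g'] hs IH]; rewrite inE => /orP[/eqP[<- <-]|hin] a b /=.
  by rewrite altsum_shift// subrr.
by rewrite !IH// subrr.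
Qed.

(** Djokovic's polarization formula: a mixed difference is a linear
    combination of differences in a single direction.  Expanding the latter,
    the term of index j is invariant under translation by the pair
    (h, h / j), and cancels for j > 0. *)
Lemma polarization (V : lmodType R) (hs : seq (V * V)) p (f : V -> R) z :
  (forall j, (j < p)%N -> exists h, (h, j.+1%:R^-1 *: h) \in hs) ->
  altsum hs (fun a b => iter p (shd (- b)) f (z + a)) 0 0 =
  altsum hs (fun a b => f (z + a)) 0 0.
Proof.
move=> hsP; have [c c0 cE] := shd_coefs p.
pose F (j : nat) a b := f (z + a + (- b) *+ j).
have -> : altsum hs (fun a b => iter p (shd (- b)) f (z + a)) 0 0 =
    \sum_(j < p.+1) c j * altsum hs (F j) 0 0.
  by rewrite -altsum_sum; apply: altsum_ext => a b; rewrite cE.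
rewrite big_ord_recl c0 mul1r big1 ?addr0; last first.
  move=> j _; rewrite lift0; have [h hin] := hsP j (ltn_ord j).
  rewrite (altsum_inv hin) ?mulr0// => a b.
  rewrite /F; congr f; rewrite opprD mulrnDl -scalerN scalerMnl -mulr_natr mulVf ?pnatr_eq0// scale1r.
  by rewrite [z + (a + h)]addrA addrACA subrr addr0.
by apply: altsum_ext => a b; rewrite /F mulr0n addr0.
Qed.

Lemma altsum_iter (V : lmodType R) (w : V) (g : nat -> V) (s : seq nat) (f : V -> R) z a b :
  altsum [seq (w, g i) | i <- s] (fun a b => f (z + a)) a b = iter (size s) (shd w) f (z + a).
Proof.
elim: s a b => [//|i s IH] a b /=.
by rewrite !IH /shd addrA.
Qed.

Lemma iter_shd_line (V : lmodType R) (v z : V) (h s : R) p (f : V -> R) :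
  iter p (shd (h *: v)) f (z + s *: v) =
  iter p (shd (h : R^o)) (fun x : R^o => f (z + x *: v)) s.
Proof.
elim: p s => [//|p IH] s; rewrite !iterS {1}/shd IH -addrA -scalerDl IH.
by [].
Qed.

Lemma mvt_ball (f f' : R -> R) (a b : R) :
  (forall x : R, `|x - a| <= `|b - a| -> is_derive x 1 f (f' x)) ->
  exists2 c, `|c - a| <= `|b - a| & f b - f a = f' c * (b - a).
Proof.
move=> df; have cf x : `|x - a| <= `|b - a| -> f y @[y --> x] --> f x.
  by move=> /df; exact: der_continuous.
have [ab|ba] := leP a b.
  have E x : x \in `[a, b] -> `|x - a| <= `|b - a|.
    by rewrite in_itv /= => /andP[ax xb]; rewrite !ger0_norm ?subr_ge0// lerD2r.
  have [||c cab fc] := @MVT_segment R f f' a b ab.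
  - by move=> x xab; apply: df; apply: E; exact: subset_itv_oo_cc.
  - apply: derivable_within_continuous => x xab.
    by have [] := df x (E _ xab).
  by exists c => //; exact: E.
have E x : x \in `[b, a] -> `|x - a| <= `|b - a|.
  rewrite in_itv /= => /andP[ax xb]; rewrite ![`|_ - a|]distrC !ger0_norm ?subr_ge0// ?lerD2l ?lerN2//.
  exact: ltW.
have [||c cab fc] := @MVT_segment R f f' b a (ltW ba).
- by move=> x xab; apply: df; apply: E; exact: subset_itv_oo_cc.
- apply: derivable_within_continuous => x xab.
  by have [] := df x (E _ xab).
exists c; first exact: E.
by rewrite -opprB fc -mulrN opprB.
Qed.

(** The mean value theorem, applied to one factor 1 - T at a time. *)
Lemma iter_shd_mvt (Q : nat -> R -> R) (rho h t : R) p :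
  (forall n (s : R), `|s| <= rho -> is_derive s 1 (Q n) (Q n.+1 s)) ->
  `|t| + p%:R * `|h| <= rho ->
  exists2 xi, `|xi - t| <= p%:R * `|h| & iter p (shd (h : R^o)) (Q 0) t = (- h) ^+ p * Q p xi.
Proof.
elim: p Q rho => [|p IHp] Q rho dQ trho.
  by exists t; rewrite ?subrr ?normr0 ?mul0r// expr0 mul1r.
have rho' : `|t| + p%:R * `|h| <= rho - `|h|.
  by rewrite lerBrDr -addrA -[X in _ + (_ + X)]mul1r -mulrDl natr1.
have [|xi xit xiE] := IHp (fun n => shd (h : R^o) (Q n)) (rho - `|h|) _ rho'.
  move=> n s sr; apply: derB.
    by apply: dQ; apply: (le_trans sr); rewrite gerBl.
  have := derD (der_id s) (der_cst (h : R) s) => d1.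
  apply: (is_derive_eq (der_comp d1 (dQ n (s + h) _))).
    by rewrite (le_trans (ler_normD _ _))// -lerBrDr.
  by rewrite addr0 mul1r.
have xi_le x : `|x - xi| <= `|xi + h - xi| -> `|x| <= rho /\ `|x - t| <= p.+1%:R * `|h|.
  rewrite addrAC subrr add0r => xh.
  have xt : `|x - t| <= p.+1%:R * `|h|.
    have := ler_normD (x - xi) (xi - t); rewrite addrA subrK -natr1 mulrDl mul1r.
    by move: xh xit; lra.
  split=> //; apply: le_trans trho.
  by rewrite -{1}(subrK t x) addrC (le_trans (ler_normD _ _))// lerD2l.
have [|c cxi cE] := @mvt_ball (Q p) (Q p.+1) xi (xi + h).
  by move=> x /xi_le[xr _]; exact: dQ.
exists c; first exact: (xi_le _ cxi).2.
rewrite iterSr xiE /shd -opprB cE addrAC subrr add0r exprS.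
by rewrite mulrN [Q p.+1 c * h]mulrC mulrA -mulNr -[- (_ * h)]mulrN [_ * - h]mulrC.
Qed.

End FiniteDifferences.

(** * Local bounds on mixed derivatives *)

Section MixedBounds.
Set Implicit Arguments.
Unset Strict Implicit.
Context {R : realType}.
Variables (f : R -> R -> R^o) (x0 y0 : R).
Hypothesis sf : smooth2_at f x0 y0.

Let V : lmodType R := (R^o * R^o)%type.
Let fV (z : V) : R := f z.1 z.2.

Definition scale_pairs (h : R) (hs : seq (V * V)) := [seq (h *: p.1, h *: p.2) | p <- hs].

Lemma line_smooth (g : R -> R) (s : R) :
  smooth_at ((fun x => g (s + 1 * x)) : R -> R^o) 0 -> smooth_at (g : R -> R^o) s /\
  forall m, iter m cderiv (g : R -> R^o) s =
            iter m cderiv ((fun x => g (s + 1 * x)) : R -> R^o) 0.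
Proof.
move=> sg; have [|sg' gm] := @smooth_affine R (fun x => g (s + 1 * x)) 1 (- s) s.
  by rewrite mul1r addNr.
have E : (fun x => g (s + 1 * (- s + 1 * x))) = g.
  by apply/funext => x; rewrite !mul1r addrA subrr add0r.
rewrite E in sg' gm; split=> // m.
by rewrite gm expr1n !mul1r addNr.
Qed.

(** Along a line the mean value theorem applies, so that the bounds on the
    directional derivatives of order p bound the differences of order p, at all
    small scales h. *)
Lemma pure_difference_bound (p : nat) (a b : V) : exists d K, [/\ 0 < d, 0 <= K &
  forall x y h : R, `|x - x0| < d -> `|y - y0| < d -> `|h| < d ->
    `|iter p (shd (- (h *: b))) fV ((x, y) + h *: a)| <= K * `|h| ^+ p].
Proof.
have [M [d d0 HM]] := @directional_bound R f x0 y0 (- b.1) (- b.2) p sf.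
pose K := 1 + (`|a.1| + `|a.2|) + p%:R * (`|b.1| + `|b.2|).
have a0 : 0 <= `|a.1| + `|a.2| by rewrite addr_ge0.
have b0 : 0 <= p%:R * (`|b.1| + `|b.2|) by rewrite mulr_ge0// addr_ge0.
have K0 : 0 < K by rewrite /K -addrA ltr_wpDr// addr_ge0.
exists (d / K), `|M|; split=> //; first by rewrite divr_gt0.
move=> x y h xd yd hd.
have box u a1 b1 s w0 : `|u - w0| < d / K -> `|a1| <= `|a.1| + `|a.2| -> `|b1| <= `|b.1| + `|b.2| ->
    `|s| <= p%:R * `|h| -> `|u + h * a1 - s * b1 - w0| < d.
  move=> ud ale ble sh.
  have -> : u + h * a1 - s * b1 - w0 = (u - w0) + h * a1 + (- (s * b1)) by ring.
  have n1 := ler_normD (u - w0 + h * a1) (- (s * b1)).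
  have n2 := ler_normD (u - w0) (h * a1).
  rewrite normrN !normrM in n1 n2.
  have q1 : `|h| * `|a1| <= d / K * (`|a.1| + `|a.2|).
    by rewrite ler_pM// ltW.
  have q2 : `|s| * `|b1| <= d / K * (p%:R * (`|b.1| + `|b.2|)).
    apply: (@le_trans _ _ (p%:R * `|h| * (`|b.1| + `|b.2|))); first by rewrite ler_pM.
    by rewrite mulrAC mulrC ler_wpM2r// ltW.
  have dE : d = d / K + d / K * (`|a.1| + `|a.2|) + d / K * (p%:R * (`|b.1| + `|b.2|)).
    by rewrite -[X in X + _ + _]mulr1 -!mulrDr divfK// gt_eqF.
  by move: n1 n2 q1 q2 ud dE; lra.
have E := @iter_shd_line R V (- b) ((x, y) + h *: a) h 0 p fV.
rewrite scale0r addr0 scalerN in E; rewrite E => {E}.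
pose L (s : R) : R := fV ((x, y) + h *: a + s *: (- b)).
have LE (s : R) : `|s| <= p%:R * `|h| ->
    smooth_at (L : R -> R^o) s /\ `|iter p cderiv (L : R -> R^o) s| <= M.
  move=> sh; have [] := HM (x + h * a.1 - s * b.1) (y + h * a.2 - s * b.2).
  - by apply: box => //; rewrite lerDl.
  - by apply: box => //; rewrite lerDr.
  have -> : (fun s0 => f (x + h * a.1 - s * b.1 + - b.1 * s0) (y + h * a.2 - s * b.2 + - b.2 * s0))
      = (fun s0 => L (s + 1 * s0)).
    apply/funext => s0; rewrite /L /fV /= !scaleRE; congr f; ring.
  by move=> sL; have [? ->] := line_smooth sL.
have [||xi xiP ->] := @iter_shd_mvt R (fun n => iter n cderiv (L : R -> R^o)) (p%:R * `|h|) h 0 p.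
- by move=> n s /LE[sL _]; exact/smooth_at_der/smooth_at_iter.
- by rewrite normr0 add0r.
rewrite subr0 in xiP; rewrite normrM normrX normrN mulrC ler_wpM2r ?exprn_ge0//.
exact: le_trans (LE _ xiP).2 (ler_norm _).
Qed.

(** The alternating sum consists of differences in single directions, each
    bounded by the preceding lemma; the pairs (a, b) record the partial
    sums. *)
Lemma altsum_bound (p : nat) (hs : seq (V * V)) (a b : V) : exists d K, [/\ 0 < d, 0 <= K &
  forall x y h : R, `|x - x0| < d -> `|y - y0| < d -> `|h| < d ->
    `|altsum (scale_pairs h hs) (fun a b => iter p (shd (- b)) fV ((x, y) + a)) (h *: a) (h *: b)|
       <= K * `|h| ^+ p].
Proof.
elim: hs a b => [|[u w] hs IH] a b /=; first exact: pure_difference_bound.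
have [d1 [K1 [d10 K10 H1]]] := IH a b.
have [d2 [K2 [d20 K20 H2]]] := IH (a + u) (b + w).
exists (Num.min d1 d2), (K1 + K2); split; [by rewrite lt_min d10|exact: addr_ge0|].
move=> x y h; rewrite !lt_min => /andP[x1 x2] /andP[y1 y2] /andP[h1 h2].
rewrite mulrDl (le_trans (ler_normB _ _))// lerD// ?H1//.
by have := H2 x y h x2 y2 h2; rewrite !scalerDr.
Qed.

(** Polarization for the steps w, repeated m times, and v: the alternating sum
    is then the difference in v of a difference of order m in w. *)
Lemma mixed_difference_bound (m : nat) : exists d K, [/\ 0 < d, 0 <= K &
  forall x y h : R, `|x - x0| < d -> `|y - y0| < d -> `|h| < d ->
    `|iter m (shd (h : R^o)) (f x) y - iter m (shd (h : R^o)) (f (x + h)) y|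
      <= K * `|h| ^+ m.+1].
Proof.
pose v : V := (1, 0); pose w : V := (0, 1).
pose hs : seq (V * V) := (v, m.+1%:R^-1 *: v) :: [seq (w, i%:R^-1 *: w) | i <- iota 1 m].
have [d [K [d0 K0 H]]] := @altsum_bound m.+1 hs 0 0.
exists d, K; split=> // x y h xd yd hd.
have := H x y h xd yd hd; rewrite !scaler0 polarization; last first.
  move=> j; rewrite ltnS leq_eqVlt => /orP[/eqP ->|jm].
    exists (h *: v); rewrite /scale_pairs /= inE; apply/orP; left.
    by rewrite scalerA mulrC -scalerA.
  exists (h *: w); rewrite /scale_pairs /= inE; apply/orP; right.
  apply/mapP; exists (w, j.+1%:R^-1 *: w).
    by apply/mapP; exists j.+1 => //; rewrite mem_iota.
  by rewrite /= !scalerA mulrC.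
rewrite /= /scale_pairs -map_comp.
rewrite (@altsum_iter R V (h *: w) (fun i => h *: (i%:R^-1 *: w))).
rewrite (@altsum_iter R V (h *: w) (fun i => h *: (i%:R^-1 *: w))).
have line u : iter m (shd (h *: w)) fV ((u, y) : V) = iter m (shd (h : R^o)) (f u) y.
  have -> : ((u, y) : V) = (u, 0) + y *: w.
    by congr pair; rewrite /= scaleRE ?mulr0 ?addr0 ?mulr1 ?add0r.
  rewrite iter_shd_line; congr (iter _ _ _ _); apply/funext => s.
  by rewrite /fV /= !scaleRE mulr0 addr0 mulr1 add0r.
rewrite size_iota !addr0 add0r line.
have -> : ((x, y) : V) + h *: v = (x + h, y).
  by congr pair; rewrite /= scaleRE ?mulr0 ?addr0 ?mulr1.
by rewrite line.
Qed.

Lemma near2_smooth_snd : near2 (fun x y => smooth_at (f x) y) x0 y0.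
Proof.
have [M H] := @directional_bound R f x0 y0 0 1 0 sf.
apply: near2_sub H => a b [+ _] => sL.
have E : (fun s => f (a + 0 * s) (b + 1 * s)) = (fun s => f a (b + 1 * s)).
  by apply/funext => s; rewrite mul0r addr0.
by rewrite E in sL; have [] := line_smooth sL.
Qed.

(** Partial derivatives in one variable are locally Lipschitz in the other
    one: differences of order m + 1 are bounded by h ^ (m + 1), and
    telescoping over tau / h steps in the first variable leaves
    tau * h ^ m. *)
Lemma iter_deriv_lipschitz (m : nat) : exists d C, [/\ 0 < d, 0 <= C &
  forall x y tau : R, `|x - x0| < d -> `|y - y0| < d -> `|tau| < d ->
    `|iter m cderiv (f x) y - iter m cderiv (f (x + tau)) y| <= C * `|tau|].
Proof.
have [d1 [K [d10 K0 H]]] := mixed_difference_bound m.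
have [d2 d20 sm] := near2_smooth_snd.
pose d := Num.min d1 d2 / 2.
have m0 : 0 < Num.min d1 d2 by rewrite lt_min d10.
have dd0 : 0 < d by rewrite divr_gt0.
have d12 : d + d = Num.min d1 d2 by rewrite /d -splitr.
have d1le : d + d <= d1 by rewrite d12 ge_min lexx.
have d2le : d + d <= d2 by rewrite d12 ge_min lexx orbT.
exists d, K; split=> // x y tau xd yd td.
have [->|t0] := eqVneq tau 0; first by rewrite addr0 subrr !normr0 mulr0.
have tp : 0 < `|tau| by rewrite normr_gt0.
apply/ler_addgt0Pr => e e0.
have sx s : `|s - x| <= `|tau| -> `|s - x0| < d + d.
  move=> st; rewrite -(subrK x s) -addrA (le_lt_trans (ler_normD _ _))//.
  by rewrite ltrD// (le_lt_trans st).
have cont s : `|s - x| <= `|tau| -> exists2 eta, 0 < eta &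
    forall r, `|r - y| < eta -> `|iter m cderiv (f s) y - iter m cderiv (f s) r| < e / 2.
  move=> /sx sxd.
  have : smooth_at (f s) y.
    by apply: sm; [exact: lt_le_trans sxd _|apply: (lt_le_trans yd); lra].
  move=> /(smooth_at_iter m) /smooth_at_scontinuous /cvgr_dist_lt /(_ (e / 2)).
  case; first by rewrite divr_gt0.
  by move=> eta /= eta0 Heta; exists eta => // r ry; apply: Heta; rewrite /= distrC.
have [|eta1 eta10 c1] := cont x; first by rewrite subrr normr0.
have [|eta2 eta20 c2] := cont (x + tau); first by rewrite addrAC subrr add0r.
pose eta := Num.min (Num.min eta1 eta2) d.
have eta0 : 0 < eta by rewrite !lt_min eta10 eta20 dd0.
(* with this number of steps, the points where iter_shd_mvt evaluates the
   derivatives are closer to y than eta *)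
pose N := (Num.bound ((m.+1%:R * `|tau|) / eta)).+1.
have Nlt : m.+1%:R * `|tau| < N%:R * eta.
  rewrite -ltr_pdivrMr//; apply: (@lt_trans _ _ (Num.bound ((m.+1%:R * `|tau|) / eta))%:R).
    by apply: archi_boundP; rewrite divr_ge0 ?mulr_ge0// ltW.
  by rewrite ltr_nat.
have N0 : (0 : R) < N%:R by rewrite ltr0n.
pose h := tau / N%:R.
have hN : h * N%:R = tau by rewrite divfK// gt_eqF.
have hn : `|h| * N%:R = `|tau| by rewrite -[in RHS]hN [RHS]normrM normr_nat.
have hp : 0 < `|h| by rewrite normr_gt0 mulf_neq0// invr_eq0 gt_eqF.
have mh : m.+1%:R * `|h| < eta.
  by rewrite -(ltr_pM2r N0) -mulrA hn mulrC [eta * _]mulrC mulrC.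
have hle : `|h| <= m.+1%:R * `|h| by rewrite ler_peMl// ler1n.
have hd : `|h| < d by apply: (le_lt_trans hle); apply: (lt_le_trans mh); rewrite /eta ge_min lexx orbT.
have tele n : (n <= N)%N ->
    `|iter m (shd (h : R^o)) (f x) y - iter m (shd (h : R^o)) (f (x + n%:R * h)) y|
      <= n%:R * (K * `|h| ^+ m.+1).
  elim: n => [_|n IHn nN]; first by rewrite mul0r addr0 subrr normr0 mul0r.
  have -> : iter m (shd (h : R^o)) (f x) y - iter m (shd (h : R^o)) (f (x + n.+1%:R * h)) y =
      (iter m (shd (h : R^o)) (f x) y - iter m (shd (h : R^o)) (f (x + n%:R * h)) y) +
      (iter m (shd (h : R^o)) (f (x + n%:R * h)) y -
       iter m (shd (h : R^o)) (f (x + n%:R * h + h)) y).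
    rewrite addrA subrK; congr (_ - iter _ _ (f _) _).
    by rewrite -natr1 mulrDl mul1r addrA.
  rewrite (le_trans (ler_normD _ _))// -natr1 mulrDl mul1r lerD//; first exact: IHn (ltnW nN).
  apply: H; [|by apply: (lt_le_trans yd); lra|by apply: (lt_le_trans hd); lra].
  apply: lt_le_trans d1le; apply: sx.
  rewrite addrAC subrr add0r normrM -hn normr_nat mulrC ler_wpM2l//.
  by rewrite ler_nat ltnW.
have := tele N (leqnn N).
have -> : N%:R * (K * `|h| ^+ m.+1) = K * `|tau| * `|h| ^+ m by rewrite -hn exprS; ring.
rewrite [N%:R * h]mulrC hN.
have mvtx s : `|s - x| <= `|tau| -> exists2 xi, `|xi - y| < eta &
    iter m (shd (h : R^o)) (f s) y = (- h) ^+ m * iter m cderiv (f s) xi.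
  move=> /sx sxd.
  pose g r := f s (y + 1 * r).
  have sg r : `|r| <= m%:R * `|h| -> smooth_at (f s) (y + 1 * r).
    move=> rle; apply: sm; first exact: lt_le_trans d2le.
    rewrite mul1r addrAC; apply: lt_le_trans d2le.
    rewrite (le_lt_trans (ler_normD _ _))// ltrD// (le_lt_trans rle)//.
    apply: (@le_lt_trans _ _ (m.+1%:R * `|h|)); first by rewrite ler_wpM2r// ler_nat.
    by apply: (lt_le_trans mh); rewrite /eta ge_min lexx orbT.
  have [||xi xiP xiE] := @iter_shd_mvt R (fun n => iter n cderiv (g : R -> R^o)) (m%:R * `|h|) h 0 m.
  - by move=> n r /sg sr; apply/smooth_at_der/smooth_at_iter; exact: (smooth_affine sr).1.
  - by rewrite normr0 add0r.
  rewrite subr0 in xiP; exists (y + xi).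
    rewrite addrAC subrr add0r (le_lt_trans xiP)//; apply: le_lt_trans mh.
    by rewrite ler_wpM2r// ler_nat.
  have [_ gm] := smooth_affine (sg _ xiP).
  rewrite gm expr1n !mul1r in xiE; rewrite -xiE.
  have E := @iter_shd_line R (R^o : lmodType R) 1 y h 0 m (f s).
  rewrite scale0r addr0 scaleRE mulr1 in E; rewrite E.
  by congr (iter _ _ _ _); apply/funext => r; rewrite /g /= scaleRE mulr1 mul1r.
have [|xi1 xi1P ->] := mvtx x; first by rewrite subrr normr0.
have [|xi2 xi2P ->] := mvtx (x + tau); first by rewrite addrAC subrr add0r.
rewrite -mulrBr normrM normrX normrN mulrC ler_pM2r ?exprn_gt0// => le12.
have b1 : `|iter m cderiv (f x) y - iter m cderiv (f x) xi1| < e / 2.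
  by apply: c1; apply: (lt_le_trans xi1P); rewrite /eta !ge_min lexx.
have b2 : `|iter m cderiv (f (x + tau)) y - iter m cderiv (f (x + tau)) xi2| < e / 2.
  by apply: c2; apply: (lt_le_trans xi2P); rewrite /eta !ge_min lexx orbT.
move: b1 b2 le12; move: (iter m cderiv (f x) y) (iter m cderiv (f x) xi1)
  (iter m cderiv (f (x + tau)) y) (iter m cderiv (f (x + tau)) xi2) => A B C D b1 b2 le12.
have -> : A - C = (A - B) + (B - D) + (- (C - D)) by rewrite opprB !addrA !subrK.
rewrite (le_trans (ler_normD _ _))// normrN.
rewrite (le_trans (lerD (ler_normD _ _) (lexx _)))//.
by move: b1 b2 le12; lra.
Qed.

End MixedBounds.

(** * Partial derivatives of functions that are smooth along curves *)

Section MixedPartials.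
Set Implicit Arguments.
Unset Strict Implicit.
Context {R : realType}.

(** Interchange of two limits at 0, one of which is uniform. *)
Lemma limit_interchange (D : R -> R -> R) (a b : R -> R) (C delta : R) :
  0 < delta ->
  (forall tau h, tau != 0 -> h != 0 -> `|tau| < delta -> `|h| < delta ->
     `|D tau h - a tau| <= C * `|h|) ->
  (forall h, h != 0 -> `|h| < delta -> D tau h @[tau --> 0^'] --> b h) ->
  exists q : R, a @ 0^' --> q /\ b @ 0^' --> q.
Proof.
move=> d0 Da Db.
have C1 : 0 < `|C| + 1 by rewrite ltr_wpDl.
have Da' tau h : tau != 0 -> h != 0 -> `|tau| < delta -> `|h| < delta ->
     `|D tau h - a tau| <= (`|C| + 1) * `|h|.
  move=> *; apply: le_trans (Da _ _ _ _ _ _) _ => //; rewrite ler_wpM2r//.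
  by rewrite (le_trans (ler_norm _))// lerDl.
have near_small e : 0 < e -> \forall h \near (0 : R)^', h != 0 /\ `|h| < e.
  move=> e0; near=> h; split; first by near: h; exact: nbhs_dnbhs_neq.
  by near: h; exact: dnbhs0_lt.
have ca : cvg (a @ 0^').
  apply: cauchy_cvg; apply: cauchy_exP => e e0.
  pose eta := Num.min delta (e / 2 / (`|C| + 1)).
  have eta0 : 0 < eta by rewrite lt_min d0 !divr_gt0.
  pose h := eta / 2.
  have h0 : 0 < h by rewrite divr_gt0.
  have hn0 : h != 0 by rewrite gt_eqF.
  have hn : `|h| = h by rewrite gtr0_norm.
  have heta : h < eta by rewrite /h; lra.
  have hd : `|h| < delta by rewrite hn (lt_le_trans heta)// /eta ge_min lexx.
  have Ch : (`|C| + 1) * `|h| < e / 2.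
    rewrite -ltr_pdivlMl// hn [_^-1 * _]mulrC (lt_le_trans heta)// /eta ge_min lexx orbT//.
  have /cvgr_dist_lt /(_ (e / 2)) := Db h hn0 hd; rewrite divr_gt0// => /(_ isT) Dn.
  exists (b h).
  have sm := near_small _ d0.
  have H : \forall tau \near (0 : R)^', `|b h - a tau| < e.
    near=> tau.
    have [t0 td] : tau != 0 /\ `|tau| < delta by near: tau.
    have H1 : `|b h - D tau h| < e / 2 by near: tau.
    have H2 := Da' tau h t0 hn0 td hd.
    rewrite (_ : b h - a tau = (b h - D tau h) + (D tau h - a tau)); last by rewrite addrA subrK.
    rewrite (splitr e) (le_lt_trans (ler_normD _ _))// ltrD//.
    exact: le_lt_trans H2 Ch.
  exact: H.
exists (lim (a @ 0^')); split=> //.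
have bq h : h != 0 -> `|h| < delta -> `|b h - lim (a @ 0^')| <= (`|C| + 1) * `|h|.
  move=> h0 hd.
  have cD : (fun tau => `|D tau h - a tau|) @ 0^' --> `|b h - lim (a @ 0^')|.
    by apply: cvg_norm; apply: cvgB; [exact: Db|].
  apply: (@cvgr_to_le _ _ _ _ _ _ _ cD); near=> tau.
  have [t0 td] : tau != 0 /\ `|tau| < delta by near: tau; exact: near_small.
  exact: Da'.
apply/cvgrPdist_le => e e0; near=> h.
have [h0 hd] : h != 0 /\ `|h| < delta by near: h; exact: near_small.
rewrite distrC (le_trans (bq h h0 hd))// -ler_pdivlMl// ltW//.
have [] : h != 0 /\ `|h| < (`|C| + 1)^-1 * e by near: h; apply: near_small; rewrite mulr_gt0// invr_gt0.
by [].
Unshelve. all: by end_near. Qed.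

Section ParamStep.
Variables (k : R -> R -> R^o) (x0 s : R).
Hypothesis ks : smooth2_at k x0 s.

Let K m tau r : R^o := iter m cderiv (k tau) r.

(** G m tau is the difference quotient in the first variable of the derivative
    of order m in the second one.  Its second derivative is bounded uniformly
    in tau, by the Lipschitz bound of order m + 2, so that its own difference
    quotients converge at a uniform rate, and the limits can be
    interchanged. *)
Lemma param_step (m : nat) (Q : R -> R) :
  (\forall r \near s, is_cderiv (fun tau => K m tau r) x0 (Q r : R^o)) ->
  exists q, is_cderiv (fun tau => K m.+1 tau s) x0 (q : R^o) /\ is_cderiv (Q : R -> R^o) s q.
Proof.
move=> Qn.
have [d1 d10 sm] := near2_smooth_snd ks.
have [d2 [C [d20 C0 lip]]] := iter_deriv_lipschitz ks m.+2.
have [d3 /= d30 Qd] := Qn.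
pose d := Num.min (Num.min d1 d2) d3.
have d0 : 0 < d by rewrite !lt_min d10 d20 d30.
have dd1 (x : R) : `|x| < d -> `|x| < d1 by rewrite !lt_min => /andP[/andP[]].
have dd2 (x : R) : `|x| < d -> `|x| < d2 by rewrite !lt_min => /andP[/andP[]].
have dd3 (x : R) : `|x| < d -> `|x| < d3 by rewrite !lt_min => /andP[].
have xx : `|x0 - x0| < d by rewrite subrr normr0.
have smk tau r : `|tau| < d -> `|r - s| < d -> smooth_at (k (tau + x0)) r.
  by move=> td rd; apply: sm; [rewrite addrK; exact: dd1|exact: dd1].
have smk0 r : `|r - s| < d -> smooth_at (k x0) r.
  by move=> rd; have := smk 0 r; rewrite normr0 add0r; apply.
pose G n tau r := tau^-1 * (K n (tau + x0) r - K n x0 r).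
have dG n tau r : `|tau| < d -> `|r - s| < d -> is_derive r 1 (G n tau) (G n.+1 tau r).
  move=> td rd.
  have := derB (smooth_at_der (smooth_at_iter n (smk tau r td rd)))
               (smooth_at_der (smooth_at_iter n (smk0 r rd))).
  move=> H; apply: (is_derive_eq (derM (der_cst (tau^-1 : R) r) H)).
  by rewrite mul0r add0r.
have G2 tau r : tau != 0 -> `|tau| < d -> `|r - s| < d -> `|G m.+2 tau r| <= C.
  move=> t0 td rd; rewrite /G normrM normfV mulrC ler_pdivrMr ?normr_gt0// distrC.
  have H := lip x0 r tau (dd2 _ xx) (dd2 _ rd) (dd2 _ td).
  by rewrite [x0 + tau]addrC in H.
have [||q [qa qb]] := @limit_interchange (fun tau h => h^-1 * (G m tau (h + s) - G m tau s))
    (fun tau => G m.+1 tau s) (fun h => h^-1 * (Q (h + s) - Q s)) C d d0.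
- move=> tau h t0 h0 td hd.
  have cl x c : `|c - s| <= `|h| -> `|x - s| <= `|c - s| -> `|x - s| < d.
    by move=> H1 H2; apply: le_lt_trans hd; exact: le_trans H1.
  have [x|c cP cE] := @mvt_ball R (G m tau) (G m.+1 tau) s (h + s).
    by rewrite addrK => xh; apply: dG => //; exact: le_lt_trans hd.
  rewrite addrK in cP cE.
  rewrite cE mulrCA mulVf// mulr1.
  have [x xP|c' c'P c'E] := @mvt_ball R (G m.+1 tau) (G m.+2 tau) s c.
    by apply: dG => //; exact: cl xP.
  by rewrite c'E normrM ler_pM// G2//; exact: cl c'P.
- move=> h h0 hd.
  have lim r : `|r - s| < d -> G m tau r @[tau --> 0^'] --> Q r.
    move=> rd; have := Qd r; rewrite /= distrC => /(_ (dd3 _ rd)).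
    exact.
  apply: cvgM; first exact: cvg_cst.
  by apply: cvgB; apply: lim; rewrite ?addrK// subrr normr0.
exists q; split; last exact: qb.
exact: qa.
Qed.

End ParamStep.

(** The other half of Boman's theorem, for first partial derivatives: the
    difference quotients in the first variable converge together with all their
    derivatives in the second one, so that the partial derivative is smooth in
    the second variable, and mixed second derivatives are symmetric. *)
Lemma param_deriv (k : R -> R -> R^o) (x0 r0 : R) :
  (\forall r \near r0, smooth2_at k x0 r) ->
  smooth_at (fun r => cderiv (k^~ r) x0) r0 /\
  cderiv (fun r => cderiv (k^~ r) x0) r0 = cderiv (fun tau => cderiv (k tau) r0) x0.
Proof.
move=> ks.
pose K m tau r : R^o := iter m cderiv (k tau) r.
pose Q m r : R^o := cderiv (fun tau => K m tau r) x0.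
have KQ m r : (\forall s \near r, smooth2_at k x0 s) -> is_cderiv (fun tau => K m tau r) x0 (Q m r).
  elim: m r => [|m IHm] r kr.
    apply/smooth_at_is_cderiv.
    exact: (nbhs_singleton kr) (smooth_at_id x0) (smooth_at_cst r x0) _ _.
  have [|q [q1 _]] := @param_step k x0 r (nbhs_singleton kr) m (Q m).
    by apply: filterS (near_join kr) => s; exact: IHm.
  by rewrite /Q (is_cderivE Ro_hausdorff q1).
have QQ m r : (\forall s \near r, smooth2_at k x0 s) -> is_cderiv (Q m) r (Q m.+1 r).
  move=> kr; have [|q [q1 q2]] := @param_step k x0 r (nbhs_singleton kr) m (Q m).
    by apply: filterS (near_join kr) => s; exact: KQ.
  by rewrite {2}/Q (is_cderivE Ro_hausdorff q1).
have [|sQ QE] := @smooth_tower R R^o Q r0 Ro_hausdorff.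
  by apply: filterS (near_join ks) => r kr m; exact: QQ.
split; [exact: sQ|exact: (nbhs_singleton QE 1%N)].
Qed.

End MixedPartials.

(** * Curves in convenient spaces *)

Section ConvenientCalculus.
Set Implicit Arguments.
Unset Strict Implicit.
Context {R : realType}.

Lemma nearR (P : R -> Prop) (t : R) : (forall s, P s) -> \forall s \near t, P s.
Proof. by move=> H; near=> s; exact: H. Unshelve. all: by end_near. Qed.

Lemma smooth_at_linear (E F : tvsType R) (l : {linear E -> F}) (c : R -> E) t :
  hausdorff_space F -> continuous l -> smooth_at c t ->
  smooth_at (l \o c) t /\ cderiv (l \o c) t = l (cderiv c t).
Proof.
move=> hF cl sc; have [|sQ QE] := @smooth_tower R F (fun n => l \o iter n cderiv c) t hF.
  apply: filterS (smooth_at_near sc) => s ss n; apply: is_cderiv_linear => //.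
  exact/smooth_at_is_cderiv/smooth_at_iter.
by split=> //; apply: (is_cderivE hF); apply: is_cderiv_linear => //; exact: smooth_at_is_cderiv.
Qed.

(** Continuous functionals separate the points of a convenient space: a step
    from 0 to a vector that all functionals annihilate is a smooth curve, hence
    a continuous one. *)
Lemma convenient_separated (E : tvsType R) (v w : E) : convenient E ->
  (forall l : {linear E -> R^o}, continuous l -> l v = l w) -> v = w.
Proof.
move=> [hE cE] lvw; apply/esym/subr0_eq; set u := w - v.
pose c (s : R) : E := if s <= 0 then 0 else u.
have sc : smooth_at c 0.
  apply: cE; apply: nearR => s l cl.
  have -> : l \o c = (fun=> 0) :> (R -> R^o).
    apply/funext => x /=; rewrite /c; case: ifP => _; first by rewrite linear0.
    by rewrite linearB lvw// subrr.
  exact: smooth_at_cst.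
have cc := is_cderiv_continuous (smooth_at_is_cderiv sc); rewrite {2}/c lexx in cc.
apply/esym/hE => A B A0 Bu; exists u; split; last exact: nbhs_singleton.
have /= [e /= e0 eA] := cc A A0.
have : A (c (e / 2)).
  by apply: eA; rewrite /= sub0r normrN gtr0_norm ?divr_gt0//; lra.
by rewrite /c leNgt divr_gt0.
Qed.

Lemma convenient_smooth (E : tvsType R) (c : R -> E) t : convenient E ->
  (\forall s \near t, forall l : {linear E -> R^o}, continuous l -> smooth_at (l \o c) s) ->
  smooth_at c t.
Proof. by move=> [_]; apply. Qed.

Lemma convenient_R : convenient (R^o : tvsType R).
Proof.
split=> [|c t ct]; first exact: Ro_hausdorff.
have := nbhs_singleton ct; pose l : {linear R^o -> R^o} := idfun.
by move=> /(_ l); apply => x; exact: cvg_id.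
Qed.

Section OneSpace.
Variables (E : tvsType R) (convE : convenient E).
Implicit Types (c d : R -> E) (t s : R).

Let hE : hausdorff_space E := convE.1.

Lemma cderiv_linear (l : {linear E -> R^o}) c t : continuous l -> smooth_at c t ->
  cderiv (l \o c) t = l (cderiv c t).
Proof. by move=> cl sc; have [] := smooth_at_linear Ro_hausdorff cl sc. Qed.

Lemma smooth_linear (l : {linear E -> R^o}) c t : continuous l -> smooth_at c t ->
  smooth_at (l \o c) t.
Proof. by move=> cl sc; have [] := smooth_at_linear Ro_hausdorff cl sc. Qed.

(** Continuous functionals reduce the rules of differentiation to those for
    real functions. *)
Lemma cderiv_weak c t (v : E) : smooth_at c t ->
  (forall l : {linear E -> R^o}, continuous l -> is_derive t 1 (l \o c : R -> R) (l v)) ->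
  cderiv c t = v.
Proof.
move=> sc lv; apply: convenient_separated => // l cl.
by rewrite -cderiv_linear//; apply: der_cderiv; exact: lv.
Qed.

Lemma smooth_cst (v : E) t : smooth_at (fun=> v) t.
Proof. by apply: convenient_smooth => //; apply: nearR => s l cl; exact: smooth_at_cst. Qed.

Lemma smoothD c d t : smooth_at c t -> smooth_at d t ->
  smooth_at (fun s => c s + d s) t.
Proof.
move=> sc sd; apply: convenient_smooth => //.
apply: filterS2 (smooth_at_near sc) (smooth_at_near sd) => s cs ds l cl.
have -> : l \o (fun s => c s + d s) = (fun s => l (c s) + l (d s)) :> (R -> R^o).
  by apply/funext => x /=; rewrite linearD.
by apply: smooth_atD; exact: smooth_linear.
Qed.

Lemma smoothZ (a : R -> R^o) c t : smooth_at a t -> smooth_at c t ->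
  smooth_at (fun s => (a s : R) *: c s) t.
Proof.
move=> sa sc; apply: convenient_smooth => //.
apply: filterS2 (smooth_at_near sa) (smooth_at_near sc) => s as_ cs l cl.
have -> : l \o (fun s => (a s : R) *: c s) = (fun s => a s * l (c s)) :> (R -> R^o).
  by apply/funext => x /=; rewrite linearZ.
by apply: smooth_atM => //; exact: smooth_linear.
Qed.

Lemma smoothN c t : smooth_at c t -> smooth_at (fun s => - c s) t.
Proof.
move=> sc; apply: near_smooth_at (smoothZ (smooth_at_cst (-1) t) sc).
by apply: nearR => s; rewrite scaleN1r.
Qed.

Lemma smooth_comp (p : R -> R^o) c t : smooth_at p t -> smooth_at c (p t) ->
  smooth_at (fun s => c (p s)) t.
Proof.
move=> sp sc; apply: convenient_smooth => //.
have cn : \forall s \near t, smooth_at c (p s).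
  exact: (smooth_at_scontinuous sp (smooth_at_near sc)).
apply: filterS2 (smooth_at_near sp) cn => s ps cs l cl.
by apply: (@smooth_at_scomp R p (l \o c)) => //; exact: smooth_linear.
Qed.

Lemma cderivD c d t : smooth_at c t -> smooth_at d t ->
  cderiv (fun s => c s + d s) t = cderiv c t + cderiv d t.
Proof.
move=> sc sd; apply: cderiv_weak; first exact: smoothD.
move=> l cl; have := derD (smooth_at_der (smooth_linear cl sc)) (smooth_at_der (smooth_linear cl sd)).
rewrite !cderiv_linear// -linearD; apply: der_near.
by apply: nearR => s /=; rewrite linearD.
Qed.

Lemma cderivN c t : smooth_at c t -> cderiv (fun s => - c s) t = - cderiv c t.
Proof.
move=> sc; apply: cderiv_weak; first exact: smoothN.
move=> l cl; have := derN (smooth_at_der (smooth_linear cl sc)).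
rewrite cderiv_linear// -linearN; apply: der_near.
by apply: nearR => s /=; rewrite linearN.
Qed.

Lemma cderiv_cst (v : E) t : cderiv (fun=> v) t = 0.
Proof.
apply: cderiv_weak; first exact: smooth_cst.
by move=> l cl; rewrite linear0; exact: der_cst.
Qed.

Lemma cderivZ (k : R) c t : smooth_at c t ->
  cderiv (fun s => k *: c s) t = k *: cderiv c t.
Proof.
move=> sc; apply: cderiv_weak; first exact: smoothZ (smooth_at_cst k t) sc.
move=> l cl; have := derM (der_cst k t) (smooth_at_der (smooth_linear cl sc)).
rewrite mul0r add0r cderiv_linear// -[k * l _]/(k *: (l _ : R^o)) -linearZ.
by apply: der_near; apply: nearR => s /=; rewrite linearZ.
Qed.

Lemma cderiv_line (v w : E) t : cderiv (fun s : R => v + s *: w) t = w.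
Proof.
have sZ : smooth_at (fun s : R => s *: w) t.
  exact: smoothZ (smooth_at_id t) (smooth_cst w t).
rewrite cderivD ?cderiv_cst ?add0r//; last exact: smooth_cst.
apply: cderiv_weak => // l cl.
have := derM (der_id t) (der_cst (l w : R) t).
rewrite mul1r mulr0 addr0; apply: der_near.
by apply: nearR => s /=; rewrite linearZ.
Qed.

Lemma cderiv_scale (k : R) c t : smooth_at c (k * t) ->
  cderiv (fun s => c (k * s)) t = k *: cderiv c (k * t).
Proof.
move=> sc; have sk : smooth_at ((fun s => k * s) : R -> R^o) t.
  by apply: smooth_atM; [exact: smooth_at_cst|exact: smooth_at_id].
apply: cderiv_weak; first exact: (@smooth_comp (fun s => k * s)).
move=> l cl; rewrite linearZ /= -cderiv_linear//.
have d1 := derM (der_cst k t) (der_id t).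
have := der_comp d1 (smooth_at_der (smooth_linear cl sc)).
by rewrite mul0r add0r mulr1.
Qed.

End OneSpace.

Lemma diffquot_shift (E : tvsType R) (c : R -> E) (a t : R) :
  diffquot (fun h => c (a + h)) t = diffquot c (a + t).
Proof. by apply/funext => h; rewrite /diffquot addrCA. Qed.

Lemma cderiv_shift (E : tvsType R) (c : R -> E) (a t : R) :
  cderiv (fun h => c (a + h)) t = cderiv c (a + t).
Proof. by rewrite /cderiv diffquot_shift. Qed.

Lemma smooth_at_shift (E : tvsType R) (c : R -> E) (a t : R) :
  smooth_at c (a + t) -> smooth_at (fun h => c (a + h)) t.
Proof.
move=> sc; have itE n : iter n cderiv (fun h => c (a + h)) = (fun h => iter n cderiv c (a + h)).
  by elim: n => //= n ->; apply/funext => h; rewrite cderiv_shift.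
have ca : (fun h : R => a + h) h @[h --> t] --> a + t.
  by apply: cvgD; [exact: cvg_cst|exact: cvg_id].
have : \forall s \near t, forall n, cderivable (iter n cderiv c) (a + s) := ca _ sc.
by apply: filterS => s cs n; rewrite itE; have [v cv] := cs n; exists v; rewrite diffquot_shift.
Qed.

(** Hadamard's lemma.  The derivative of order m of (f r - f 0) / r is
    hadamard_num m r / r ^ (m + 1), where the derivative of hadamard_num m is
    r ^ m times that of order m + 1 of f, so that one application of the mean
    value theorem to hadamard_num m controls it near 0. *)
Section Hadamard.
Variable f : R -> R.
Hypothesis sf : smooth_at (f : R -> R^o) 0.

Let D n := iter n cderiv (f : R -> R^o) : R -> R.

Fixpoint hadamard_num (m : nat) (r : R) : R :=
  if m is n.+1 then r ^+ n.+1 * D n.+1 r - n.+1%:R * hadamard_num n r else f r - f 0.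

Definition hadamard_quot (m : nat) (r : R) : R :=
  if r == 0 then D m.+1 0 / m.+1%:R else hadamard_num m r / r ^+ m.+1.

Lemma der_hadamard_num m r : smooth_at (f : R -> R^o) r ->
  is_derive r 1 (hadamard_num m) (r ^+ m * D m.+1 r).
Proof.
move=> sr; have dD n : is_derive r 1 (D n) (D n.+1 r).
  exact/smooth_at_der/smooth_at_iter.
elim: m => [|m IHm].
  by apply: (is_derive_eq (derB (dD 0%N) (der_cst (f 0) r))); rewrite expr0 mul1r subr0.
have dX : is_derive r 1 (fun x : R => x ^+ m.+1) (m.+1%:R * r ^+ m).
  have := @is_deriveX R R id m.+1 r 1 _ (der_id r).
  by rewrite exprfctE => H; apply: (is_derive_eq H); rewrite scaleRE mulr1.
have := derB (derM dX (dD m.+1)) (derM (der_cst (m.+1%:R : R) r) IHm).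
by move=> H; apply: (is_derive_eq H); ring.
Qed.

Lemma hadamard_num0 m : hadamard_num m 0 = 0.
Proof. by elim: m => [|m IHm] /=; rewrite ?subrr// IHm expr0n mul0r mulr0 subrr. Qed.

Lemma hadamard_num_taylor m : exists C, \forall r \near (0 : R),
  `|hadamard_num m r - D m.+1 0 / m.+1%:R * r ^+ m.+1 - D m.+2 0 / m.+2%:R * r ^+ m.+2|
    <= C * `|r| ^+ m.+3.
Proof.
have c3 := smooth_at_scontinuous (smooth_at_iter m.+3 sf).
pose C := `|D m.+3 0| + 1.
have hC : \forall s \near (0 : R), `|D m.+3 s| <= C.
  have /(cvgr_dist_le) := c3; move=> /(_ 1 ltr01); apply: filterS => s hs.
  by rewrite /C -lerBlDl; apply: le_trans hs; rewrite distrC lerB_dist.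
have [e /= e0 eP] : \forall s \near (0 : R), `|D m.+3 s| <= C /\ smooth_at (f : R -> R^o) s.
  by apply: filterS2 hC (smooth_at_near sf).
have ne : \forall r \near (0 : R), `|r| < e.
  by exists e => // r /=; rewrite sub0r normrN.
exists C; near=> r.
have re : `|r| < e by near: r.
have ball x : `|x| <= `|r| -> `|D m.+3 x| <= C /\ smooth_at (f : R -> R^o) x.
  by move=> xr; apply: eP; rewrite /= sub0r normrN (le_lt_trans xr).
have C0 : 0 <= C by rewrite addr_ge0.
have rem x : `|x| <= `|r| -> `|D m.+1 x - D m.+1 0 - D m.+2 0 * x| <= C * `|x| ^+ 2.
  move=> xr.
  have [y|y yx yE] := @mvt_ball R (D m.+1) (D m.+2) 0 x.
    rewrite !subr0 => yx; apply/smooth_at_der/smooth_at_iter.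
    exact: (ball _ (le_trans yx xr)).2.
  rewrite !subr0 in yx yE; rewrite yE -mulrBl.
  have [z|z zy zE] := @mvt_ball R (D m.+2) (D m.+3) 0 y.
    rewrite !subr0 => zy; apply/smooth_at_der/smooth_at_iter.
    exact: (ball _ (le_trans zy (le_trans yx xr))).2.
  rewrite !subr0 in zy zE; rewrite zE !normrM expr2 mulrA ler_wpM2r// ler_pM//.
  exact: (ball _ (le_trans zy (le_trans yx xr))).1.
pose g x := hadamard_num m x - D m.+1 0 / m.+1%:R * x ^+ m.+1 - D m.+2 0 / m.+2%:R * x ^+ m.+2.
have dX n (x : R) : is_derive x 1 (fun x : R => x ^+ n.+1) (n.+1%:R * x ^+ n).
  have := @is_deriveX R R id n.+1 x 1 _ (der_id x).
  by rewrite exprfctE => H; apply: (is_derive_eq H); rewrite scaleRE mulr1.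
have [x|x xr xE] := @mvt_ball R g (fun x => x ^+ m * (D m.+1 x - D m.+1 0 - D m.+2 0 * x)) 0 r.
  rewrite !subr0 => xr.
  have d0 := der_hadamard_num m (ball _ xr).2.
  have d1 := derM (der_cst (D m.+1 0 / m.+1%:R : R) x) (dX m x).
  have d2 := derM (der_cst (D m.+2 0 / m.+2%:R : R) x) (dX m.+1 x).
  apply: (is_derive_eq (derB (derB d0 d1) d2)).
  rewrite !mul0r !add0r ![_ / _ * (_ * _)]mulrA !divfK ?pnatr_eq0//.
  by rewrite exprS; ring.
rewrite !subr0 in xr xE.
have g0 : g 0 = 0 by rewrite /g hadamard_num0 !expr0n !mulr0 !subr0.
rewrite g0 subr0 in xE; rewrite -/(g r) xE !normrM normrX.
have -> : C * `|r| ^+ m.+3 = `|r| ^+ m * (C * `|r| ^+ 2) * `|r|.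
  by rewrite -addn3 exprD; ring.
rewrite ler_wpM2r// ler_pM ?exprn_ge0//; first by rewrite lerXn2r ?nnegrE.
by apply: (le_trans (rem _ xr)); rewrite ler_wpM2l// lerXn2r ?nnegrE.
Unshelve. all: by end_near. Qed.

Lemma der_hadamard_quot m r : smooth_at (f : R -> R^o) r ->
  is_derive r 1 (hadamard_quot m) (hadamard_quot m.+1 r).
Proof.
move=> sr; have [->|r0] := eqVneq r 0.
  have [C HC] := hadamard_num_taylor m.
  apply: (@der_quad _ _ _ _ C); near=> x.
  have [->|x0] := eqVneq x 0; first by rewrite !subrr mulr0 subr0 normr0 expr0n mulr0.
  have Hx : `|hadamard_num m x - D m.+1 0 / m.+1%:R * x ^+ m.+1 - D m.+2 0 / m.+2%:R * x ^+ m.+2|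
    <= C * `|x| ^+ m.+3 by near: x.
  have xp : 0 < `|x ^+ m.+1| by rewrite normr_gt0 expf_neq0.
  rewrite /hadamard_quot eqxx (negbTE x0) -(ler_pM2r xp) -normrM.
  rewrite [X in `|X|](_ : _ = hadamard_num m x - D m.+1 0 / m.+1%:R * x ^+ m.+1 - D m.+2 0 / m.+2%:R * x ^+ m.+2); last first.
    by rewrite subr0 !mulrBl divfK ?expf_neq0// [x ^+ m.+2]exprS [_ * (x * _)]mulrA.
  apply: (le_trans Hx); rewrite subr0 -mulrA normrX -real_normK ?num_real//.
  by rewrite -exprD addSn add1n.
have H : is_derive r 1 (fun x => hadamard_num m x / x ^+ m.+1) (hadamard_quot m.+1 r).
  have dX : is_derive r 1 (fun x : R => x ^+ m.+1) (m.+1%:R * r ^+ m).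
    have := @is_deriveX R R id m.+1 r 1 _ (der_id r).
    by rewrite exprfctE => H; apply: (is_derive_eq H); rewrite scaleRE mulr1.
  have rm : r ^+ m.+1 != 0 by rewrite expf_neq0.
  have := derM (der_hadamard_num m sr) (@derV R (fun x : R => x ^+ m.+1) r _ rm dX).
  move=> H; apply: (is_derive_eq H).
  rewrite /hadamard_quot (negbTE r0) /= !exprS; field.
  by rewrite r0 expf_neq0.
have nr : nbhs r [set x : R | x != 0].
  by apply: open_nbhs_nbhs; split => //; exact: open_neq.
apply: der_near H; near=> x.
rewrite /hadamard_quot; suff /negbTE -> : x != 0 by [].
by near: x.
Unshelve. all: by end_near. Qed.

Lemma smooth_hadamard_quot : smooth_at (hadamard_quot 0 : R -> R^o) 0.
Proof.
apply: (@smooth_tower R R^o hadamard_quot 0 Ro_hausdorff _).1.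
apply: filterS (smooth_at_near sf) => s ss n.
by apply/is_cderiv_derive; exact: der_hadamard_quot.
Qed.

End Hadamard.

End ConvenientCalculus.

(** * Maps from the plane to a convenient space *)

Section PlaneCalculus.
Set Implicit Arguments.
Unset Strict Implicit.
Context {R : realType}.

Definition d1 (E : tvsType R) (f : R -> R -> E) (x y : R) : E := cderiv (f^~ y) x.
Definition d2 (E : tvsType R) (f : R -> R -> E) (x y : R) : E := cderiv (f x) y.

Lemma smooth2_point (E : tvsType R) (f : R -> R -> E) x y :
  smooth2 f x y -> smooth2_at f x y.
Proof. exact: near2_point. Qed.

Lemma smooth2_near (E : tvsType R) (f : R -> R -> E) x y :
  smooth2 f x y -> near2 (smooth2 f) x y.
Proof. exact: near2_near2. Qed.

Lemma smooth2_at_swap (E : tvsType R) (f : R -> R -> E) x y :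
  smooth2_at f x y -> smooth2_at (fun a b => f b a) y x.
Proof. by move=> sf p q r sp sq pr qr; exact: (sf q p r sq sp qr pr). Qed.

Lemma smooth2_swap (E : tvsType R) (f : R -> R -> E) x y :
  smooth2 f x y -> smooth2 (fun a b => f b a) y x.
Proof.
by move=> [d d0 H]; exists d => // a b ay bx; apply: smooth2_at_swap; exact: H.
Qed.

Lemma smooth2_at_fst (E : tvsType R) (f : R -> R -> E) x y :
  smooth2_at f x y -> smooth_at (f^~ y) x.
Proof.
by move=> sf; exact: (sf (fun x => x) (fun=> y) x (smooth_at_id x) (smooth_at_cst y x)).
Qed.

Lemma smooth2_at_snd (E : tvsType R) (f : R -> R -> E) x y :
  smooth2_at f x y -> smooth_at (f x) y.
Proof.
by move=> sf; exact: (sf (fun=> x) (fun x => x) y (smooth_at_cst x y) (smooth_at_id y)).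
Qed.

Lemma smooth2_at_diag (E : tvsType R) (f : R -> R -> E) x :
  smooth2_at f x x -> smooth_at (fun r => f r r) x.
Proof.
by move=> sf; exact: (sf (fun x => x) (fun x => x) x (smooth_at_id x) (smooth_at_id x)).
Qed.

Lemma smooth2_at_near_eq (E : tvsType R) (f g : R -> R -> E) x y :
  near2 (fun a b => f a b = g a b) x y -> smooth2_at f x y -> smooth2_at g x y.
Proof.
move=> fg sf p q r sp sq pr qr; apply: near_smooth_at (sf p q r sp sq pr qr).
exact: near2_scurve fg sp sq pr qr.
Qed.

Lemma smooth2_near_eq (E : tvsType R) (f g : R -> R -> E) x y :
  near2 (fun a b => f a b = g a b) x y -> smooth2 f x y -> smooth2 g x y.
Proof.
move=> /near2_near2 fg sf; apply: near2_sub (near2_and fg sf) => a b [].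
exact: smooth2_at_near_eq.
Qed.

(** Smooth curves detect continuity in the plane. *)
Lemma smooth2_at_continuous (f : R -> R -> R^o) x y e : smooth2_at f x y -> 0 < e ->
  near2 (fun a b => `|f a b - f x y| < e) x y.
Proof.
move=> sf e0; apply: near2_of_curves => p q r sp sq pr qr.
have /smooth_at_scontinuous/cvgr_dist_lt /(_ e e0) := sf p q r sp sq pr qr.
by apply: filterS => s; rewrite distrC pr qr.
Qed.

Lemma near2_comp P (a b : R -> R -> R^o) x y :
  smooth2_at a x y -> smooth2_at b x y -> near2 P (a x y) (b x y) ->
  near2 (fun u v => P (a u v) (b u v)) x y.
Proof.
move=> sa sb nP; apply: near2_of_curves => p q r sp sq pr qr.
apply: (near2_scurve nP (sa p q r sp sq pr qr) (sb p q r sp sq pr qr)).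
  by rewrite pr qr.
by rewrite pr qr.
Qed.

Section OneSpace.
Variables (E : tvsType R) (convE : convenient E).
Implicit Types (f g : R -> R -> E) (c : R -> E).

Lemma smooth2_at_linear f (l : {linear E -> R^o}) x y : continuous l ->
  smooth2_at f x y -> smooth2_at (fun a b => l (f a b)) x y.
Proof.
move=> cl sf p q r sp sq pr qr.
exact: (smooth_linear cl (sf p q r sp sq pr qr)).
Qed.

Lemma near2_of_smooth_at_fst c x y : smooth_at c x -> near2 (fun a _ => smooth_at c a) x y.
Proof.
move=> sc; apply: near2_of_curves => p q r sp sq pr qr.
by apply: (smooth_at_scontinuous sp); rewrite pr; exact: smooth_at_near.
Qed.

Lemma smooth2_fst c x y : smooth_at c x -> smooth2 (fun a _ => c a) x y.
Proof.
move=> /(near2_of_smooth_at_fst y); apply: near2_sub => a b sc p q r sp sq pr qr.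
by apply: smooth_comp => //; rewrite pr.
Qed.

Lemma smooth2_snd c x y : smooth_at c y -> smooth2 (fun _ b => c b) x y.
Proof. by move=> sc; apply: smooth2_swap; exact: smooth2_fst. Qed.

Lemma smooth2D f g x y : smooth2 f x y -> smooth2 g x y ->
  smooth2 (fun a b => f a b + g a b) x y.
Proof.
move=> sf sg; apply: near2_sub (near2_and sf sg) => a b [fab gab] p q r sp sq pr qr.
by apply: smoothD => //; [exact: (fab p q)|exact: (gab p q)].
Qed.

Lemma smooth2Z (k : R -> R -> R^o) f x y : smooth2 k x y -> smooth2 f x y ->
  smooth2 (fun a b => (k a b : R) *: f a b) x y.
Proof.
move=> sf sg; apply: near2_sub (near2_and sf sg) => a b [fab gab] p q r sp sq pr qr.
by apply: (@smoothZ R E convE (fun s => k (p s) (q s))); [exact: (fab p q)|exact: (gab p q)].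
Qed.

(** Along a curve (p, q) this is the derivative in tau, at 0, of
    f (p r + tau) (q r), to which param_deriv applies once a functional has
    been composed with f. *)
Lemma smooth2_at_d1 f x y : smooth2 f x y -> smooth2_at (d1 f) x y.
Proof.
move=> sf p q r0 sp sq pr qr; apply: convenient_smooth => //.
have nf : \forall r \near r0, smooth2 f (p r) (q r).
  exact: near2_scurve (smooth2_near sf) sp sq pr qr.
have sn : \forall r \near r0, [/\ smooth2 f (p r) (q r), smooth_at p r & smooth_at q r].
  by apply: filterS3 nf (smooth_at_near sp) (smooth_at_near sq).
apply: filterS (near_join sn) => s ns l cl.
pose k (tau r : R) : R^o := l (f (p r + tau) (q r)).
have sk : \forall r \near s, smooth2_at k 0 r.
  apply: filterS ns => r [sfr spr sqr] a b t sa sb at0 bt.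
  apply: (@smooth_linear _ _ l (fun x => f (p (b x) + a x) (q (b x)))) => //.
  apply: (smooth2_point sfr (p := fun x => p (b x) + a x) (q := fun x => q (b x))).
  - apply: (@smooth_atD R (fun x => p (b x)) a); last exact: sa.
    by apply: (@smooth_at_scomp R b p); rewrite ?bt.
  - by apply: (@smooth_at_scomp R b q); rewrite ?bt.
  - by rewrite at0 bt addr0.
  - by rewrite bt.
apply: near_smooth_at (param_deriv sk).1.
apply: filterS ns => r [sfr _ _] /=.
rewrite (cderiv_shift (fun h => l (f h (q r)) : R^o) (p r) 0) addr0.
exact: (cderiv_linear cl (smooth2_at_fst (smooth2_point sfr))).
Qed.

Lemma smooth2_d1 f x y : smooth2 f x y -> smooth2 (d1 f) x y.
Proof. by move=> /smooth2_near; apply: near2_sub => a b; exact: smooth2_at_d1. Qed.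

Lemma smooth2_d2 f x y : smooth2 f x y -> smooth2 (d2 f) x y.
Proof. by move=> sf; exact: smooth2_swap (smooth2_d1 (smooth2_swap sf)). Qed.

Lemma near_snd f x y : smooth2 f x y -> \forall r \near y, smooth2 f x r.
Proof.
move=> /smooth2_near sf.
exact: (near2_scurve sf (smooth_at_cst x y) (smooth_at_id y) erefl erefl).
Qed.

Lemma near_fst f x y : smooth2 f x y -> \forall r \near x, smooth2 f r y.
Proof.
move=> /smooth2_near sf.
exact: (near2_scurve sf (smooth_at_id x) (smooth_at_cst y x) erefl erefl).
Qed.

(** Continuous functionals reduce this to the symmetry for real functions. *)
Lemma schwarz f x y : smooth2 f x y -> d2 (d1 f) x y = d1 (d2 f) x y.
Proof.
move=> sf; apply: (convenient_separated convE) => l cl.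
have sk : \forall r \near y, smooth2_at (fun a b => l (f a b) : R^o) x r.
  apply: filterS (near_snd sf) => r sr; apply: smooth2_at_linear => //.
  exact: smooth2_point.
have [_ E0] := param_deriv sk.
have s1 : smooth_at (d1 f x) y by exact: smooth2_at_snd (smooth2_at_d1 sf).
have s2 : smooth_at (fun a => d2 f a y) x.
  exact: smooth2_at_fst (smooth2_point (smooth2_d2 sf)).
rewrite /d2 -(cderiv_linear cl s1) /d1 -(cderiv_linear cl s2).
transitivity (cderiv (fun r => cderiv (fun a => l (f a r) : R^o) x) y).
  apply: near_cderiv; apply: filterS (near_snd sf) => r sr /=.
  exact/esym/(cderiv_linear cl (smooth2_at_fst (smooth2_point sr))).
rewrite E0; apply: near_cderiv; apply: filterS (near_fst sf) => r sr /=.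
exact: (cderiv_linear cl (smooth2_at_snd (smooth2_point sr))).
Qed.

(** The chain rule in the only form that is needed.  The increment splits into
    one in each variable; the mean value theorem and the continuity of the
    partial derivative take care of the variable that moves second. *)
Lemma cderiv_diag f x : smooth2 f x x ->
  cderiv (fun r => f r r) x = d1 f x x + d2 f x x.
Proof.
move=> sf; apply: (cderiv_weak convE) => [|l cl].
  exact: smooth2_at_diag (smooth2_point sf).
pose k a b : R := l (f a b).
have [d d0 sk] := near2_and (smooth2_near sf) sf.
have dk1 a b : smooth2 f a b -> is_derive a 1 (k^~ b) (l (d1 f a b)).
  move=> /smooth2_point/smooth2_at_fst sab.
  by rewrite /d1 -(cderiv_linear cl sab); apply: smooth_at_der; exact: smooth_linear.
have dk2 a b : smooth2 f a b -> is_derive b 1 (k a) (l (d2 f a b)).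
  move=> /smooth2_point/smooth2_at_snd sab.
  by rewrite /d2 -(cderiv_linear cl sab); apply: smooth_at_der; exact: smooth_linear.
apply/is_cderiv_derive; rewrite linearD /is_cderiv.
have H2 : diffquot (k x : R -> R^o) x @ 0^' --> l (d2 f x x).
  by apply/is_cderiv_derive; exact: dk2.
have H1 : (fun h => diffquot (k^~ (h + x) : R -> R^o) x h) @ 0^' --> l (d1 f x x).
  apply/cvgrPdist_lt => e e0.
  have cd := smooth2_at_continuous (smooth2_at_linear cl (smooth2_at_d1 sf)) e0.
  have [eta eta0 H] := near2_and (smooth2_near sf) cd.
  have nd : \forall h \near (0 : R)^', `|h| < eta by exact: dnbhs0_lt.
  near=> h.
  have h0 : h != 0 by near: h; exact: nbhs_dnbhs_neq.
  have hd : `|h| < eta by near: h.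
  have xh : `|h + x - x| < eta by rewrite addrK.
  have [c|c cx cE] := @mvt_ball R (k^~ (h + x)) (fun a => l (d1 f a (h + x))) x (h + x).
    rewrite addrK => ch; apply: dk1; apply: (H _ _ _ xh).1.
    exact: le_lt_trans hd.
  rewrite addrK in cx cE.
  rewrite /diffquot cE scaleRE mulrCA mulVf// mulr1 distrC.
  by apply: (H _ _ _ xh).2; exact: le_lt_trans hd.
have H : (fun h => diffquot (k^~ (h + x) : R -> R^o) x h + diffquot (k x : R -> R^o) x h) @ 0^'
    --> l (d1 f x x) + l (d2 f x x) by exact: cvgD_tvs.
apply: cvg_trans H; apply: near_eq_cvg; near=> h.
by rewrite /diffquot /= -scalerDr addrA subrK.
Unshelve. all: by end_near. Qed.

Definition hadamard c (r : R) : E := if r == 0 then cderiv c 0 else r^-1 *: (c r - c 0).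

Lemma hadamardE c r : c r = c 0 + r *: hadamard c r.
Proof.
rewrite /hadamard; have [->|r0] := eqVneq r 0; first by rewrite scale0r addr0.
by rewrite scalerA divff// scale1r addrC subrK.
Qed.

Lemma hadamard0 c : hadamard c 0 = cderiv c 0.
Proof. by rewrite /hadamard eqxx. Qed.

Lemma smooth_hadamard c : smooth_at c 0 -> smooth_at (hadamard c) 0.
Proof.
move=> sc; apply: convenient_smooth => //.
apply: filterS (smooth_at_near sc) => s sn l cl.
have [->|s0] := eqVneq s 0.
  have := smooth_hadamard_quot (smooth_linear cl sc).
  apply: near_smooth_at; apply: nearR => r; rewrite /hadamard_quot /hadamard /=.
  case: eqVneq => [r0|r0]; first by rewrite divr1; exact: cderiv_linear.
  by rewrite expr1 linearZ linearB /= scaleRE mulrC.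
have nr : nbhs s [set x : R | x != 0].
  by apply: open_nbhs_nbhs; split => //; exact: open_neq.
have H : smooth_at ((fun r => r^-1 * (l (c r) - l (c 0))) : R -> R^o) s.
  apply: smooth_atM; first by apply: smooth_atV => //; exact: smooth_at_id.
  apply: smooth_atD; first exact: (smooth_linear cl sn).
  by apply: smooth_atN; exact: smooth_at_cst.
apply: near_smooth_at H; apply: filterS nr => r /negbTE r0.
by rewrite /hadamard /= r0 linearZ linearB.
Qed.

End OneSpace.

(** The derivative of a smooth map along a curve depends only on the velocity
    of the curve: by Hadamard's lemma the curve is the diagonal of the plane
    map (s, r) |-> c 0 + s z r, that is constant for s = 0 and the tangent
    line for r = 0. *)
Lemma chain_velocity (E F : tvsType R) (convE : convenient E) (convF : convenient F)
    (Psi : E -> F) (c : R -> E) :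
  smooth2 (fun s r : R => Psi (c 0 + s *: hadamard c r)) 0 0 ->
  cderiv (Psi \o c) 0 = cderiv (fun s : R => Psi (c 0 + s *: cderiv c 0)) 0.
Proof.
move=> sh; have -> : Psi \o c = (fun r => Psi (c 0 + r *: hadamard c r)).
  by apply/funext => r /=; rewrite [in LHS]hadamardE.
rewrite (cderiv_diag convF sh) /d2.
under [X in _ + cderiv X _]eq_fun do rewrite scale0r addr0.
by rewrite (cderiv_cst convF) addr0 /d1 hadamard0.
Qed.

Lemma smooth_at_cvg (E : tvsType R) (c : R -> E) t : smooth_at c t -> c s @[s --> t] --> c t.
Proof. by move=> /smooth_at_is_cderiv; exact: is_cderiv_continuous. Qed.

(** Expand x and y by Hadamard's lemma, to the second order.  All terms but the
    two of the product rule are r times values of b along smooth curves; the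
    last hypothesis on b, that these vanish at 0, holds for bounded b as well
    as for b smooth along curves. *)
Lemma bilinear_product_rule (E F G : tvsType R) (convE : convenient E) (convF : convenient F)
    (b : E -> F -> G) (x : R -> E) (y : R -> F) t :
  (forall u u' v, b (u + u') v = b u v + b u' v) ->
  (forall u v v', b u (v + v') = b u v + b u v') ->
  (forall (k : R) u v, b (k *: u) v = k *: b u v) ->
  (forall (k : R) u v, b u (k *: v) = k *: b u v) ->
  (forall (X : R -> E) (Y : R -> F), smooth_at X 0 -> smooth_at Y 0 ->
     r *: b (X r) (Y r) @[r --> 0^'] --> 0) ->
  smooth_at x t -> smooth_at y t ->
  is_cderiv (fun r => b (x r) (y r)) t (b (cderiv x t) (y t) + b (x t) (cderiv y t)).
Proof.
move=> bDl bDr bZl bZr b0 sx sy.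
pose X r := x (t + r); pose Y r := y (t + r).
have sX : smooth_at X 0 by apply: smooth_at_shift; rewrite addr0.
have sY : smooth_at Y 0 by apply: smooth_at_shift; rewrite addr0.
have X0 : X 0 = x t by rewrite /X addr0.
have Y0 : Y 0 = y t by rewrite /Y addr0.
have dX : cderiv X 0 = cderiv x t by rewrite (cderiv_shift x t 0) addr0.
have dY : cderiv Y 0 = cderiv y t by rewrite (cderiv_shift y t 0) addr0.
pose zX := hadamard X; pose zY := hadamard Y.
have szX : smooth_at zX 0 by exact: smooth_hadamard.
have szY : smooth_at zY 0 by exact: smooth_hadamard.
pose wX := hadamard zX; pose wY := hadamard zY.
have swX : smooth_at wX 0 by exact: smooth_hadamard.
have swY : smooth_at wY 0 by exact: smooth_hadamard.
have zX0 : zX 0 = cderiv X 0 by exact: hadamard0.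
have zY0 : zY 0 = cderiv Y 0 by exact: hadamard0.
rewrite /is_cderiv -X0 -Y0 -dX -dY.
have lim : (fun r : R => (b (cderiv X 0) (Y 0) + b (X 0) (cderiv Y 0)) +
    (r *: b (X 0) (wY r) + r *: b (cderiv X 0) (zY r) + r *: b (wX r) (Y r))) @ 0^' -->
    (b (cderiv X 0) (Y 0) + b (X 0) (cderiv Y 0)) + (0 + 0 + 0).
  apply: cvgD_tvs; first exact: cvg_cst.
  apply: cvgD_tvs; first apply: cvgD_tvs.
  - by apply: (b0 (fun=> X 0)) => //; exact: smooth_cst.
  - by apply: (b0 (fun=> cderiv X 0)) => //; exact: smooth_cst.
  - exact: b0.
rewrite !addr0 in lim; apply: cvg_trans lim; apply: near_eq_cvg; near=> h.
have h0 : h != 0 by near: h; exact: nbhs_dnbhs_neq.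
rewrite /diffquot [h + t]addrC -/(X h) -/(Y h).
have -> : b (x t) (y t) = b (X 0) (Y 0) by rewrite X0 Y0.
have EX : X h = X 0 + h *: zX h by exact: hadamardE.
have EY : Y h = Y 0 + h *: zY h by exact: hadamardE.
have EzX : zX h = cderiv X 0 + h *: wX h by rewrite -zX0; exact: hadamardE.
have EzY : zY h = cderiv Y 0 + h *: wY h by rewrite -zY0; exact: hadamardE.
have -> : b (X h) (Y h) - b (X 0) (Y 0) =
    h *: (b (X 0) (zY h) + b (zX h) (Y h)).
  by rewrite {1}EX bDl bZl {1}EY bDr bZr addrAC [b (X 0) (Y 0) + _]addrC addrK scalerDr.
have E1 : b (X 0) (zY h) = b (X 0) (cderiv Y 0) + h *: b (X 0) (wY h).
  by rewrite EzY bDr bZr.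
have E2 : b (cderiv X 0) (Y h) = b (cderiv X 0) (Y 0) + h *: b (cderiv X 0) (zY h).
  by rewrite EY bDr bZr.
have E3 : b (zX h) (Y h) = b (cderiv X 0) (Y h) + h *: b (wX h) (Y h).
  by rewrite EzX bDl bZl.
rewrite scalerA mulVf// scale1r E3 E1 E2 !addrA; congr (_ + _).
by congr (_ + _); rewrite -addrA addrC.
Unshelve. all: by end_near. Qed.

Lemma linear_rule (E F : tvsType R) (convE : convenient E) (T : E -> F) (y : R -> E) t :
  hausdorff_space F ->
  (forall u v, T (u + v) = T u + T v) -> (forall (k : R) u, T (k *: u) = k *: T u) ->
  (forall Y : R -> E, smooth_at Y 0 -> smooth_at (T \o Y) 0) ->
  smooth_at y t -> cderiv (T \o y) t = T (cderiv y t).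
Proof.
move=> hF TD TZ sT sy; apply: (is_cderivE hF).
pose Y r := y (t + r).
have sY : smooth_at Y 0 by apply: smooth_at_shift; rewrite addr0.
have dY : cderiv Y 0 = cderiv y t by rewrite (cderiv_shift y t 0) addr0.
have cz := smooth_at_cvg (sT _ (smooth_hadamard convE sY)).
rewrite /= hadamard0 dY in cz.
have cz' : (T \o hadamard Y) @ 0^' --> T (cderiv y t) by exact: cvg_within_filter.
apply: cvg_trans cz'; apply: near_eq_cvg; near=> h.
have h0 : h != 0 by near: h; exact: nbhs_dnbhs_neq.
have EY : y (t + h) = y t + h *: hadamard Y h.
  by have := hadamardE Y h; rewrite {1 2}/Y addr0.
by rewrite /diffquot /= [h + t]addrC EY TD TZ addrAC subrr add0r scalerA mulVf// scale1r.
Unshelve. all: by end_near. Qed.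

Lemma right0_cvg : (fun x : R => x : R^o) @ ((0 : R)^'+) --> (0 : R^o).
Proof. by move=> V [e e0 eV]; exists e => // x xe x0; exact: eV. Qed.

Lemma compact_vn_bounded (E : tvsType R) (c : R -> E) (K : set R) :
  compact K -> (forall r, K r -> c s @[s --> r] --> c r) -> vn_bounded (c @` K).
Proof.
move=> cK cc U U0.
have cov : \forall eta \near (0 : R)^'+, K `<=` [set r | U (eta *: c r)].
  apply: (iffLR (compact_near_coveringP K) cK _ _ (fun eta r => U (eta *: c r))) => r Kr.
  have H : (fun z : R * R => z.2 *: c z.1) z @[z --> (nbhs r, (0 : R)^'+)] --> 0 *: c r.
    apply: cvgZ_tvs.
      apply: (@cvg_comp _ _ _ snd (fun x : R => x : R^o)); first exact: cvg_snd.
      exact: right0_cvg.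
    move=> V /(cc r Kr) nV; exists ([set s | V (c s)], setT); last by move=> z [].
    by split => //; exact: filterT.
  by rewrite scale0r in H; exact: (H U U0).
near (0 : R)^'+ => eta.
have eta0 : 0 < eta by [].
exists eta^-1; first by rewrite invr_gt0.
move=> _ [r Kr <-]; exists (eta *: c r).
  by move: r Kr; near: eta.
by rewrite scalerA mulVf ?scale1r// gt_eqF.
Unshelve. all: by end_near. Qed.

(** Pieces of smooth curves are compact, hence bounded, and so are the values
    of a bounded bilinear map on them. *)
Lemma bounded_bilinear_cvg0 (E F : tvsType R) (b : E -> E -> F) (X Y : R -> E) :
  bounded2 b -> smooth_at X 0 -> smooth_at Y 0 -> r *: b (X r) (Y r) @[r --> 0^'] --> 0.
Proof.
move=> bb sX sY.
have [e /= e0 He] : \forall s \near (0 : R), smooth_at X s /\ smooth_at Y s.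
  by apply: filterS2 (smooth_at_near sX) (smooth_at_near sY).
pose K : set R := `[- (e / 2), e / 2]%classic.
have cK : compact K by exact: segment_compact.
have Ks s : K s -> smooth_at X s /\ smooth_at Y s.
  rewrite /K /= in_itv /= => se; apply: He.
  by rewrite /= sub0r normrN (le_lt_trans (y := e / 2)) ?ler_norml//; lra.
have bX : vn_bounded (X @` K).
  by apply: compact_vn_bounded => // s /Ks[sx _]; exact: smooth_at_cvg.
have bY : vn_bounded (Y @` K).
  by apply: compact_vn_bounded => // s /Ks[_ sy]; exact: smooth_at_cvg.
have bB := bb _ _ bX bY.
move=> U U0.
have := @scale_continuous R F (0, 0) U; rewrite /= scale0r => /(_ U0) [[/= N V] [N0 V0] NV].
have [rho rho0 Brho] := bB V V0.
have c0 : (fun r : R => r * rho) r @[r --> (0 : R)] --> (0 : R).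
  by rewrite -[X in _ --> X](mul0r rho); apply: cvgM; [exact: cvg_id|exact: cvg_cst].
have nN : \forall r \near (0 : R), N (r * rho) by exact: (c0 N N0).
have nK : \forall r \near (0 : R), K r.
  exists (e / 2); first by rewrite /= divr_gt0.
  by move=> r; rewrite /= sub0r normrN => /ltW; rewrite /K /= in_itv /= ler_norml.
have : \forall r \near (0 : R), U (r *: b (X r) (Y r)).
  apply: filterS2 nN nK => r Nr Kr.
  have [|v Vv <-] := Brho (b (X r) (Y r)).
    by exists (X r); [exists r|exists (Y r); [exists r|]].
  by rewrite scalerA; exact: (NV (r * rho, v)).
by move=> [d d0 dU]; exists d => // r rd _; exact: dU.
Qed.

End PlaneCalculus.

(** * Smooth maps into a Lie group *)

Section LieGroups.
Set Implicit Arguments.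
Unset Strict Implicit.
Context {R : realType} {E : tvsType R} {G : groupType}.
Variables (A : set (chart E G)) (lieG : is_lie_group A).
Variables (a : chart E G) (Aa : A a) (a1 : cdom a 1%g).
Implicit Types (c d : R -> G) (t s r : R) (x y : R).

Lemma lie_convenient : convenient E. Proof. by case: lieG. Qed.
Lemma lie_atlas : is_atlas A. Proof. by case: lieG. Qed.
Let convE := lie_convenient.

Lemma msmooth_at_near c t : msmooth_at A c t -> \forall s \near t, msmooth_at A c s.
Proof.
move=> [b Ab [bc sc]]; apply: filterS2 (near_join bc) (smooth_at_near sc) => s bs ss.
by exists b.
Qed.

(** A smooth curve can be read in every chart around its position, by the
    smoothness of the chart changes. *)
Lemma chart_curve (b : chart E G) c t : A b -> msmooth_at A c t -> cdom b (c t) ->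
  (\forall s \near t, cdom b (c s)) /\ smooth_at (cmap b \o c) t.
Proof.
move=> Ab [e Ae [ec sc]] bct; have [_ inv op tr] := lie_atlas.
have ect := nbhs_singleton ec.
have Ot : (cmap e @` (cdom e `&` cdom b)) (cmap e (c t)) by exists (c t).
have On := op e b Ae Ab (cmap e \o c) t sc Ot.
have bc : \forall s \near t, cdom b (c s).
  apply: filterS2 On ec => s [z [ez bz] /= zE] es.
  by rewrite -(inv e (c s) Ae es) -zE (inv e z Ae ez).
split=> //; have := tr e b Ae Ab (cmap e \o c) t sc On.
by apply: near_smooth_at; apply: filterS ec => s es /=; rewrite inv.
Qed.

Lemma msmooth_cst (g : G) t : msmooth_at A (fun=> g) t.
Proof.
have [cov _ _ _] := lie_atlas; have [b Ab bg] := cov g.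
exists b => //; split; first exact: nearR.
exact: smooth_cst.
Qed.

Lemma msmoothM c d t : msmooth_at A c t -> msmooth_at A d t ->
  msmooth_at A (fun k => c k * d k)%g t.
Proof. by case: lieG => _ _ + _; exact. Qed.

Lemma msmoothV c t : msmooth_at A c t -> msmooth_at A (fun k => (c k)^-1)%g t.
Proof. by case: lieG => _ _ _; exact. Qed.

Lemma cderiv_ext (F : tvsType R) (e f : R -> F) t : (forall s, e s = f s) ->
  cderiv e t = cderiv f t.
Proof. by move=> ef; congr (cderiv _ t); apply/funext. Qed.

Lemma msmooth_comp (p : R -> R^o) c t : smooth_at p t -> msmooth_at A c (p t) ->
  msmooth_at A (fun k => c (p k)) t.
Proof.
move=> sp [b Ab [bc sc]]; exists b => //; split.
  exact: (smooth_at_scontinuous sp bc).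
exact: (smooth_comp convE sp sc).
Qed.

Definition chart_range : set E := cmap a @` cdom a.

Lemma chart_rangeP p : chart_range p -> cdom a (cinv a p) /\ cmap a (cinv a p) = p.
Proof. by have [_ inv _ _] := lie_atlas; move=> [z az <-]; rewrite inv. Qed.

Lemma chart_range_open : cinfty_open chart_range.
Proof. by have [_ _ op _] := lie_atlas; have := op a a Aa Aa; rewrite setIid. Qed.

Lemma cinvK (g : G) : cdom a g -> cinv a (cmap a g) = g.
Proof. by have [_ inv _ _] := lie_atlas; exact: inv. Qed.

Lemma msmooth_cinv (v : R -> E) t : smooth_at v t -> chart_range (v t) ->
  msmooth_at A (fun k => cinv a (v k)) t.
Proof.
move=> sv vt; have nv := chart_range_open sv vt; exists a => //; split.
  by apply: filterS nv => s /chart_rangeP[].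
by apply: near_smooth_at sv; apply: filterS nv => s /chart_rangeP[_ /= ->].
Qed.

(** * Smooth maps from the plane to the group *)

(** The analogue of smooth2_at for maps into the group. *)
Definition msm2_at (w : R -> R -> G) x y : Prop :=
  forall (p q : R -> R^o) r, smooth_at p r -> smooth_at q r -> p r = x -> q r = y ->
    msmooth_at A (fun k => w (p k) (q k)) r.

Definition msm2 w x y := near2 (msm2_at w) x y.

Lemma msm2_cst (g : G) x y : msm2 (fun _ _ => g) x y.
Proof. by exists 1 => // b b' _ _ p q r *; exact: msmooth_cst. Qed.

Lemma msm2M w w' x y : msm2 w x y -> msm2 w' x y -> msm2 (fun b b' => w b b' * w' b b')%g x y.
Proof.
move=> sw sw'; apply: near2_sub (near2_and sw sw') => b b' [H H'] p q r sp sq pr qr.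
by apply: msmoothM; [exact: H|exact: H'].
Qed.

Lemma msm2V w x y : msm2 w x y -> msm2 (fun b b' => (w b b')^-1)%g x y.
Proof.
apply: near2_sub => b b' H p q r sp sq pr qr.
by apply: msmoothV; exact: H.
Qed.

Lemma msm2_swap w x y : msm2 w x y -> msm2 (fun b b' => w b' b) y x.
Proof.
move=> [d d0 H]; exists d => // b b' by_ b'x p q r sp sq pr qr.
exact: (H b' b b'x by_ q p r sq sp qr pr).
Qed.

Lemma msm2_fst c x y : msmooth_at A c x -> msm2 (fun b _ => c b) x y.
Proof.
move=> sc; have : near2 (fun b _ => msmooth_at A c b) x y.
  apply: near2_of_curves => p q r sp sq pr qr.
  by apply: (smooth_at_scontinuous sp); rewrite pr; exact: msmooth_at_near.
apply: near2_sub => b b' cb p q r sp sq pr qr.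
by apply: msmooth_comp => //; rewrite pr.
Qed.

Lemma msm2_snd c x y : msmooth_at A c y -> msm2 (fun _ b => c b) x y.
Proof. by move=> sc; apply: msm2_swap; exact: msm2_fst. Qed.

Lemma msm2_comp w (p q : R -> R -> R^o) x y : smooth2 p x y -> smooth2 q x y ->
  msm2 w (p x y) (q x y) -> msm2 (fun b b' => w (p b b') (q b b')) x y.
Proof.
move=> sp sq sw.
have swn := near2_comp (smooth2_point sp) (smooth2_point sq) sw.
apply: near2_sub (near2_and (near2_and sp sq) swn) => b b' [[pb qb] wb] u v r su sv ur vr.
by apply: (wb _ _ r (pb u v r su sv ur vr) (qb u v r su sv ur vr)); rewrite ur vr.
Qed.

Lemma msm2_global w x y : msmooth2 A w -> msm2 w x y.
Proof. by move=> sw; exists 1 => // b b' _ _ p q r sp sq _ _; exact: sw. Qed.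

Lemma msm2_at_fst w x y : msm2_at w x y -> msmooth_at A (w^~ y) x.
Proof.
by move=> sw; exact: (sw (fun x => x) (fun=> y) x (smooth_at_id x) (smooth_at_cst y x)).
Qed.

Lemma msm2_at_snd w x y : msm2_at w x y -> msmooth_at A (w x) y.
Proof.
by move=> sw; exact: (sw (fun=> x) (fun x => x) y (smooth_at_cst x y) (smooth_at_id y)).
Qed.

Lemma msm2_cinv (v : R -> R -> E) x y : smooth2 v x y -> chart_range (v x y) ->
  msm2 (fun b b' => cinv a (v b b')) x y.
Proof.
move=> sv vxy; have nv : near2 (fun b b' => chart_range (v b b')) x y.
  apply: near2_of_curves => p q r sp sq pr qr.
  apply: (chart_range_open (smooth2_point sv sp sq pr qr)).
  by rewrite pr qr.
apply: near2_sub (near2_and sv nv) => b b' [sb vb] p q r sp sq pr qr.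
apply: (@msmooth_cinv (fun k => v (p k) (q k))); first exact: sb.
by rewrite pr qr.
Qed.

Lemma msm2_dom w x y : msm2_at w x y -> cdom a (w x y) ->
  near2 (fun b b' => cdom a (w b b')) x y.
Proof.
move=> sw wxy; apply: near2_of_curves => p q r sp sq pr qr.
by apply: (chart_curve Aa (sw p q r sp sq pr qr) _).1; rewrite pr qr.
Qed.

Lemma msm2_chart w x y : msm2 w x y -> cdom a (w x y) ->
  smooth2 (fun b b' => cmap a (w b b')) x y.
Proof.
move=> sw wxy.
apply: near2_sub (near2_and sw (msm2_dom (near2_point sw) wxy)) => b b' [wb db].
move=> p q r sp sq pr qr.
by apply: (chart_curve Aa (wb p q r sp sq pr qr) _).2; rewrite pr qr.
Qed.

(** * Families of curves depending on two numbers *)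

(** Along each curve in the plane of the first two variables, the map becomes a
    smooth map of two variables: its velocity in the third variable is then
    smooth along curves in the first two. *)
Definition msm3 (w : R -> R -> R -> G) x y : Prop :=
  near2 (fun b b' => forall (p q : R -> R^o) r, smooth_at p r -> smooth_at q r ->
    p r = b -> q r = b' -> msm2 (fun k s => w (p k) (q k) s) r 0) x y.

Lemma msm3M w w' x y : msm3 w x y -> msm3 w' x y ->
  msm3 (fun b b' s => w b b' s * w' b b' s)%g x y.
Proof.
move=> sw sw'; apply: near2_sub (near2_and sw sw') => b b' [H H'] p q r sp sq pr qr.
by apply: msm2M; [exact: H|exact: H'].
Qed.

Lemma msm3V w x y : msm3 w x y -> msm3 (fun b b' s => (w b b' s)^-1)%g x y.
Proof.
apply: near2_sub => b b' H p q r sp sq pr qr.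
by apply: msm2V; exact: H.
Qed.

Lemma msm3_12 w x y : msm2 w x y -> msm3 (fun b b' _ => w b b') x y.
Proof.
apply: near2_sub => b b' H p q r sp sq pr qr.
by apply: (@msm2_fst (fun k => w (p k) (q k))); exact: H.
Qed.

Lemma msm3_13 w x y : msm2 w x 0 -> msm3 (fun b _ s => w b s) x y.
Proof.
move=> /near2_near2 sw.
have : near2 (fun b _ => msm2 w b 0) x y.
  apply: near2_of_curves => p q r sp sq pr qr.
  exact: (near2_scurve sw sp (smooth_at_cst 0 r) pr erefl).
apply: near2_sub => b b' wb p q r sp sq pr qr.
apply: (@msm2_comp w (fun k _ => p k) (fun _ s => s)).
- exact: (smooth2_fst convenient_R).
- exact: (smooth2_snd convenient_R _ (smooth_at_id 0)).
- by rewrite pr.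
Qed.

Lemma msm3_3 c x y : msmooth_at A c 0 -> msm3 (fun _ _ s => c s) x y.
Proof. by move=> sc; exists 1 => // b b' _ _ p q r *; exact: msm2_snd. Qed.

Lemma msm3_deriv w x y : msm3 w x y -> cdom a (w x y 0) ->
  smooth2 (fun b b' => cderiv (fun s => cmap a (w b b' s)) 0) x y.
Proof.
move=> sw wxy.
have w0 : msm2_at (fun b b' => w b b' 0) x y.
  move=> p q r sp sq pr qr.
  have := near2_point (near2_point sw p q r sp sq pr qr).
  exact: (@msm2_at_fst (fun k s => w (p k) (q k) s)).
apply: near2_sub (near2_and sw (msm2_dom w0 wxy)) => b b' [wb db] p q r sp sq pr qr.
have sm : smooth2 (fun k s => cmap a (w (p k) (q k) s)) r 0.
  by apply: msm2_chart; [exact: wb|rewrite pr qr].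
exact: (smooth2_at_fst (smooth2_point (smooth2_d2 convE sm))).
Qed.

(** * Velocities of curves through the unit *)

Definition vel c : E := cderiv (cmap a \o c) 0.

Definition line (xi : E) (s : R) : G := cinv a (cmap a 1%g + s *: xi).

Lemma chart_range1 : chart_range (cmap a 1%g).
Proof. by exists 1%g. Qed.

Lemma line0 xi : line xi 0 = 1%g.
Proof. by rewrite /line scale0r addr0 cinvK. Qed.

Lemma smooth_affine_line (v xi : E) t : smooth_at (fun s : R => v + s *: xi) t.
Proof.
apply: smoothD => //; first exact: smooth_cst.
by apply: (@smoothZ _ _ _ (fun s => s)) => //; [exact: smooth_at_id|exact: smooth_cst].
Qed.

Lemma msmooth_line xi : msmooth_at A (line xi) 0.
Proof.
apply: (@msmooth_cinv (fun s => cmap a 1%g + s *: xi)); first exact: smooth_affine_line.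
by rewrite scale0r addr0; exact: chart_range1.
Qed.

Lemma msm2_line (X : R -> E) x : smooth_at X x ->
  msm2 (fun b s => line (X b) s) x 0.
Proof.
move=> sX; apply: (@msm2_cinv (fun b s => cmap a 1%g + s *: X b)).
  apply: smooth2D => //; first exact/smooth2_fst/smooth_cst.
  apply: (@smooth2Z _ _ _ (fun _ s => s)) => //.
    by apply: smooth2_snd; [exact: convenient_R|exact: smooth_at_id].
  exact: smooth2_fst.
by rewrite scale0r addr0; exact: chart_range1.
Qed.

Lemma cmap_line xi : \forall s \near (0 : R), cmap a (line xi s) = cmap a 1%g + s *: xi.
Proof.
have := chart_range_open (smooth_affine_line (cmap a 1%g) xi 0).
rewrite scale0r addr0 => /(_ chart_range1); apply: filterS => s /chart_rangeP[].
by [].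
Qed.

Lemma vel_line xi : vel (line xi) = xi.
Proof. by rewrite /vel (near_cderiv (cmap_line xi)) cderiv_line. Qed.

Lemma vel_cst (g : G) : vel (fun=> g) = 0.
Proof. exact: cderiv_cst. Qed.

Lemma smooth_chart c t : msmooth_at A c t -> cdom a (c t) -> smooth_at (cmap a \o c) t.
Proof. by move=> sc ct; exact: (chart_curve Aa sc ct).2. Qed.

Lemma near_dom c t : msmooth_at A c t -> cdom a (c t) -> \forall s \near t, cdom a (c s).
Proof. by move=> sc ct; exact: (chart_curve Aa sc ct).1. Qed.

Lemma cderiv_mul (g h : G) c d : cdom a (g * h)%g -> msmooth_at A c 0 -> msmooth_at A d 0 ->
  c 0 = 1%g -> d 0 = 1%g ->
  cderiv (fun s => cmap a (g * (c s * d s) * h)%g) 0 =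
  cderiv (fun s => cmap a (g * c s * h)%g) 0 + cderiv (fun s => cmap a (g * d s * h)%g) 0.
Proof.
move=> ag sc sd c0 d0.
have sw : smooth2 (fun b s => cmap a (g * (c b * d s) * h)%g) 0 0.
  apply: msm2_chart; last by rewrite c0 d0 !mulg1.
  apply: msm2M; last exact: msm2_cst.
  by apply: msm2M; [exact: msm2_cst|apply: msm2M; [exact: msm2_fst|exact: msm2_snd]].
rewrite (cderiv_diag convE sw); congr (_ + _).
  by apply: cderiv_ext => s; rewrite d0 mulg1.
by apply: cderiv_ext => s; rewrite c0 mul1g.
Qed.

Lemma velM c d : msmooth_at A c 0 -> msmooth_at A d 0 -> c 0 = 1%g -> d 0 = 1%g ->
  vel (fun s => c s * d s)%g = vel c + vel d.
Proof.
move=> sc sd c0 d0; have a11 : cdom a (1 * 1)%g by rewrite mulg1.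
have := cderiv_mul a11 sc sd c0 d0.
have unitE (e : R -> G) : (fun s => cmap a (1 * e s * 1)%g) = cmap a \o e.
  by apply/funext => s; rewrite /= mul1g mulg1.
by rewrite !unitE.
Qed.

Lemma velV c : msmooth_at A c 0 -> c 0 = 1%g -> vel (fun s => (c s)^-1)%g = - vel c.
Proof.
move=> sc c0; apply/eqP; rewrite -addr_eq0 addrC -velM//; last by rewrite c0 invg1.
  have -> : (fun s => c s * (c s)^-1)%g = (fun=> 1%g) :> (R -> G).
    by apply/funext => s; rewrite mulgV.
  by rewrite vel_cst.
exact: msmoothV.
Qed.

Lemma chain_vel (F : tvsType R) (convF : convenient F) (Psi : G -> F) c :
  (forall w, msm2 w 0 0 -> w 0 0 = 1%g -> smooth2 (fun b s => Psi (w b s)) 0 0) ->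
  msmooth_at A c 0 -> c 0 = 1%g ->
  cderiv (Psi \o c) 0 = cderiv (fun s => Psi (line (vel c) s)) 0.
Proof.
move=> sPsi sc c0.
have ac0 : cdom a (c 0) by rewrite c0.
have sac := smooth_chart sc ac0.
rewrite (@near_cderiv _ _ (Psi \o c) ((Psi \o cinv a) \o (cmap a \o c))); last first.
  by apply: filterS (near_dom sc ac0) => s /= as_; rewrite cinvK.
rewrite (chain_velocity convE convF) /= c0; last first.
  apply: sPsi; last by rewrite scale0r addr0 cinvK.
  apply: (@msm2_cinv (fun s r : R => cmap a 1%g + s *: hadamard (cmap a \o c) r)).
    apply: smooth2D => //; first exact/smooth2_fst/smooth_cst.
    apply: (@smooth2Z _ _ _ (fun s _ => s)) => //.
      by apply: smooth2_fst; [exact: convenient_R|exact: smooth_at_id].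
    by apply: smooth2_snd => //; exact: smooth_hadamard.
  by rewrite scale0r addr0; exact: chart_range1.
by [].
Qed.

(** * The bilinear part of the multiplication, and the bracket *)

(** The left invariant vector field of eta as a function on the group. *)
Definition lfield (eta : E) (g : G) : E := cderiv (fun s => cmap a (g * line eta s)%g) 0.

(** The bilinear part of the multiplication, read in the chart around the unit:
    xi belongs to the left factor. *)
Definition bmul (xi eta : E) : E :=
  cderiv (fun r => left_invariant a eta (cmap a 1%g + r *: xi)) 0.

Lemma bmulE xi eta : bmul xi eta = cderiv (fun r => lfield eta (line xi r)) 0.
Proof. by []. Qed.

Lemma adE xi eta : ad a xi eta = bmul xi eta - bmul eta xi.
Proof. by []. Qed.

Lemma smooth2_lfield (X : R -> E) (w : R -> R -> G) x y :
  smooth_at X x -> msm2 w x y -> cdom a (w x y) ->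
  smooth2 (fun b b' => lfield (X b) (w b b')) x y.
Proof.
move=> sX sw wxy; apply: (@msm3_deriv (fun b b' s => w b b' * line (X b) s)%g).
  apply: msm3M; first exact: msm3_12.
  by apply: (@msm3_13 (fun b s => line (X b) s)); exact: msm2_line.
by rewrite line0 mulg1.
Qed.

(** Left translation is smooth, and chain_vel replaces d by the line with the
    same velocity. *)
Lemma lfield_vel (g : G) d : cdom a g -> msmooth_at A d 0 -> d 0 = 1%g ->
  cderiv (fun s => cmap a (g * d s)%g) 0 = lfield (vel d) g.
Proof.
move=> ag sd d0; apply: (@chain_vel _ convE (fun h => cmap a (g * h)%g)) => // w sw w0.
by apply: (@msm2_chart (fun b s => g * w b s)%g); [exact: msm2M (msm2_cst g 0 0) sw|rewrite w0 mulg1].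
Qed.

Lemma smooth_lfield (eta : E) c t : msmooth_at A c t -> cdom a (c t) ->
  smooth_at (fun r => lfield eta (c r)) t.
Proof.
move=> sc ct.
have := @smooth2_lfield (fun=> eta) (fun b _ => c b) t 0 (smooth_cst convE eta t) (msm2_fst 0 sc) ct.
by move=> /smooth2_point/smooth2_at_fst.
Qed.

Lemma cderiv_lfield (eta : E) c : msmooth_at A c 0 -> c 0 = 1%g ->
  cderiv (fun r => lfield eta (c r)) 0 = bmul (vel c) eta.
Proof.
move=> sc c0; rewrite bmulE; apply: (@chain_vel _ convE (lfield eta)) => // w sw w0.
by apply: (@smooth2_lfield (fun=> eta)) => //; [exact: smooth_cst|rewrite w0].
Qed.

Lemma mixed_mul c d : msmooth_at A c 0 -> msmooth_at A d 0 -> c 0 = 1%g -> d 0 = 1%g ->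
  cderiv (fun r => cderiv (fun s => cmap a (c r * d s)%g) 0) 0 = bmul (vel c) (vel d).
Proof.
move=> sc sd c0 d0; rewrite -(cderiv_lfield (vel d) sc c0); apply: near_cderiv.
have ac0 : cdom a (c 0) by rewrite c0.
by apply: filterS (near_dom sc ac0) => r ar; exact: lfield_vel.
Qed.

(** The same mixed derivative in the other order, which gives access to
    linearity in the left factor. *)
Lemma mixed_mul_swap c d : msmooth_at A c 0 -> msmooth_at A d 0 -> c 0 = 1%g -> d 0 = 1%g ->
  cderiv (fun s => cderiv (fun r => cmap a (c r * d s)%g) 0) 0 = bmul (vel c) (vel d).
Proof.
move=> sc sd c0 d0; rewrite -(mixed_mul sc sd c0 d0).
have sw : smooth2 (fun r s => cmap a (c r * d s)%g) 0 0.
  by apply: msm2_chart; [apply: msm2M; [exact: msm2_fst|exact: msm2_snd]|rewrite c0 d0 mulg1].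
exact: (schwarz convE sw).
Qed.

Lemma lfieldD eta eta' (g : G) : cdom a g ->
  lfield (eta + eta') g = lfield eta g + lfield eta' g.
Proof.
move=> ag; have sl := msmooth_line.
rewrite -{1}(vel_line eta) -{1}(vel_line eta') -velM ?line0// -lfield_vel ?line0 ?mulg1//.
  have ag1 : cdom a (g * 1)%g by rewrite mulg1.
  have := cderiv_mul ag1 (sl eta) (sl eta') (line0 eta) (line0 eta').
  have unitE (e : R -> G) : (fun s => cmap a (g * e s * 1)%g) = (fun s => cmap a (g * e s)%g).
    by apply/funext => s; rewrite mulg1.
  by rewrite !unitE.
exact: msmoothM.
Qed.

Lemma lfieldZ (k : R) eta (g : G) : cdom a g -> lfield (k *: eta) g = k *: lfield eta g.
Proof.
move=> ag; rewrite /lfield.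
have -> : (fun s => cmap a (g * line (k *: eta) s)%g) = (fun s => cmap a (g * line eta (k * s))%g).
  by apply/funext => s; rewrite /line scalerA mulrC.
have sg : msmooth_at A (fun s => g * line eta s)%g 0.
  by apply: msmoothM; [exact: msmooth_cst|exact: msmooth_line].
rewrite (cderiv_scale convE (c := fun s => cmap a (g * line eta s)%g)) ?mulr0//.
by apply: (smooth_chart sg); rewrite line0 mulg1.
Qed.

Lemma near_line_dom xi : \forall r \near (0 : R), cdom a (line xi r).
Proof. by apply: near_dom; [exact: msmooth_line|rewrite line0]. Qed.

Lemma bmulDr xi eta eta' : bmul xi (eta + eta') = bmul xi eta + bmul xi eta'.
Proof.
rewrite !bmulE -(cderivD convE); try by apply: smooth_lfield; [exact: msmooth_line|rewrite line0].
by apply: near_cderiv; apply: filterS (near_line_dom xi) => r ar; exact: lfieldD.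
Qed.

Lemma bmulZr (k : R) xi eta : bmul xi (k *: eta) = k *: bmul xi eta.
Proof.
rewrite !bmulE -(cderivZ convE); last by apply: smooth_lfield; [exact: msmooth_line|rewrite line0].
by apply: near_cderiv; apply: filterS (near_line_dom xi) => r ar; exact: lfieldZ.
Qed.

Lemma bmulZl (k : R) xi eta : bmul (k *: xi) eta = k *: bmul xi eta.
Proof.
rewrite !bmulE.
have -> : (fun r => lfield eta (line (k *: xi) r)) = (fun r => lfield eta (line xi (k * r))).
  by apply/funext => r; rewrite /line scalerA mulrC.
rewrite (cderiv_scale convE (c := fun r => lfield eta (line xi r))) ?mulr0//.
by apply: smooth_lfield; [exact: msmooth_line|rewrite line0].
Qed.

Lemma bmulDl xi xi' eta : bmul (xi + xi') eta = bmul xi eta + bmul xi' eta.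
Proof.
have sl := msmooth_line; pose d := line eta.
have mixE e : msmooth_at A e 0 -> e 0 = 1%g ->
    bmul (vel e) eta = cderiv (fun s => cderiv (fun r => cmap a (e r * d s)%g) 0) 0.
  move=> se e0; have := mixed_mul_swap se (sl eta) e0 (line0 eta).
  by rewrite vel_line => <-.
have sm e : msmooth_at A e 0 -> e 0 = 1%g ->
    smooth_at (fun s => cderiv (fun r => cmap a (e r * d s)%g) 0) 0.
  move=> se e0.
  have sw : smooth2 (fun r s => cmap a (e r * d s)%g) 0 0.
    apply: msm2_chart; last by rewrite e0 mul1g /d line0.
    by apply: msm2M; [exact: msm2_fst|exact: (@msm2_snd d 0 0 (sl eta))].
  exact: (smooth2_at_snd (smooth2_at_d1 convE sw)).
have := mixE (fun r => line xi r * line xi' r)%g (msmoothM (sl xi) (sl xi')).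
rewrite !line0 mulg1 (velM (sl xi) (sl xi') (line0 xi) (line0 xi')) !vel_line => /(_ erefl) ->.
have := mixE (line xi) (sl xi) (line0 xi); rewrite vel_line => ->.
have := mixE (line xi') (sl xi') (line0 xi'); rewrite vel_line => ->.
rewrite -(cderivD convE); try by apply: sm; rewrite ?line0//; exact: sl.
apply: near_cderiv; apply: filterS (near_line_dom eta) => s as_.
have ag1 : cdom a (1 * d s)%g by rewrite mul1g.
have := cderiv_mul ag1 (sl xi) (sl xi') (line0 xi) (line0 xi').
have unitE (e : R -> G) : (fun r => cmap a (1 * e r * d s)%g) = (fun r => cmap a (e r * d s)%g).
  by apply/funext => r; rewrite mul1g.
by rewrite !unitE.
Qed.

Lemma adDl xi xi' eta : ad a (xi + xi') eta = ad a xi eta + ad a xi' eta.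
Proof. by rewrite !adE bmulDl bmulDr opprD addrACA. Qed.

Lemma adDr xi eta eta' : ad a xi (eta + eta') = ad a xi eta + ad a xi eta'.
Proof. by rewrite !adE bmulDl bmulDr opprD addrACA. Qed.

Lemma adZl (k : R) xi eta : ad a (k *: xi) eta = k *: ad a xi eta.
Proof. by rewrite !adE bmulZl bmulZr scalerBr. Qed.

Lemma adZr (k : R) xi eta : ad a xi (k *: eta) = k *: ad a xi eta.
Proof. by rewrite !adE bmulZl bmulZr scalerBr. Qed.

Lemma adN xi eta : ad a xi eta = - ad a eta xi.
Proof. by rewrite !adE opprB. Qed.

Lemma smooth_bmul (X Y : R -> E) t : smooth_at X t -> smooth_at Y t ->
  smooth_at (fun k => bmul (X k) (Y k)) t.
Proof.
move=> sX sY.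
have sm : smooth2 (fun k r => lfield (Y k) (line (X k) r)) t 0.
  by apply: smooth2_lfield => //; [exact: msm2_line|rewrite line0].
exact: (smooth2_at_fst (smooth2_point (smooth2_d2 convE sm))).
Qed.

Lemma smooth_ad (X Y : R -> E) t : smooth_at X t -> smooth_at Y t ->
  smooth_at (fun k => ad a (X k) (Y k)) t.
Proof.
by move=> sX sY; apply: smoothD => //; [|apply: smoothN => //]; exact: smooth_bmul.
Qed.

Lemma cderiv_ad (X Y : R -> E) t : smooth_at X t -> smooth_at Y t ->
  cderiv (fun k => ad a (X k) (Y k)) t =
  ad a (cderiv X t) (Y t) + ad a (X t) (cderiv Y t).
Proof.
move=> sX sY; apply: (is_cderivE convE.1).
apply: (bilinear_product_rule convE convE) => //.
- exact: adDl.
- exact: adDr.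
- exact: adZl.
- exact: adZr.
move=> X' Y' sX' sY'; rewrite -(scale0r (ad a (X' 0) (Y' 0))).
have sz : smooth_at (fun r : R => (r : R) *: ad a (X' r) (Y' r)) 0.
  by apply: (@smoothZ _ _ _ (fun r => r)) => //; [exact: smooth_at_id|exact: smooth_ad].
by apply: cvg_within_filter; exact: (smooth_at_cvg sz).
Qed.

(** * The adjoint representation *)

(** In (c r d(s) c(r)^-1) c r = c r d(s), differentiated in s and then in r,
    the last factor on the left contributes the bilinear part of d s * c r. *)
Lemma mixed_conj c d : msmooth_at A c 0 -> msmooth_at A d 0 -> c 0 = 1%g -> d 0 = 1%g ->
  cderiv (fun r => cderiv (fun s => cmap a (c r * d s * (c r)^-1)%g) 0) 0 =
  ad a (vel c) (vel d).
Proof.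
move=> sc sd c0 d0.
pose M b r := cderiv (fun s => cmap a (c b * d s * (c b)^-1 * c r)%g) 0.
have sM : smooth2 M 0 0.
  apply: (@msm3_deriv (fun b r s => c b * d s * (c b)^-1 * c r)%g).
    apply: msm3M; last by apply: (@msm3_12 (fun _ r => c r)); exact: msm2_snd.
    apply: msm3M; last by apply: msm3V; apply: (@msm3_12 (fun b _ => c b)); exact: msm2_fst.
    by apply: msm3M; [apply: (@msm3_12 (fun b _ => c b)); exact: msm2_fst|exact: msm3_3].
  by rewrite c0 d0 invg1 !mulg1.
have := cderiv_diag convE sM.
have -> : (fun r => M r r) = (fun r => cderiv (fun s => cmap a (c r * d s)%g) 0).
  by apply/funext => r; apply: cderiv_ext => s; rewrite mulgVK.
rewrite (mixed_mul sc sd c0 d0) => bE.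
have d1E : d1 M 0 0 = cderiv (fun r => cderiv (fun s => cmap a (c r * d s * (c r)^-1)%g) 0) 0.
  by rewrite /d1 /M c0; apply: cderiv_ext => r; apply: cderiv_ext => s; rewrite mulg1.
have d2E : d2 M 0 0 = bmul (vel d) (vel c).
  rewrite -(mixed_mul_swap sd sc d0 c0) /d2 /M c0; apply: cderiv_ext => r.
  by apply: cderiv_ext => s; rewrite mul1g invg1 mulg1.
by rewrite -d1E adE bE d2E; exact/esym/addrK.
Qed.

Definition Ad (g : G) (eta : E) : E := vel (fun s => g * line eta s * g^-1)%g.

Lemma msmooth_conj (g : G) c t : msmooth_at A c t -> msmooth_at A (fun s => g * c s * g^-1)%g t.
Proof.
move=> sc; apply: msmoothM; last exact: msmooth_cst.
by apply: msmoothM => //; exact: msmooth_cst.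
Qed.

Lemma conj0 (g : G) c : c 0 = 1%g -> (g * c 0 * g^-1)%g = 1%g.
Proof. by move=> ->; rewrite mulg1 mulgV. Qed.

Lemma vel_conj (g : G) d : msmooth_at A d 0 -> d 0 = 1%g ->
  vel (fun s => g * d s * g^-1)%g = Ad g (vel d).
Proof.
move=> sd d0; apply: (@chain_vel _ convE (fun h => cmap a (g * h * g^-1)%g)) => // w sw w0.
apply: (@msm2_chart (fun b s => g * w b s * g^-1)%g); last by rewrite w0 mulg1 mulgV.
by apply: msm2M; [apply: msm2M => //|]; exact: msm2_cst.
Qed.

Lemma AdD (g : G) eta eta' : Ad g (eta + eta') = Ad g eta + Ad g eta'.
Proof.
have sl := msmooth_line.
rewrite -{1}(vel_line eta) -{1}(vel_line eta') -velM ?line0//.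
rewrite -vel_conj ?line0 ?mulg1//; last exact: msmoothM.
rewrite /Ad -velM; try exact: msmooth_conj.
- by congr vel; apply/funext => s; rewrite !mulgA mulgVK.
- by rewrite line0 mulg1 mulgV.
- by rewrite line0 mulg1 mulgV.
Qed.

Lemma smooth_Ad_line (g : G) (Y : R -> E) t : smooth_at Y t ->
  smooth2 (fun k s => cmap a (g * line (Y k) s * g^-1)%g) t 0.
Proof.
move=> sY; apply: msm2_chart; last by rewrite line0 mulg1 mulgV.
apply: msm2M; last exact: msm2_cst.
by apply: msm2M; [exact: msm2_cst|exact: msm2_line].
Qed.

Lemma smooth_Ad (g : G) (Y : R -> E) t : smooth_at Y t -> smooth_at (fun k => Ad g (Y k)) t.
Proof.
move=> sY; exact: (smooth2_at_fst (smooth2_point (smooth2_d2 convE (smooth_Ad_line g sY)))).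
Qed.

Lemma AdZ (g : G) (k : R) eta : Ad g (k *: eta) = k *: Ad g eta.
Proof.
rewrite /Ad /vel.
have -> : cmap a \o (fun s => g * line (k *: eta) s * g^-1)%g =
          (fun s => (cmap a \o (fun s => g * line eta s * g^-1)%g) (k * s)).
  by apply/funext => s; rewrite /= /line scalerA mulrC.
rewrite (cderiv_scale convE) ?mulr0//.
apply: smooth_chart; first by apply: msmooth_conj; exact: msmooth_line.
by rewrite line0 mulg1 mulgV.
Qed.

Lemma cderiv_Ad (g : G) (Y : R -> E) t : smooth_at Y t ->
  cderiv (fun k => Ad g (Y k)) t = Ad g (cderiv Y t).
Proof.
move=> sY; apply: (linear_rule convE convE.1) => //.
- exact: AdD.
- exact: AdZ.
- by move=> Y' sY'; exact: smooth_Ad.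
Qed.

(** Conjugation by g maps the curves that define the bracket of xi and eta to
    curves that define the bracket of Ad g xi and Ad g eta. *)
Lemma Ad_ad (g : G) xi eta : Ad g (ad a xi eta) = ad a (Ad g xi) (Ad g eta).
Proof.
have sl := msmooth_line.
pose W r := cderiv (fun s => cmap a (line xi r * line eta s * (line xi r)^-1)%g) 0.
have WE : cderiv W 0 = ad a xi eta.
  by have := mixed_conj (sl xi) (sl eta) (line0 xi) (line0 eta); rewrite !vel_line.
have sW : smooth_at W 0.
  have sw : smooth2 (fun r s => cmap a (line xi r * line eta s * (line xi r)^-1)%g) 0 0.
    apply: msm2_chart; last by rewrite !line0 invg1 !mulg1.
    apply: msm2M; last by apply: msm2V; exact: msm2_fst.
    by apply: msm2M; [exact: msm2_fst|exact: msm2_snd].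
  exact: (smooth2_at_fst (smooth2_point (smooth2_d2 convE sw))).
rewrite -WE -(cderiv_Ad g sW).
rewrite -mixed_conj; try exact: msmooth_conj; try exact: conj0 (line0 _).
apply: cderiv_ext => r.
rewrite -[W r]/(vel (fun s => line xi r * line eta s * (line xi r)^-1)%g).
rewrite -vel_conj; [|exact: msmooth_conj|by rewrite line0 mulg1 mulgV].
apply: cderiv_ext => s /=.
by rewrite !invgM invgK !mulgA !mulgVK.
Qed.

(** The Jacobi identity, as the derivative at the unit of the fact that Ad g
    preserves the bracket. *)
Lemma ad_jacobi zeta xi eta :
  ad a zeta (ad a xi eta) = ad a (ad a zeta xi) eta + ad a xi (ad a zeta eta).
Proof.
have sl := msmooth_line.
have dAd v : cderiv (fun k => Ad (line zeta k) v) 0 = ad a zeta v.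
  have := mixed_conj (sl zeta) (sl v) (line0 zeta) (line0 v).
  by rewrite !vel_line.
have sAd v : smooth_at (fun k => Ad (line zeta k) v) 0.
  have sw : smooth2 (fun r s => cmap a (line zeta r * line v s * (line zeta r)^-1)%g) 0 0.
    apply: msm2_chart; last by rewrite !line0 invg1 !mulg1.
    apply: msm2M; last by apply: msm2V; exact: msm2_fst.
    by apply: msm2M; [exact: msm2_fst|exact: msm2_snd].
  exact: (smooth2_at_fst (smooth2_point (smooth2_d2 convE sw))).
have Ad1 v : Ad (line zeta 0) v = v.
  rewrite line0 /Ad -[RHS]vel_line; congr vel; apply/funext => s.
  by rewrite mul1g invg1 mulg1.
rewrite -dAd.
have -> : (fun k => Ad (line zeta k) (ad a xi eta)) =
    (fun k => ad a (Ad (line zeta k) xi) (Ad (line zeta k) eta)).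
  by apply/funext => k; exact: Ad_ad.
by rewrite (cderiv_ad (sAd xi) (sAd eta)) !dAd !Ad1.
Qed.

(** * Logarithmic derivatives of a map from the plane *)

Lemma bmulNr xi eta : bmul xi (- eta) = - bmul xi eta.
Proof. by rewrite -scaleN1r bmulZr scaleN1r. Qed.

(** The logarithmic derivative w t s * (w t 0)^-1 depends on t through both
    factors: cderiv_diag separates them, and the second one contributes a
    value of bmul. *)
Lemma mixed_rlog w : msm2 w 0 0 -> w 0 0 = 1%g ->
  cderiv (fun t => cderiv (fun s => cmap a (w t s * (w t 0)^-1)%g) 0) 0 =
  cderiv (fun t => cderiv (fun s => cmap a (w t s)) 0) 0 - bmul (vel (w 0)) (vel (w^~ 0)).
Proof.
move=> sw w0.
have sw1 : msmooth_at A (w^~ 0) 0 by exact: msm2_at_fst (near2_point sw).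
have sw2 : msmooth_at A (w 0) 0 by exact: msm2_at_snd (near2_point sw).
pose M t t' := cderiv (fun s => cmap a (w t s * (w t' 0)^-1)%g) 0.
have sM : smooth2 M 0 0.
  apply: (@msm3_deriv (fun t t' s => w t s * (w t' 0)^-1)%g).
    apply: msm3M; first exact: (@msm3_13 w).
    apply: msm3V; apply: (@msm3_12 (fun _ t' => w t' 0)).
    exact: (@msm2_snd (w^~ 0)).
  by rewrite w0 invg1 mulg1.
rewrite (cderiv_diag convE sM); congr (_ + _).
  by apply: cderiv_ext => t; apply: cderiv_ext => s; rewrite w0 invg1 mulg1.
have w10 : (w^~ 0) 0 = 1%g by [].
have iw10 : (w 0 0)^-1%g = 1%g by rewrite w0 invg1.
rewrite -bmulNr -(velV sw1 w10).
exact: (mixed_mul_swap sw2 (msmoothV sw1) w0 iw10).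
Qed.

(** Both sides of mixed_rlog and of its mirror image contain the mixed second
    derivative of cmap a (w t s), which is symmetric; what remains are the two
    orders of bmul, and their difference is the bracket. *)
Lemma zero_curvature1 w : msm2 w 0 0 -> w 0 0 = 1%g ->
  cderiv (fun t => cderiv (fun s => cmap a (w t s * (w t 0)^-1)%g) 0) 0 =
  cderiv (fun s => cderiv (fun t => cmap a (w t s * (w 0 s)^-1)%g) 0) 0 +
  ad a (vel (w^~ 0)) (vel (w 0)).
Proof.
move=> sw w0; rewrite (mixed_rlog sw w0).
have H := mixed_rlog (msm2_swap sw) w0; rewrite H => {H}.
have sc : smooth2 (fun t s => cmap a (w t s)) 0 0 by apply: msm2_chart => //; rewrite w0.
have E1 : cderiv (fun s => cderiv (fun t => cmap a (w t s)) 0) 0 =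
          cderiv (fun t => cderiv (fun s => cmap a (w t s)) 0) 0 := schwarz convE sc.
by rewrite E1 adE addrA subrK.
Qed.

Section PlaneMap.
Variable g : R -> R -> G.
Hypothesis g_smooth : msmooth2 A g.

Lemma smooth2_rlog t s : smooth2 (fun t s => rlog a (g^~ s) t) t s.
Proof.
apply: (@smooth2_near_eq _ _ (fun t s => cderiv (fun h => cmap a (g (t + h) s * (g t s)^-1)%g) 0)).
  exists 1 => // b b' _ _.
  rewrite (cderiv_shift (fun h => cmap a (g h b' * (g b b')^-1)%g) b 0) addr0.
  by [].
apply: (@msm3_deriv (fun t s h => g (t + h) s * (g t s)^-1)%g); last by rewrite addr0 mulgV.
apply: msm3M; last by apply: msm3V; apply: (@msm3_12 g); exact: msm2_global.
exists 1 => // b b' _ _ p q r sp sq pr qr.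
apply: (@msm2_comp g (fun k h => p k + h) (fun k _ => q k)).
- apply: (smooth2D convenient_R (smooth2_fst convenient_R 0 sp)).
  exact: (smooth2_snd convenient_R r (smooth_at_id 0)).
- exact: (smooth2_fst convenient_R 0 sq).
- exact: msm2_global.
Qed.

(** The right logarithmic derivatives of g and of g times a constant agree, so
    that g t s may be assumed to be the unit. *)
Lemma zero_curvature t s :
  cderiv (fun t' => rlog a (g t') s) t =
  cderiv (fun s' => rlog a (g^~ s') t) s + ad a (rlog a (g^~ s) t) (rlog a (g t) s).
Proof.
pose w t' s' := (g (t + t') (s + s') * (g t s)^-1)%g.
have w0 : w 0 0 = 1%g by rewrite /w !addr0 mulgV.
have sw : msm2 w 0 0.
  apply: msm2M; last exact: msm2_cst.
  apply: (@msm2_comp g (fun t' _ => t + t') (fun _ s' => s + s')).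
  - apply: (smooth2_fst convenient_R (c := fun t' => t + t')).
    by apply: smooth_atD; [exact: smooth_at_cst|exact: smooth_at_id].
  - apply: (smooth2_snd convenient_R (c := fun s' => s + s')).
    by apply: smooth_atD; [exact: smooth_at_cst|exact: smooth_at_id].
  - exact: msm2_global.
have yE t' : cderiv (fun s' => cmap a (w t' s' * (w t' 0)^-1)%g) 0 = rlog a (g (t + t')) s.
  rewrite /rlog -[in RHS](addr0 s) -cderiv_shift; apply: cderiv_ext => s'.
  by rewrite /w !addr0 invgM invgK mulgA mulgVK.
have uE s' : cderiv (fun t' => cmap a (w t' s' * (w 0 s')^-1)%g) 0 = rlog a (g^~ (s + s')) t.
  rewrite /rlog -[in RHS](addr0 t) -cderiv_shift; apply: cderiv_ext => t'.
  by rewrite /w !addr0 invgM invgK mulgA mulgVK.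
have v1 : vel (w^~ 0) = rlog a (g^~ s) t.
  rewrite -[s in RHS]addr0 -uE; apply: cderiv_ext => t'.
  by rewrite /= w0 invg1 mulg1.
have v2 : vel (w 0) = rlog a (g t) s.
  rewrite -[t in RHS]addr0 -yE; apply: cderiv_ext => s'.
  by rewrite /= w0 invg1 mulg1.
have := zero_curvature1 sw w0; rewrite v1 v2.
have -> : (fun t' => cderiv (fun s' => cmap a (w t' s' * (w t' 0)^-1)%g) 0) =
    (fun t' => rlog a (g (t + t')) s) by apply/funext => t'; exact: yE.
have -> : (fun s' => cderiv (fun t' => cmap a (w t' s' * (w 0 s')^-1)%g) 0) =
    (fun s' => rlog a (g^~ (s + s')) t) by apply/funext => s'; exact: uE.
by rewrite (cderiv_shift (fun t' => rlog a (g t') s)) (cderiv_shift (fun s' => rlog a (g^~ s') t)) !addr0.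
Qed.

End PlaneMap.

End LieGroups.

(** * Transposes of the bracket, and the Jacobi equation *)

Section Transpose.
Set Implicit Arguments.
Unset Strict Implicit.
Context {R : realType} {E : tvsType R} {G : groupType}.
Variables (A : set (chart E G)) (lieG : is_lie_group A).
Variables (a : chart E G) (Aa : A a) (a1 : cdom a 1%g).
Variables (ip : E -> E -> R^o) (ip_inner : is_inner_product ip).
Variables (adT : E -> E -> E) (adTP : is_transpose a ip adT).

Lemma ipDl x y z : ip (x + y) z = ip x z + ip y z.
Proof. by case: ip_inner => sc _ _ _; have := sc z 1 x y; rewrite scale1r mul1r. Qed.

Lemma ip0l z : ip 0 z = 0.
Proof. by apply: (addrI (ip 0 z)); rewrite -ipDl !addr0. Qed.

Lemma ipZl (k : R) x z : ip (k *: x) z = k *: ip x z.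
Proof. by case: ip_inner => sc _ _ _; have := sc z k x 0; rewrite ip0l !addr0. Qed.

Lemma ipC x y : ip x y = ip y x.
Proof. by case: ip_inner. Qed.

Lemma ipDr x y z : ip z (x + y) = ip z x + ip z y.
Proof. by rewrite ipC ipDl ![ip z _]ipC. Qed.

Lemma ipZr (k : R) x z : ip z (k *: x) = k *: ip z x.
Proof. by rewrite ipC ipZl [ip z _]ipC. Qed.

(** Positivity makes the inner product nondegenerate, which determines the
    transpose and makes it linear in both arguments. *)
Lemma ip_ext v w : (forall z, ip z v = ip z w) -> v = w.
Proof.
move=> vw; apply/eqP; rewrite -subr_eq0; apply/negPn/negP => vw0.
case: ip_inner => _ _ /(_ _ vw0) + _.
by rewrite -scaleN1r ipDr ipZr vw !scaleN1r subrr ltxx.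
Qed.

Lemma adTDl x y z : adT (x + y) z = adT x z + adT y z.
Proof. by apply: ip_ext => e; rewrite ipDr -!adTP (adDl lieG Aa a1) ipDl. Qed.

Lemma adTDr x y z : adT z (x + y) = adT z x + adT z y.
Proof. by apply: ip_ext => e; rewrite ipDr -!adTP ipDr. Qed.

Lemma adTZl (k : R) x z : adT (k *: x) z = k *: adT x z.
Proof. by apply: ip_ext => e; rewrite ipZr -!adTP (adZl lieG Aa a1) ipZl. Qed.

Lemma adTZr (k : R) x z : adT z (k *: x) = k *: adT z x.
Proof. by apply: ip_ext => e; rewrite ipZr -!adTP ipZr. Qed.

(** The transpose of the Jacobi identity: ad^T is an antirepresentation. *)
Lemma adT_ad x y z : adT (ad a x y) z = adT y (adT x z) - adT x (adT y z).
Proof.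
apply: ip_ext => e; rewrite -scaleN1r ipDr ipZr -!adTP scaleN1r.
have := ad_jacobi lieG Aa a1 x y e => J.
have -> : ad a (ad a x y) e = ad a x (ad a y e) - ad a y (ad a x e).
  by rewrite J addrK.
by rewrite -[- ad a y _]scaleN1r ipDl ipZl scaleN1r.
Qed.

Lemma cderiv_adT (bT : bounded2 adT) (X Y : R -> E) t : smooth_at X t -> smooth_at Y t ->
  cderiv (fun k => adT (X k) (Y k)) t = adT (cderiv X t) (Y t) + adT (X t) (cderiv Y t).
Proof.
have convE := lie_convenient lieG.
move=> sX sY; apply: (is_cderivE convE.1).
apply: (bilinear_product_rule convE convE) => //.
- by move=> u u' v; exact: adTDl.
- by move=> u v v'; exact: adTDr.
- exact: adTZl.
- by move=> k u v; exact: adTZr.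
- by move=> X' Y'; exact: bounded_bilinear_cvg0.
Qed.

End Transpose.

Theorem mainTheorem4 (R : realType) (E : tvsType R) (G : groupType)
    (A : set (chart E G)) (lieG : is_lie_group A)
    (a : chart E G) (Aa : A a) (a1 : cdom a 1%g)
    (ip : E -> E -> R^o) (ip_inner : is_inner_product ip)
    (adT : E -> E -> E) (adTP : is_transpose a ip adT)
    (adT_bounded : bounded2 adT)
    (g : R -> R -> G) (g_smooth : msmooth2 A g)
    (g_geodesic : forall s, geodesic a A adT (fun t => g t s)) :
  let u t s := rlog a (fun t' => g t' s) t in
  let y t s := rlog a (fun s' => g t s') s in
  let y_t t s := cderiv (fun t' => y t' s) t in
  let y_tt t s := cderiv (fun t' => y_t t' s) t in
  forall t s : R,
    smooth_at (fun t' => y t' s) t /\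
    y_tt t s =
      opcomm (fun x => adT (y t s) x + ad a (y t s) x) (adT (u t s)) (u t s)
      - adT (u t s) (y_t t s)
      - alpha adT (u t s) (y_t t s)
      + ad a (u t s) (y_t t s).
Proof.
move=> u y y_t y_tt t s.
have convE := lie_convenient lieG.
have su t' s' : smooth2 u t' s' by exact: (smooth2_rlog lieG Aa a1 g_smooth).
have sy t' s' : smooth2 y t' s'.
  have gs : msmooth2 A (fun x x' => g x' x) by move=> p q r sp sq; exact: g_smooth.
  exact: (smooth2_swap (smooth2_rlog lieG Aa a1 gs s' t')).
have syt t' s' : smooth_at (fun x => y x s') t' := smooth2_at_fst (smooth2_point (sy t' s')).
split; first exact: syt.
have ytE t' : y_t t' s = d2 u t' s + ad a (u t' s) (y t' s).
  exact: (zero_curvature lieG Aa a1 g_smooth).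
have sut t' s' : smooth_at (u^~ s') t' := smooth2_at_fst (smooth2_point (su t' s')).
have ut t' s' : cderiv (u^~ s') t' = - adT (u t' s') (u t' s') := (g_geodesic s').2 t'.
have sus : smooth_at (u t) s := smooth2_at_snd (smooth2_point (su t s)).
have sd2 : smooth_at (fun t' => d2 u t' s) t.
  exact: (smooth2_at_fst (smooth2_point (smooth2_d2 convE (su t s)))).
(* the variation of the geodesic equation, after exchanging the derivatives in
   t and s *)
have uts : cderiv (fun t' => d2 u t' s) t =
    - (adT (d2 u t s) (u t s) + adT (u t s) (d2 u t s)).
  rewrite -[LHS]/(d1 (d2 u) t s) -(schwarz convE (su t s)).
  rewrite -(cderiv_adT lieG Aa a1 ip_inner adTP adT_bounded sus sus).
  rewrite /d2 -(cderivN convE).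
    by congr (cderiv _ _); apply/funext => s'; exact: ut.
  have := smoothN convE (smooth2_at_snd (smooth2_point (smooth2_d1 convE (su t s)))).
  have -> : (fun s' => - d1 u t s') = (fun s' => adT (u t s') (u t s')).
    by apply/funext => s'; rewrite /d1 ut opprK.
  by [].
have yttE : y_tt t s = - (adT (d2 u t s) (u t s) + adT (u t s) (d2 u t s)) +
    (ad a (- adT (u t s) (u t s)) (y t s) + ad a (u t s) (y_t t s)).
  rewrite /y_tt.
  have -> : (fun t' => y_t t' s) = (fun t' => d2 u t' s + ad a (u t' s) (y t' s)).
    by apply/funext.
  rewrite (cderivD convE sd2 (smooth_ad lieG Aa a1 (sut t s) (syt t s))) uts.
  by rewrite (cderiv_ad lieG Aa a1 (sut t s) (syt t s)) ut.
have usE : d2 u t s = y_t t s + ad a (y t s) (u t s).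
  by rewrite ytE [ad a (y t s) _]adN addrK.
rewrite yttE usE /opcomm /alpha.
move: (u t s) (y t s) (y_t t s) => U Y Yt.
have aD := adTDl lieG Aa a1 ip_inner adTP; have aDr := adTDr ip_inner adTP.
rewrite aD (aDr Yt (ad a Y U)) (aDr (adT Y U) (ad a Y U)) (adT_ad lieG Aa a1 ip_inner adTP) [ad a (- _) _]adN.
have -> : ad a Y (- adT U U) = - ad a Y (adT U U).
  by rewrite -scaleN1r (adZr lieG Aa a1) scaleN1r.
rewrite opprK; move: (adT Yt U) (adT U (adT Y U)) (adT Y (adT U U)) (adT U Yt)
  (adT U (ad a Y U)) (ad a Y (adT U U)) (ad a U Yt) => B1 B2 B3 B4 B5 B6 B7.
rewrite !opprD opprK !addrA; congr (_ + _).
by rewrite [LHS](ACl (3 * 6 * 2 * 5 * 4 * 1)).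
Qed.
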